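(* Let $\mathcal V$ be a complex vector space, $A:\mathcal V\to\mathcal V$ a linear operator, and $b,c\in\mathcal V$. Let $\mathcal D\subseteq \mathcal V'$ be an admissible set for the data $(A,b,c)$. Define a Hermitian form $\mathcal F$ on $\mathcal D\times\mathcal D$ by $$\mathcal F(x',y')=\sum_{j=0}^\infty\Big[(A^jc,x')\overline{(A^jc,y')}-(A^jb,x')\overline{(A^jb,y')}\Big],\qquad x',y'\in\mathcal D.$$ Let $\kappa$ be a nonnegative integer. (1) If $\mathcal F$ has $\kappa$ negative squares, then there is a pair $(f,B)$, where $f\in\mathbf S_0$ and $B$ is a Blaschke product of degree $\kappa$, such that $f(A)c=B(A)b$. (2) If there is a pair $(f,B)$ with $f\in\mathbf S_0$ and $B$ a Blaschke product of degree $\kappa$ such that $f(A)c=B(A)b$, then $\mathcal F$ has $\kappa'$ negative squares for some $\kappa'\le\kappa$.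
   Context: $\mathbf D$ is the open unit disk. $\mathbf S_0$ is the Schur class: holomorphic functions on $\mathbf D$ bounded by one in modulus. A Blaschke product of degree $\kappa$ is a function $B(z)=\gamma\prod_{j=1}^\kappa \frac{z-a_j}{1-z\bar a_j}$ with $|\gamma|=1$ and $a_1,\dots,a_\kappa\in\mathbf D$ not necessarily distinct (for $\kappa=0$, a constant of modulus one). $\mathcal V'$ is the algebraic dual of $\mathcal V$; write $(x,x')=x'(x)$ for $x\in\mathcal V$, $x'\in\mathcal V'$; $A':\mathcal V'\to\mathcal V'$ is the dual operator, $(x,A'x')=(Ax,x')$. A set $\mathcal D\subseteq\mathcal V'$ is admissible for $(A,b,c)$ if: (i) $\mathcal D$ is a linear subspace of $\mathcal V'$ invariant under $A'$; (ii) the sums $\sum_{j=0}^\infty|(A^jb,x')|^2$ and $\sum_{j=0}^\infty|(A^jc,x')|^2$ are finite for all $x'\in\mathcal D$; (iii) if some $x'\in\mathcal D$ annihilates $c,Ac,A^2c,\dots$, then $x'$ annihilates $b,Ab,A^2b,\dots$. For $f(z)=\sum_{j\ge0} f_jz^j$ and $B(z)=\sum_{j\ge0}B_jz^j$ in the Hardy space $H^2$ of the disk, the equation $f(A)c=B(A)b$ means, by definition (relative to $\mathcal D$), that $\sum_{j=0}^\infty f_j(A^jc,x')=\sum_{j=0}^\infty B_j(A^jb,x')$ for all $x'\in\mathcal D$. A Hermitian form (kernel) $K(\zeta,z)=\overline{K(z,\zeta)}$ on $\Omega\times\Omega$ has $\kappa$ negative squares if every selfadjoint matrix $(K(\zeta_j,\zeta_i))_{i,j=1}^n$,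 with $\zeta_1,\dots,\zeta_n\in\Omega$, $n\ge1$, has at most $\kappa$ negative eigenvalues (counting multiplicity) and at least one such matrix has exactly $\kappa$. *)

(* Defs.v *)
From HB Require Import structures.
From mathcomp Require Import all_boot all_order all_algebra.
From mathcomp Require Import all_classical all_reals all_analysis.
From mathcomp Require Import complex.

Set Implicit Arguments.
Unset Strict Implicit.
Unset Printing Implicit Defensive.

Import Order.TTheory GRing.Theory Num.Theory.
Import numFieldNormedType.Exports.

Local Open Scope classical_set_scope.
Local Open Scope ring_scope.

(* The complex numbers are R[i] for an arbitrary R : realType. The alias
   R[i]^o carries the topology of the modulus, so limits and complex
   derivatives are taken there. On R[i], z < 0 means that z is real and
   negative, and `|z| is the modulus seen as an element of R[i]. *)

Definition unit_disk (R : realType) : set R[i] := [set z | `|z| < 1].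

(* Only the values on the disk matter. derivable at z in the direction 1, over
   the scalar field R[i], is complex differentiability. *)
Definition schur_class (R : realType) (f : R[i]^o -> R[i]^o) : Prop :=
  forall z : R[i]^o, unit_disk z -> derivable f z 1 /\ `|f z| <= 1.

Definition blaschke_product (R : realType) (k : nat) (B : R[i] -> R[i]) : Prop :=
  exists (g : R[i]) (a : 'I_k -> R[i]),
    [/\ `|g| = 1,
        forall j, unit_disk (a j)
      & forall z, unit_disk z ->
          B z = g * \prod_(j < k) ((z - a j) / (1 - z * (a j)^*))].

Definition power_series_on_disk (R : realType) (f : R[i] -> R[i])
    (u : nat -> R[i]) : Prop :=
  forall z, unit_disk z ->
    series (fun j => u j * z ^+ j : R[i]^o) @ \oo --> (f z : R[i]^o).

Definition square_summable (R : realType) (u : nat -> R[i]) : Prop :=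
  cvgn (series (fun j => `|u j| ^+ 2 : R[i]^o)).

Definition algebraic_dual (R : realType) (V : lmodType R[i]) :
    set (V -> R[i]) := [set x' | scalar x'].

Definition is_subspace (R : realType) (V : lmodType R[i])
    (D : set (V -> R[i])) : Prop :=
  [/\ D `<=` @algebraic_dual R V,
      D (fun=> 0)
    & forall (a : R[i]) x' y', D x' -> D y' -> D (fun v => a * x' v + y' v)].

Definition dual_operator (R : realType) (V : lmodType R[i])
  (A : V -> V) (x' : V -> R[i]) : V -> R[i] := x' \o A.

Definition admissible (R : realType) (V : lmodType R[i])
    (A : {linear V -> V}) (b c : V) (D : set (V -> R[i])) : Prop :=
  [/\ is_subspace D /\ (forall x', D x' -> D (dual_operator A x')),
      forall x', D x' ->
        square_summable (fun j => x' (iter j A b)) /\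
        square_summable (fun j => x' (iter j A c))
    & forall x', D x' -> (forall j, x' (iter j A c) = 0) ->
        forall j, x' (iter j A b) = 0].

(* f(A)c = B(A)b relative to D. The Taylor coefficients are determined by f
   and B; the relation is used only for bounded f and B, which are in H^2. *)
Definition calculus_eq (R : realType) (V : lmodType R[i])
    (A : {linear V -> V}) (b c : V) (D : set (V -> R[i]))
    (f B : R[i] -> R[i]) : Prop :=
  exists fs Bs : nat -> R[i],
    [/\ power_series_on_disk f fs,
        power_series_on_disk B Bs
      & forall x', D x' -> exists s : R[i]^o,
          series (fun j => fs j * x' (iter j A c) : R[i]^o) @ \oo --> s /\
          series (fun j => Bs j * x' (iter j A b) : R[i]^o) @ \oo --> s].

Definition hermitian_form (R : realType) (V : lmodType R[i])
    (A : {linear V -> V}) (b c : V) (x' y' : V -> R[i]) : R[i] :=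
  limn (series (fun j =>
    x' (iter j A c) * (y' (iter j A c))^*
    - x' (iter j A b) * (y' (iter j A b))^* : R[i]^o)).

(* The roots of the characteristic polynomial, repeated by multiplicity. *)
Definition eigenvalue_seq (R : realType) (n : nat) (M : 'M[R[i]]_n) :
    seq R[i] :=
  sval (closed_field_poly_normal (char_poly M)).

Definition num_neg_eigenvalues (R : realType) (n : nat) (M : 'M[R[i]]_n) : nat :=
  count (fun z => z < 0) (eigenvalue_seq M).

Definition kernel_matrix (R : realType) (T : Type) (K : T -> T -> R[i])
    (n : nat) (x : 'I_n -> T) : 'M[R[i]]_n :=
  \matrix_(i, j) K (x j) (x i).

Definition has_negative_squares (R : realType) (T : Type) (Omega : set T)
    (K : T -> T -> R[i]) (k : nat) : Prop :=
  [/\ forall x y, Omega x -> Omega y -> K x y = (K y x)^*,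
      forall (n : nat) (x : 'I_n -> T), (0 < n)%N -> (forall i, Omega (x i)) ->
        (num_neg_eigenvalues (kernel_matrix K x) <= k)%N
    & exists (n : nat) (x : 'I_n -> T),
        [/\ (0 < n)%N, forall i, Omega (x i)
          & num_neg_eigenvalues (kernel_matrix K x) = k]].

(* Main.v *)
Require Import Defs.
From HB Require Import structures.
From mathcomp Require Import all_boot all_order all_algebra.
From mathcomp Require Import all_classical all_reals all_analysis.
From mathcomp Require Import complex.
From mathcomp Require Import zify ring lra.
From mathcomp Require cyclic separable cyclotomic.

Set Implicit Arguments.
Unset Strict Implicit.
Unset Printing Implicit Defensive.

Import Order.TTheory GRing.Theory Num.Theory.
Import numFieldNormedType.Exports.

Local Open Scope classical_set_scope.
Local Open Scope ring_scope.

(* Let c, b be functionals on a space W with an operator A, both with square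
   summable orbits, and Q(x, y) = <c(A^j x), c(A^j y)> - <b(A^j x), b(A^j y)>.

   If Q has at most k + 1 negative squares, there is a with |a| < 1 such that
   adding to Q the rank one form of the normalised Szego functional
   s_a(x) = sqrt(1 - |a|^2) sum_j a^j b(A^j x) leaves at most k negative squares.
   Up to a small perturbation that makes all forms nondegenerate, a is found from
   an eigenvector with eigenvalue of modulus > 1 of the pencil of the Stein
   equation Q(x, y) + b(x) b(y)^* = Q(A x, A y) + c(x) c(y)^*; the perturbation is
   removed by compactness of the closed disk. Since
   Q + s_a s_a^* is the form of the pair (c, b'), where the orbits of b' arise from
   those of b by a Blaschke factor of the backward shift, k steps produce a
   Blaschke product of degree k and a nonnegative form. For a nonnegative form
   the map c(A^j x) |-> b(A^j x) is a contraction, which is extended to the unit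
   vectors of l^2 one at a time while commuting with the backward shift; the first
   coordinates of the images are the Taylor coefficients of f.

   Conversely, f and B make the form of the pair (c, b') nonnegative, because a
   Schur function acts as a contraction on l^2, and passing from b to b' changes
   Q by k rank one forms. *)

(** * Limits and square summable sequences *)

(** Why one Szego functional absorbs a negative square: if Q(g, g) < 0, then Q(w, w) + |Q(w, g)|^2 /
    (- Q(g, g)) is Q evaluated at the projection of w to the orthogonal complement of g, so one
    negative square is gone. For an eigenvector g with eigenvalue mu and a = 1 / conj(mu), the
    pencil reads Q(w, g) = a Q(A w, g) - b(w) conj(b(g)). Iterated, it expresses Q(w, g) as -
    conj(b(g)) sum_j a^j b(A^j w) up to a^m Q(A^m w, g), which dies out along the orbit. Together
    with |b(g)|^2 <= (1 - |a|^2) (- Q(g, g)) this bounds the added term by |s_a(w)|^2. The obstacle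
    is that eigenvectors require finite dimension, while finite spans need not be invariant under A
    and Q may be degenerate on them. The pencil is therefore compressed to polynomials of bounded
    size, where A is multiplication by a power of X and the perturbation is a multiple of the
    coefficient inner product, which that multiplication preserves. All errors must then be
    controlled relative to - Q(g, g), of which no lower bound is known beforehand; a definite
    majorant of Q serves this purpose. *)

Section Modulus.
Variable R : realType.
Local Notation C := R[i].
Implicit Types x y z : C.

(** The modulus is taken in [R] rather than in [R[i]], so that estimates live in a totally ordered
    field where [lra] and [nra] apply. *)
Definition nm z : R := complex.Re `|z|.

Lemma nmE z : `|z| = (nm z)%:C%C.
Proof. by rewrite /nm normc_def. Qed.

Lemma nm_ge0 z : 0 <= nm z.
Proof. by rewrite /nm normc_def /= sqrtr_ge0. Qed.

Lemma nm0 : nm 0 = 0.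
Proof. by apply: complexI; rewrite -nmE normr0. Qed.

Lemma nm1 : nm 1 = 1.
Proof. by apply: complexI; rewrite -nmE normr1. Qed.

Lemma nm_eq0 z : (nm z == 0) = (z == 0).
Proof. by rewrite -[RHS]normr_eq0 nmE; apply/eqP/eqP => [->//|/complexI]. Qed.

Lemma nmM x y : nm (x * y) = nm x * nm y.
Proof. by apply: complexI; rewrite -nmE normrM !nmE -rmorphM. Qed.

Lemma nmX x n : nm (x ^+ n) = nm x ^+ n.
Proof. by elim: n => [|n IH]; rewrite ?expr0 ?nm1// !exprS nmM IH. Qed.

Lemma nmN x : nm (- x) = nm x.
Proof. by rewrite /nm normrN. Qed.

Lemma nmB x y : nm (x - y) = nm (y - x).
Proof. by rewrite -nmN opprB. Qed.

Lemma nmD x y : nm (x + y) <= nm x + nm y.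
Proof. by rewrite -lecR rmorphD /= -!nmE ler_normD. Qed.

Lemma nm_conj x : nm x^* = nm x.
Proof. by rewrite /nm norm_conjC. Qed.

Lemma nm_real (r : R) : nm r%:C%C = `|r|.
Proof. by rewrite /nm normc_def /= expr0n /= addr0 sqrtr_sqr. Qed.

Lemma nm_sqr x : x * x^* = (nm x ^+ 2)%:C%C.
Proof. by rewrite -normCK nmE rmorphXn. Qed.

Lemma conjE x : x^* = conjc x.
Proof.
have [->|x0] := eqVneq x 0; first by rewrite rmorph0 conjc0.
by apply: (mulfI x0); rewrite -sqr_normc normCK.
Qed.

Lemma nm_ReIm x : nm x ^+ 2 = complex.Re x ^+ 2 + complex.Im x ^+ 2.
Proof. by apply: complexI; rewrite rmorphXn /= -nmE add_Re2_Im2. Qed.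

Lemma nm_Re x : `|complex.Re x| <= nm x.
Proof. by rewrite -lecR -nmE normc_ge_Re. Qed.

Lemma nm_Im x : `|complex.Im x| <= nm x.
Proof.
rewrite -(@ler_pXn2r _ 2) ?nnegrE ?nm_ge0// real_normK ?num_real//.
by rewrite nm_ReIm lerDr sqr_ge0.
Qed.

Lemma nm_sum (I : Type) (r : seq I) (P : pred I) (F : I -> C) :
  nm (\sum_(i <- r | P i) F i) <= \sum_(i <- r | P i) nm (F i).
Proof.
elim/big_ind2: _ => //; first by rewrite nm0.
by move=> x1 x2 y1 y2 h1 h2; apply: (le_trans (nmD _ _)); apply: lerD.
Qed.

Lemma nm_leReIm x : nm x <= `|complex.Re x| + `|complex.Im x|.
Proof.
rewrite {1}[x]complexE; apply: (le_trans (nmD _ _)).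
rewrite nmM !nm_real; apply: lerD => //.
by rewrite /nm normc_def /= expr0n expr1n /= add0r sqrtr1 mul1r.
Qed.

Lemma normC_le1 z : (`|z| <= 1) = (nm z <= 1).
Proof. by rewrite nmE -[X in _ <= X](rmorph1 (real_complex R)) lecR. Qed.

Lemma normC_lt1 z : (`|z| < 1) = (nm z < 1).
Proof. by rewrite nmE -[X in _ < X](rmorph1 (real_complex R)) ltcR. Qed.

Lemma nmr_eq1 z : `|z| = 1 -> nm z = 1.
Proof. by rewrite /nm => ->. Qed.

End Modulus.

Section Limits.
Variable R : realType.
Local Notation C := R[i].

(** Convergence is expressed by a real null sequence, so that most limits follow by domination with
    [null_le]; [climP] is the link with the topology of [R[i]^o] in the statement. *)
Definition clim (u : nat -> C) (l : C) : Prop :=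
  (fun n => nm (u n - l)) @ \oo --> (0 : R).

Lemma null_le (u v : nat -> R) : (forall n, 0 <= u n) ->
  (forall n, u n <= v n) -> v @ \oo --> (0 : R) -> u @ \oo --> (0 : R).
Proof.
move=> u0 uv v0; apply: (@squeeze_cvgr _ _ _ _ (cst 0) v) => //.
  by near=> n; rewrite /cst u0 uv.
exact: cvg_cst.
Unshelve. all: by end_near. Qed.

Lemma climP (u : nat -> C) l : clim u l <-> (u : nat -> C^o) @ \oo --> (l : C^o).
Proof.
split.
  move=> ul; apply/cvgrPdist_le => /= e e0.
  have /complex_realP[r er] : e \is Num.real by rewrite gtr0_real.
  have r0 : 0 < r by rewrite -ltcR -er.
  move/cvgrPdist_le : ul => /(_ r r0) H.
  near=> n; rewrite er -normrN opprB nmE lecR.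
  have : `|0 - nm (u n - l)| <= r by near: n.
  by rewrite sub0r normrN ger0_norm ?nm_ge0.
move=> /cvgrPdist_le /= ul; apply/cvgrPdist_le => /= e e0.
have := ul e%:C%C; rewrite -[X in X < _](rmorph0 (real_complex R)) ltcR => /(_ e0) H.
near=> n; rewrite sub0r normrN ger0_norm ?nm_ge0// -lecR -nmE -normrN opprB.
by near: n.
Unshelve. all: by end_near. Qed.

Lemma clim_unique (u : nat -> C) l l' : clim u l -> clim u l' -> l = l'.
Proof.
move=> h h'; apply/eqP; rewrite -subr_eq0 -nm_eq0; apply/eqP.
have : (fun n => nm (u n - l) + nm (u n - l')) @ \oo --> (0 : R).
  by rewrite -[X in _ --> X](addr0 (0:R)); exact: cvgD h h'.
move=> hc.
have /(cvg_unique (@Rhausdorff R)) : (fun=> nm (l - l')) @ \oo --> (0 : R).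
  apply: null_le hc => [n|n]; first exact: nm_ge0.
  by rewrite (nmB (u n)) -(subrKA (u n) l); exact: nmD.
by move=> /(_ _ (cvg_cst _)) ->.
Qed.

Lemma clim_cst l : clim (fun=> l) l.
Proof.
apply: (@null_le _ (fun=> 0)); last exact: cvg_cst.
  by move=> n; exact: nm_ge0.
by move=> n; rewrite subrr nm0.
Qed.

Lemma climD u v l m : clim u l -> clim v m -> clim (fun n => u n + v n) (l + m).
Proof.
move=> h h'; apply: (@null_le _ (fun n => nm (u n - l) + nm (v n - m))).
- by move=> n; exact: nm_ge0.
- by move=> n; rewrite opprD addrACA; exact: nmD.
- by rewrite -[X in _ --> X](addr0 (0:R)); exact: cvgD h h'.
Qed.

Lemma climZ a u l : clim u l -> clim (fun n => a * u n) (a * l).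
Proof.
move=> h; have : (fun n => nm a * nm (u n - l)) @ \oo --> nm a * 0.
  by apply: cvgM h; exact: cvg_cst.
by rewrite mulr0; apply: null_le => [n|n]; rewrite ?nm_ge0// -mulrBr nmM.
Qed.

Lemma climN u l : clim u l -> clim (fun n => - u n) (- l).
Proof.
move=> /(climZ (-1)); rewrite mulN1r; congr (clim _ _).
by apply/funext => n; rewrite mulN1r.
Qed.

Lemma climB u v l m : clim u l -> clim v m -> clim (fun n => u n - v n) (l - m).
Proof. by move=> h /climN h'; exact: climD. Qed.

Lemma clim_conj u l : clim u l -> clim (fun n => (u n)^*) l^*.
Proof.
apply: null_le => [n|n]; first exact: nm_ge0.
by rewrite -rmorphB nm_conj.
Qed.

Lemma clim_nm u l : clim u l -> (fun n => nm (u n)) @ \oo --> nm l.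
Proof.
move=> h; apply/cvgrPdist_le => /= e e0.
move/cvgrPdist_le : h => /(_ e e0) h; near=> n.
have : `|0 - nm (u n - l)| <= e by near: n.
rewrite sub0r normrN ger0_norm ?nm_ge0// => /(le_trans _); apply.
rewrite ler_norml; apply/andP; split.
  by rewrite lerNl opprB lerBlDr -{1}(subrK l (u n)) nmD.
by rewrite lerBlDr nmB -{1}(subrK (u n) l) nmD.
Unshelve. all: by end_near. Qed.

Lemma clim0 u : clim u 0 <-> (fun n => nm (u n)) @ \oo --> (0 : R).
Proof.
suff -> : (fun n => nm (u n)) = (fun n => nm (u n - 0)) by [].
by apply/funext => n; rewrite subr0.
Qed.

Lemma clim_nmle u l M : clim u l -> (forall n, nm (u n) <= M) -> nm l <= M.
Proof.
move=> /clim_nm h uM; apply: (cvgr_to_le h); exact: nearW.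
Qed.

End Limits.

Section HermitianForms.
Variables (R : realType) (X : lmodType R[i]).
Local Notation C := R[i].
Implicit Types (Q : X -> X -> C) (x y z : X).

Definition hermitian_sesquilinear Q : Prop :=
  (forall a x y z, Q (a *: x + y) z = a * Q x z + Q y z) /\
  (forall x y, Q x y = (Q y x)^*).

Definition qf Q x : R := complex.Re (Q x x).

Section Theory.
Variable Q : X -> X -> C.
Hypothesis hQ : hermitian_sesquilinear Q.

Lemma hsC x y : Q x y = (Q y x)^*. Proof. exact: hQ.2. Qed.

Lemma hsPl a x y z : Q (a *: x + y) z = a * Q x z + Q y z.
Proof. exact: hQ.1. Qed.

Lemma hsDl x y z : Q (x + y) z = Q x z + Q y z.
Proof. by have := hsPl 1 x y z; rewrite scale1r mul1r. Qed.

Lemma hs0l z : Q 0 z = 0.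
Proof. by have := hsDl 0 0 z; rewrite addr0 => /(congr1 (+%R (- Q 0 z))); rewrite addNr addKr. Qed.

Lemma hsZl a x z : Q (a *: x) z = a * Q x z.
Proof. by have := hsPl a x 0 z; rewrite addr0 hs0l addr0. Qed.

Lemma hsDr x y z : Q x (y + z) = Q x y + Q x z.
Proof. by rewrite hsC hsDl rmorphD /= -!(hsC x). Qed.

Lemma hsZr a x z : Q x (a *: z) = a^* * Q x z.
Proof. by rewrite hsC hsZl rmorphM /= -(hsC x). Qed.

Lemma hsNl x z : Q (- x) z = - Q x z.
Proof. by rewrite -scaleN1r hsZl mulN1r. Qed.

Lemma hsNr x z : Q x (- z) = - Q x z.
Proof. by rewrite hsC hsNl rmorphN /= -(hsC x). Qed.

Lemma hs0r z : Q z 0 = 0.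
Proof. by rewrite hsC hs0l conjC0. Qed.

Lemma hs_suml (I : Type) (r : seq I) (P : pred I) (F : I -> X) z :
  Q (\sum_(i <- r | P i) F i) z = \sum_(i <- r | P i) Q (F i) z.
Proof. by elim/big_rec2: _ => [|i y1 y2 _ <-]; rewrite ?hs0l// hsDl. Qed.

Lemma hs_sumr (I : Type) (r : seq I) (P : pred I) (F : I -> X) z :
  Q z (\sum_(i <- r | P i) F i) = \sum_(i <- r | P i) Q z (F i).
Proof. by elim/big_rec2: _ => [|i y1 y2 _ <-]; rewrite ?hs0r// hsDr. Qed.

Lemma qfE x : Q x x = (qf Q x)%:C%C.
Proof.
have := hsC x x; rewrite conjE /qf; case: (Q x x) => a b /= [] /eqP.
by rewrite -addr_eq0 -mulr2n mulrn_eq0 /= => /eqP ->.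
Qed.

Lemma qf0 : qf Q 0 = 0.
Proof. by rewrite /qf hs0l. Qed.

Lemma qfZ a x : qf Q (a *: x) = nm a ^+ 2 * qf Q x.
Proof.
by rewrite /qf hsZl hsZr mulrA nm_sqr qfE /= !mul0r subr0.
Qed.

Lemma qfN x : qf Q (- x) = qf Q x.
Proof. by rewrite /qf hsNl hsNr opprK. Qed.

Lemma qfD x y : qf Q (x + y) = qf Q x + 2 * complex.Re (Q x y) + qf Q y.
Proof.
rewrite /qf hsDl !hsDr (hsC y x) conjE !raddfD /=; case: (Q x y) => a b /=; ring.
Qed.

Lemma qfDZ a x y :
  qf Q (x + a *: y) = qf Q x + 2 * complex.Re (a^* * Q x y) + nm a ^+ 2 * qf Q y.
Proof. by rewrite qfD qfZ hsZr. Qed.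

Lemma qf_convex (s : R) x y :
  qf Q ((1 - s)%:C%C *: x + s%:C%C *: y) =
  (1 - s) * qf Q x + s * qf Q y - s * (1 - s) * qf Q (x - y).
Proof.
rewrite (qfD (_ *: x)) !qfZ (qfD x) qfN hsNr hsZl hsZr !nm_real !real_normK ?num_real//.
rewrite conjE; case: (Q x y) => a b /= ; ring.
Qed.

Hypothesis Qpos : forall x, 0 <= qf Q x.

Lemma hs_cauchy_schwarz x y : nm (Q x y) ^+ 2 <= qf Q x * qf Q y.
Proof.
set n := nm (Q x y); set p := qf Q x; set r := qf Q y.
have key (t : R) : 0 <= p - 2 * t * n ^+ 2 + t ^+ 2 * n ^+ 2 * r.
  have := Qpos (x + (- t%:C%C * Q x y) *: y); rewrite qfDZ.
  rewrite nmM nmN nm_real exprMn real_normK ?num_real// -/n -/p -/r.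
  have -> : (- t%:C%C * Q x y)^* * Q x y = (- t * n ^+ 2)%:C%C.
    rewrite rmorphM /= -mulrA [(Q x y)^* * _]mulrC nm_sqr -/n.
    by rewrite rmorphN /= (conjE t%:C%C) conjc_real -rmorphN -rmorphM.
  by rewrite /= => h; apply: le_trans h _; lra.
have p0 : 0 <= p := Qpos x; have r0 : 0 <= r := Qpos y.
have [->|n0] := eqVneq n 0; first by rewrite expr0n mulr_ge0.
have n2 : 0 < n ^+ 2 by rewrite exprn_even_gt0.
have [r_eq|rn0] := eqVneq r 0.
  (* For a degenerate direction the polynomial is affine in t, and this t turns it into p - 2 (p +
     1) < 0. *)
  have := key ((p + 1) / n ^+ 2); rewrite r_eq mulr0 addr0 -mulrA divfK ?gt_eqF//.
  by move=> h; exfalso; lra.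
have rp : 0 < r by rewrite lt_neqAle eq_sym rn0.
have := key r^-1; rewrite -ler_pdivrMr// => h.
have e : r^-1 ^+ 2 * n ^+ 2 * r = n ^+ 2 / r by field.
have e2 : 2 * r^-1 * n ^+ 2 = 2 * (n ^+ 2 / r) by ring.
by move: h; rewrite e e2; lra.
Qed.

End Theory.
End HermitianForms.

Section SquareSummable.
Variable R : realType.
Local Notation C := R[i].
Implicit Types u v : nat -> C.

(** The value 0 is a default for divergent series; convergence is supplied by [csumP] (absolute
    convergence) or by a known limit through [csum_eq]. *)
Definition csum u : C := xget 0 [set l | clim (fun n => \sum_(j < n) u j) l].

Lemma csum_eq u l : clim (fun n => \sum_(j < n) u j) l -> csum u = l.
Proof.
move=> h; rewrite /csum; case: xgetP => [x _ /= hx|/(_ l)//].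
exact: clim_unique hx h.
Qed.

Lemma real_series_cvg (t : nat -> R) (M : R) :
  (forall n, \sum_(j < n) `|t j| <= M) -> exists l : R, (fun n => \sum_(j < n) t j) @ \oo --> l.
Proof.
move=> tM; have : cvgn [normed series t].
  apply: nondecreasing_is_cvgn; first by apply/nondecreasing_seqP => n; rewrite /normed_series_of seriesSr lerDl normr_ge0.
  by exists M => _ [n _ <-]; rewrite /normed_series_of seriesEord; exact: tM.
move=> /normed_cvg /cvg_ex[l hl]; exists l.
by move: hl; rewrite seriesEord.
Qed.

Lemma cvg_dist0 (t : nat -> R) (a : R) :
  t @ \oo --> a <-> (fun n => `|t n - a|) @ \oo --> (0 : R).
Proof.
split=> /cvgrPdist_le h; apply/cvgrPdist_le => e e0; have := h e e0;
  by apply: filterS => n; rewrite sub0r normrN normr_id distrC.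
Qed.

Lemma csumP u (M : R) : (forall n, \sum_(j < n) nm (u j) <= M) ->
  clim (fun n => \sum_(j < n) u j) (csum u).
Proof.
move=> uM.
have [a ha] : exists l : R, (fun n => \sum_(j < n) complex.Re (u j)) @ \oo --> l.
  apply: (@real_series_cvg (fun j => complex.Re (u j)) M) => n; apply: le_trans (uM n).
  by apply: ler_sum => i _; exact: nm_Re.
have [b hb] : exists l : R, (fun n => \sum_(j < n) complex.Im (u j)) @ \oo --> l.
  apply: (@real_series_cvg (fun j => complex.Im (u j)) M) => n; apply: le_trans (uM n).
  by apply: ler_sum => i _; exact: nm_Im.
suff h : clim (fun n => \sum_(j < n) u j) (a +i* b)%C by rewrite (csum_eq h).
have /cvg_dist0 ha' := ha; have /cvg_dist0 hb' := hb.
have : (fun n => `|\sum_(j < n) complex.Re (u j) - a| + `|\sum_(j < n) complex.Im (u j) - b|)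
  @ \oo --> (0 : R) + 0 by exact: cvgD ha' hb'.
rewrite addr0; apply: null_le => n; first exact: nm_ge0.
apply: (le_trans (nm_leReIm _)); rewrite !raddfB /=.
have sRe (I : Type) (r : seq I) (F : I -> C) :
    complex.Re (\sum_(i <- r) F i) = \sum_(i <- r) complex.Re (F i).
  by elim/big_rec2: _ => // i y1 y2 _ <-; case: (F i) => ? ?; case: y2.
have sIm (I : Type) (r : seq I) (F : I -> C) :
    complex.Im (\sum_(i <- r) F i) = \sum_(i <- r) complex.Im (F i).
  by elim/big_rec2: _ => // i y1 y2 _ <-; case: (F i) => ? ?; case: y2.
by rewrite sRe sIm.
Qed.

Definition l2 u : Prop := exists M : R, forall n, \sum_(j < n) nm (u j) ^+ 2 <= M.

Definition ip u v : C := csum (fun j => u j * (v j)^*).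

Lemma ipP u v : l2 u -> l2 v -> clim (fun n => \sum_(j < n) u j * (v j)^*) (ip u v).
Proof.
move=> [M hM] [M' hM']; apply: (@csumP _ (M + M')) => n.
apply: le_trans (lerD (hM n) (hM' n)); rewrite -big_split /=; apply: ler_sum => i _.
rewrite nmM nm_conj; have := sqr_ge0 (nm (u i) - nm (v i)).
by have := sqr_ge0 (nm (u i) + nm (v i)); nra.
Qed.

Lemma l2D a u v : l2 u -> l2 v -> l2 (fun j => a * u j + v j).
Proof.
move=> [M hM] [M' hM']; exists (2 * nm a ^+ 2 * M + 2 * M') => n.
apply: le_trans (_ : \sum_(j < n) (2 * nm a ^+ 2 * nm (u j) ^+ 2 + 2 * nm (v j) ^+ 2) <= _).
  apply: ler_sum => i _; have h := nmD (a * u i) (v i); rewrite nmM in h.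
  have h0 := nm_ge0 (a * u i + v i).
  apply: le_trans (_ : (nm a * nm (u i) + nm (v i)) ^+ 2 <= _).
    by rewrite ler_pXn2r ?nnegrE // (le_trans h0 h).
  have := sqr_ge0 (nm a * nm (u i) - nm (v i)); nra.
rewrite big_split /= -!mulr_sumr; apply: lerD.
  by apply: ler_wpM2l; [apply: mulr_ge0; rewrite ?sqr_ge0|exact: hM].
by apply: ler_wpM2l => //; exact: hM'.
Qed.

Definition seqshift u : nat -> C := fun j => u j.+1.

Lemma l2_seqshift u : l2 u -> l2 (seqshift u).
Proof.
move=> [M hM]; exists M => n; apply: le_trans (hM n.+1).
by rewrite big_ord_recl lerDr sqr_ge0.
Qed.

Lemma ip_linear a u v w : l2 u -> l2 v -> l2 w ->
  ip (fun j => a * u j + v j) w = a * ip u w + ip v w.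
Proof.
move=> hu hv hw; apply: csum_eq.
have := climD (climZ a (ipP hu hw)) (ipP hv hw).
congr clim; apply/funext => n; rewrite mulr_sumr -big_split /=.
by apply: eq_bigr => i _; ring.
Qed.

Lemma ipC u v : l2 u -> l2 v -> ip u v = (ip v u)^*.
Proof.
move=> hu hv; apply: csum_eq; have := clim_conj (ipP hv hu).
congr clim; apply/funext => n; rewrite rmorph_sum /=; apply: eq_bigr => i _.
by rewrite rmorphM /= conjCK mulrC.
Qed.

Definition sq u : R := complex.Re (ip u u).

Lemma sq_cvg u : l2 u -> (fun n => \sum_(j < n) nm (u j) ^+ 2) @ \oo --> sq u.
Proof.
move=> hu; have h := ipP hu hu; apply/cvg_dist0; move: h; apply: null_le => n.
  exact: normr_ge0.
apply: le_trans (nm_Re _); rewrite raddfB /= -/(sq u).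
by under [X in _ <= `|complex.Re X - _|]eq_bigr do rewrite nm_sqr; rewrite -rmorph_sum.
Qed.

Lemma sq_ub u n : l2 u -> \sum_(j < n) nm (u j) ^+ 2 <= sq u.
Proof.
move=> hu; apply: (cvgr_to_ge (sq_cvg hu)); exists n => // m /= nm.
rewrite -(subnKC nm) big_split_ord /= lerDl; apply: sumr_ge0 => i _; exact: sqr_ge0.
Qed.

Lemma sq_le u (M : R) : (forall n, \sum_(j < n) nm (u j) ^+ 2 <= M) -> sq u <= M.
Proof.
by move=> hM; apply: (cvgr_to_le (sq_cvg (ex_intro _ M hM))); exact: nearW.
Qed.

Lemma sq_ge0 u : l2 u -> 0 <= sq u.
Proof. by move=> /(sq_ub 0); rewrite big_ord0. Qed.

Lemma ip_shift u v : l2 u -> l2 v -> ip u v = u 0%N * (v 0%N)^* + ip (seqshift u) (seqshift v).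
Proof.
move=> hu hv; apply: (@clim_unique _ (fun n => \sum_(j < n.+1) u j * (v j)^*)).
  by move: (ipP hu hv); rewrite /clim -cvg_shiftS.
have := climD (clim_cst (u 0%N * (v 0%N)^*)) (ipP (l2_seqshift hu) (l2_seqshift hv)).
by congr clim; apply/funext => n; rewrite big_ord_recl.
Qed.

Lemma shiftnE u m j : iter m seqshift u j = u (m + j)%N.
Proof. by elim: m j => //= m IH j; rewrite /seqshift IH addnS. Qed.

Lemma l2_shiftn u m : l2 u -> l2 (iter m seqshift u).
Proof. by move=> hu; elim: m => //= m; exact: l2_seqshift. Qed.

Lemma sq_shiftn u m : l2 u -> sq (iter m seqshift u) = sq u - \sum_(j < m) nm (u j) ^+ 2.
Proof.
move=> hu; elim: m => [|m IH]; first by rewrite big_ord0 subr0.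
have hm := l2_shiftn m hu.
rewrite big_ord_recr /= opprD addrA -IH.
have := congr1 (@complex.Re R) (ip_shift hm hm); rewrite -/(sq _) raddfD /= -/(sq _) nm_sqr /=.
by rewrite shiftnE addn0 => ->; ring.
Qed.

(** The energy of a tail is the total minus a partial sum. All decay along orbits used later comes
    from this fact. *)
Lemma sq_shiftn_cvg u : l2 u -> (fun m => sq (iter m seqshift u)) @ \oo --> (0 : R).
Proof.
move=> hu; rewrite -(subrr (sq u)); under eq_fun do rewrite sq_shiftn//.
by apply: cvgB (sq_cvg hu); exact: cvg_cst.
Qed.

End SquareSummable.

(** * Negative squares *)

Section SimilarCharPoly.
Variable F : fieldType.

Lemma char_poly_conj n (P D : 'M[F]_n) : P \in unitmx ->
  char_poly (invmx P *m D *m P) = char_poly D.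
Proof.
move=> uP; rewrite /char_poly.
have -> : char_poly_mx (invmx P *m D *m P) =
    map_mx polyC (invmx P) *m char_poly_mx D *m map_mx polyC P.
  rewrite /char_poly_mx mulmxBr mulmxBl -!map_mxM; congr (_ - _).
  by rewrite scalar_mxC -mulmxA -map_mxM mulVmx// map_mx1 mulmx1.
rewrite !det_mulmx mulrAC -det_mulmx -map_mxM mulVmx//.
by rewrite map_mx1 det1 mul1r.
Qed.

Lemma char_poly_diag n (d : 'rV[F]_n) :
  char_poly (diag_mx d) = \prod_(i < n) ('X - (d 0 i)%:P).
Proof.
rewrite char_poly_trig; last first.
  by apply/is_trig_mxP => i j ij; rewrite mxE -val_eqE (ltn_eqF ij).
by apply: eq_bigr => i _; rewrite mxE eqxx.
Qed.

End SimilarCharPoly.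

Section NegativeSquares.
Variables (R : realType) (X : lmodType R[i]).
Local Notation C := R[i].
Implicit Types (Q : X -> X -> C).

Definition lcomb n (t : 'rV[C]_n) (w : 'I_n -> X) : X := \sum_i t 0 i *: w i.

Definition sqnorm n (t : 'rV[C]_n) : R := \sum_i nm (t 0 i) ^+ 2.

(** At most [k] negative squares, without eigenvalues. Tuples may be linearly dependent, in which
    case a vanishing combination is a witness. [negsq_le_of_count] and [negsq_le_count] relate it to
    the eigenvalue count. *)
Definition negsq_le k Q : Prop :=
  forall w : 'I_k.+1 -> X, exists2 t : 'rV[C]_k.+1, t != 0 & 0 <= qf Q (lcomb t w).

Definition negdef n Q (w : 'I_n -> X) : Prop :=
  forall t : 'rV[C]_n, t != 0 -> qf Q (lcomb t w) < 0.

Lemma negsq_leN k Q : ~ negsq_le k Q -> exists w : 'I_k.+1 -> X, negdef Q w.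
Proof.
move=> /existsNP[w hw]; exists w => t t0; rewrite ltNge; apply/negP => h.
by apply: hw; exists t.
Qed.

Lemma sqnorm_ge0 n (t : 'rV[C]_n) : 0 <= sqnorm t.
Proof. by apply: sumr_ge0 => i _; exact: sqr_ge0. Qed.

Lemma sqnorm_gt0 n (t : 'rV[C]_n) : t != 0 -> 0 < sqnorm t.
Proof.
move=> t0; rewrite lt_neqAle sqnorm_ge0 andbT eq_sym.
apply: contra t0 => /eqP h; apply/eqP/rowP => i; rewrite mxE.
have /eqP := psumr_eq0P (fun i _ => sqr_ge0 (nm (t 0 i))) h (i := i) isT.
by rewrite sqrf_eq0 nm_eq0 => /eqP.
Qed.

Lemma lcombM m n (s : 'rV[C]_m) (P : 'M[C]_(m, n)) (w : 'I_n -> X) :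
  lcomb (s *m P) w = lcomb s (fun i => lcomb (row i P) w).
Proof.
rewrite /lcomb; under eq_bigr do rewrite mxE scaler_suml.
rewrite exchange_big /=; apply: eq_bigr => i _; rewrite scaler_sumr.
by apply: eq_bigr => j _; rewrite scalerA mxE.
Qed.

Lemma lcombZ n a (t : 'rV[C]_n) w : lcomb (a *: t) w = a *: lcomb t w.
Proof.
by rewrite /lcomb scaler_sumr; apply: eq_bigr => i _; rewrite mxE scalerA.
Qed.

Lemma lcomb_delta n i (w : 'I_n -> X) : lcomb (delta_mx 0 i) w = w i.
Proof.
rewrite /lcomb (bigD1 i)//= mxE !eqxx scale1r big1 ?addr0// => j ji.
by rewrite mxE eqxx (negPf ji) scale0r.
Qed.

Lemma sqnorm_unitary n (P : 'M[C]_n) (s : 'rV[C]_n) :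
  P \is unitarymx -> sqnorm (s *m P) = sqnorm s.
Proof.
move=> uP; have E (t : 'rV[C]_n) : (sqnorm t)%:C%C = (t *m (t ^t Num.Def.conjC)%sesqui) 0 0.
  rewrite !mxE rmorph_sum /=; apply: eq_bigr => i _; by rewrite !mxE nm_sqr.
apply: complexI; rewrite !E; congr (fun_of_matrix _ 0 0).
rewrite trmx_mul map_mxM !mulmxA; congr (_ *m _).
by rewrite -mulmxA (unitarymxP uP) mulmx1.
Qed.

Section Hermitian.
Variable Q : X -> X -> C.
Hypothesis hQ : hermitian_sesquilinear Q.

Definition gram n (w : 'I_n -> X) : 'M[C]_n := \matrix_(i, j) Q (w i) (w j).

Lemma hs_lcomb m n (s : 'rV[C]_m) (t : 'rV[C]_n) v w :
  Q (lcomb s v) (lcomb t w) = \sum_i \sum_j s 0 i * (t 0 j)^* * Q (v i) (w j).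
Proof.
rewrite (hs_suml hQ); apply: eq_bigr => i _; rewrite (hsZl hQ) (hs_sumr hQ).
by rewrite mulr_sumr; apply: eq_bigr => j _; rewrite (hsZr hQ) mulrA.
Qed.

Lemma gram_lcomb n (P : 'M[C]_n) (w : 'I_n -> X) i j :
  Q (lcomb (row i P) w) (lcomb (row j P) w) = (P *m gram w *m (P ^t Num.Def.conjC)%sesqui) i j.
Proof.
rewrite hs_lcomb exchange_big mxE /=; apply: eq_bigr => l _.
rewrite !mxE mulr_suml; apply: eq_bigr => k _; rewrite !mxE; ring.
Qed.

Lemma gram_herm n (w : 'I_n -> X) : gram w \is hermsymmx.
Proof.
apply/is_hermitianmxP; rewrite expr0 scale1r; apply/matrixP => i j.
by rewrite !mxE -(hsC hQ).
Qed.

Lemma gram_diagonalize n (w : 'I_n -> X) : exists (P : 'M[C]_n) (d : 'I_n -> R),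
  [/\ P \is unitarymx,
      char_poly (gram w) = \prod_i ('X - ((d i)%:C%C)%:P),
      forall i j, Q (lcomb (row i P) w) (lcomb (row j P) w) = (d i)%:C%C *+ (i == j)
    & forall s, qf Q (lcomb (s *m P) w) = \sum_i nm (s 0 i) ^+ 2 * d i].
Proof.
pose P := spectralmx (gram w); pose D := spectral_diag (gram w).
have hM := gram_herm w; have /orthomx_spectralP ME := hermitian_normalmx hM.
have uP : P \is unitarymx := spectral_unitarymx (gram w).
have Pu := unitarymx_unit uP.
have Dr i : exists d : R, D 0 i = d%:C%C.
  by apply/complex_realP; have /mxOverP := hermitian_spectral_diag_real hM; apply.
pose d i := projT1 (cid (Dr i)); have dE i : D 0 i = (d i)%:C%C := projT2 (cid (Dr i)).
have orth i j : Q (lcomb (row i P) w) (lcomb (row j P) w) = (d i)%:C%C *+ (i == j).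
  rewrite gram_lcomb ME -/P -/D -(invmx_unitary uP) !mulmxA mulmxV// mul1mx.
  by rewrite -mulmxA mulmxV// mulmx1 mxE dE.
exists P, d; split => //.
  rewrite ME char_poly_conj// char_poly_diag.
  by apply: eq_bigr => i _; rewrite -/D dE.
move=> s; rewrite lcombM /qf hs_lcomb; apply: complexI.
have -> : \sum_i \sum_j s 0 i * (s 0 j)^* * Q (lcomb (row i P) w) (lcomb (row j P) w)
   = (\sum_i nm (s 0 i) ^+ 2 * d i)%:C%C.
  rewrite rmorph_sum /=; apply: eq_bigr => i _; rewrite (bigD1 i)//= orth eqxx.
  rewrite big1 ?addr0; last by move=> j ji; rewrite orth eq_sym (negPf ji) mulr0.
  by rewrite nm_sqr -rmorphM.
by [].
Qed.

(** Two factorisations of one polynomial into linear factors agree up to permutation, so the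
    eigenvalue sequence, which is only chosen, can be traded for the real numbers [d]. *)
Lemma num_neg_gram n (w : 'I_n -> X) (M : 'M[C]_n) (d : 'I_n -> R) :
  char_poly M = \prod_i ('X - ((d i)%:C%C)%:P) ->
  num_neg_eigenvalues M = #|[pred i | d i < 0]|.
Proof.
move=> hM; rewrite /num_neg_eigenvalues /eigenvalue_seq.
case: closed_field_poly_normal => r /=.
rewrite (monicP (char_poly_monic M)) scale1r hM => h.
have /prod_XsubC_eq /permP <- : \prod_(z <- [seq (d i)%:C%C | i <- index_enum 'I_n]) ('X - z%:P)
    = \prod_(z <- r) ('X - z%:P) :> {poly C} by rewrite big_map.
rewrite count_map -sum1_card -sum1_count; apply: eq_bigl => i.
rewrite inE /=; exact: (ltcR (d i) 0).
Qed.

Lemma kernel_matrixE n (w : 'I_n -> X) : kernel_matrix Q w = (gram w)^T.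
Proof. by apply/matrixP => i j; rewrite !mxE. Qed.

Lemma char_poly_kernel_matrix n (w : 'I_n -> X) :
  char_poly (kernel_matrix Q w) = char_poly (gram w).
Proof.
rewrite kernel_matrixE /char_poly -[RHS]det_tr; congr (\det _).
by rewrite /char_poly_mx linearB /= tr_scalar_mx map_trmx.
Qed.

(** Not all [k.+1] eigenvalues of the Gram matrix are negative, and the eigenvector of a nonnegative
    one is the combination sought. *)
Lemma negsq_le_of_count k :
  (forall w : 'I_k.+1 -> X, (num_neg_eigenvalues (kernel_matrix Q w) <= k)%N) ->
  negsq_le k Q.
Proof.
move=> hk w; have [P [d [uP cP _ hq]]] := gram_diagonalize w.
have := hk w; rewrite (num_neg_gram w (etrans (char_poly_kernel_matrix w) cP)).
have [/forallP all_neg|] := boolP [forall i, d i < 0].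
  by rewrite (eq_card (B := predT)) ?card_ord ?ltnn// => i; rewrite !inE all_neg.
rewrite negb_forall => /existsP[i' di]; move: i' di => i; rewrite -leNgt => di _.
exists (delta_mx 0 i *m P).
  apply/negP => /eqP /(congr1 (mulmx^~ (invmx P))).
  rewrite mulmxK ?unitarymx_unit// mul0mx => /rowP/(_ i); rewrite !mxE !eqxx => /eqP.
  by rewrite oner_eq0.
rewrite hq; apply: sumr_ge0 => j _; rewrite mxE eqxx /=.
have [->|_] := eqVneq j i; first by rewrite mulr_ge0 ?sqr_ge0.
by rewrite nm0 expr0n mul0r.
Qed.

(** More than [k] negative eigenvalues would give [k.+1] orthogonal eigenvectors on which the form
    is negative definite. *)
Lemma negsq_le_count k n (w : 'I_n -> X) :
  negsq_le k Q -> (num_neg_eigenvalues (kernel_matrix Q w) <= k)%N.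
Proof.
move=> hk; have [P [d [uP cP orth _]]] := gram_diagonalize w.
rewrite (num_neg_gram w (etrans (char_poly_kernel_matrix w) cP)) leqNgt; apply/negP => hlt.
set N := [pred i | d i < 0] in hlt.
pose f (j : 'I_k.+1) := enum_val (widen_ord hlt j).
have fN j : d (f j) < 0 by have := enum_valP (widen_ord hlt j); rewrite inE.
have finj : injective f by move=> i j /enum_val_inj /(congr1 val) /= /val_inj.
have [t t0] := hk (fun j => lcomb (row (f j) P) w).
rewrite leNgt => /negP; apply.
have -> : qf Q (lcomb t (fun j => lcomb (row (f j) P) w)) = \sum_i nm (t 0 i) ^+ 2 * d (f i).
  apply: complexI; rewrite -(qfE hQ) hs_lcomb rmorph_sum; apply: eq_bigr => i _.
  rewrite (bigD1 i)//= orth eqxx big1 ?addr0 => [|j ji].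
    by rewrite nm_sqr -rmorphM.
  by rewrite orth (inj_eq finj) eq_sym (negPf ji) mulr0.
rewrite -oppr_gt0 -sumrN lt_neqAle; apply/andP; split; last first.
  by apply: sumr_ge0 => i _; rewrite -mulrN mulr_ge0 ?sqr_ge0// oppr_ge0 ltW.
apply/negP => /eqP/esym h; move: t0 => /eqP; apply; apply/rowP => i; rewrite mxE.
have hge j : true -> 0 <= - (nm (t 0 j) ^+ 2 * d (f j)).
  by move=> _; rewrite -mulrN mulr_ge0 ?sqr_ge0// oppr_ge0 ltW.
have /eqP := psumr_eq0P hge h (i := i) isT.
by rewrite oppr_eq0 mulf_eq0 (lt_eqF (fN i)) orbF sqrf_eq0 nm_eq0 => /eqP.
Qed.

(** The margin is minus the largest eigenvalue of the Gram matrix, since a unitary change of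
    coefficients preserves [sqnorm]. *)
Lemma negdef_margin n (w : 'I_n -> X) : negdef Q w ->
  exists2 e : R, 0 < e & forall t, qf Q (lcomb t w) <= - e * sqnorm t.
Proof.
move=> hw; have [P [d [uP cP orth hq]]] := gram_diagonalize w.
have Pu := unitarymx_unit uP.
have dneg i : d i < 0.
  have /hw : row i P != 0.
    apply/negP => /eqP; rewrite rowE => /(congr1 (mulmx^~ (invmx P))).
    rewrite mulmxK// mul0mx => /rowP/(_ i); rewrite !mxE !eqxx => /eqP.
    by rewrite oner_eq0.
  by rewrite /qf orth eqxx.
have [e e0 he] : exists2 e : R, 0 < e & forall i, d i <= - e.
  case: n w hw P d uP cP orth hq Pu dneg => [|n] w hw P d uP cP orth hq Pu dneg.
    by exists 1 => // -[].
  pose m := [arg max_(i > ord0) d i]%O; exists (- d m); first by rewrite oppr_gt0.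
  by move=> i; rewrite opprK /m; case: arg_maxP => // j _; apply.
exists e => // t; rewrite -(mulmxKV Pu t) hq sqnorm_unitary// mulr_sumr.
by apply: ler_sum => i _; rewrite mulrC; apply: ler_wpM2r; rewrite ?sqr_ge0.
Qed.

Lemma negsq_le_approx k :
  (forall (w : 'I_k.+1 -> X) (e : R), 0 < e -> exists2 t : 'rV[C]_k.+1,
     t != 0 & - e * sqnorm t <= qf Q (lcomb t w)) ->
  negsq_le k Q.
Proof.
move=> hk; apply: contrapT => /negsq_leN[w /negdef_margin[e e0 he]].
have [t t0] := hk w (e / 2) (divr_gt0 e0 (ltr0n R 2)).
have := he t; have := sqnorm_gt0 t0; nra.
Qed.

Lemma negsq_le_extend k (w : 'I_k.+1 -> X) u : negsq_le k.+1 Q ->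
  exists (t : 'rV[C]_k.+1) (a : C),
    (t != 0 \/ t = 0 /\ a != 0) /\ 0 <= qf Q (lcomb t w + a *: u).
Proof.
move=> hk; have [t t0 ht] := hk (fun i => oapp w u (unlift ord_max i)).
pose s : 'rV[C]_k.+1 := \row_j t 0 (lift ord_max j); exists s, (t 0 ord_max); split.
  have [s0|] := eqVneq s 0; [right|by left]; split => //.
  apply: contra t0 => /eqP r0; apply/eqP/rowP => i.
  rewrite mxE; case: (unliftP ord_max i) => [j ->|->//].
  by have /rowP/(_ j) := s0; rewrite !mxE.
suff <- : lcomb t (fun i => oapp w u (unlift ord_max i)) = lcomb s w + t 0 ord_max *: u by [].
rewrite /lcomb big_ord_recr /= unlift_none /=; congr (_ + _).
apply: eq_bigr => j _; have -> : widen_ord (leqnSn k.+1) j = lift ord_max j.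
  by apply: val_inj; rewrite /= /bump leqNgt ltn_ord.
by rewrite liftK mxE.
Qed.

Lemma negdef_orthonormal n (w : 'I_n -> X) : negdef Q w ->
  exists2 P : 'M[C]_n, P \in unitmx &
    forall i j, Q (lcomb (row i P) w) (lcomb (row j P) w) = - (i == j)%:R.
Proof.
move=> hw; have [P [d [uP cP orth hq]]] := gram_diagonalize w.
have dneg i : d i < 0.
  have /hw : row i P != 0.
    apply/negP => /eqP; rewrite rowE => /(congr1 (mulmx^~ (invmx P))).
    rewrite mulmxK ?unitarymx_unit// mul0mx => /rowP/(_ i); rewrite !mxE !eqxx => /eqP.
    by rewrite oner_eq0.
  by rewrite /qf orth eqxx.
pose s : 'rV[C]_n := \row_i (Num.sqrt (- d i))^-1%:C%C.
exists (diag_mx s *m P).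
  rewrite unitmx_mul (unitarymx_unit uP) andbT unitmxE det_diag unitfE.
  apply/prodf_neq0 => i _; rewrite mxE fmorph_eq0 invr_eq0 sqrtr_eq0 -ltNge.
  by rewrite oppr_gt0.
have rw i : lcomb (row i (diag_mx s *m P)) w = s 0 i *: lcomb (row i P) w.
  by rewrite -lcombZ; congr lcomb; apply/rowP => j; rewrite mul_diag_mx !mxE.
move=> i j; rewrite !rw (hsZl hQ) (hsZr hQ) orth.
have [->|ij] := eqVneq i j; last by rewrite !mulr0n !mulr0 oppr0.
rewrite mulr1n mulrA nm_sqr mxE nm_real -rmorphM /= real_normK ?num_real//.
rewrite exprVn sqr_sqrtr ?oppr_ge0 ?ltW// -[in X in _ * X](opprK (d j)) mulrN mulVf.
  by rewrite rmorphN rmorph1.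
by rewrite oppr_eq0 lt_eqF.
Qed.

End Hermitian.
End NegativeSquares.

(** * Eigenvectors of the Stein pencil *)

Section Powers.
Variable R : realType.
Local Notation C := R[i].

Lemma null_contraction (q : R) (u v : nat -> R) : 0 <= q < 1 ->
  (forall n, 0 <= u n) -> (forall n, u n.+1 <= q * u n + v n) ->
  v @ \oo --> (0 : R) -> u @ \oo --> (0 : R).
Proof.
move=> /andP[q0 q1] u0 uv v0; apply/cvgrPdist_le => e e0.
(* With this bound on [v], the level e / 2 is the fixed point of the affine recursion, and the
   excess over it shrinks by q at each step. *)
have e1 : 0 < e / 2 * (1 - q) by rewrite mulr_gt0 ?divr_gt0 ?subr_gt0.
have [N _ hN] : \forall n \near \oo, `|v n| <= e / 2 * (1 - q).
  by move/cvgrPdist_le : v0 => /(_ _ e1); apply: filterS => n; rewrite sub0r normrN.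
have ind m : u (N + m)%N <= q ^+ m * u N + e / 2.
  elim: m => [|m IH]; first by rewrite addn0 expr0 mul1r lerDl ltW ?divr_gt0.
  rewrite addnS; apply: (le_trans (uv _)).
  have := hN (N + m)%N (leq_addr _ _) => /(le_trans (ler_norm _)) hv.
  rewrite exprS -mulrA; have := ler_wpM2l q0 IH; lra.
have : (fun m => q ^+ m * u N) @ \oo --> (0 : R).
  rewrite -(mul0r (u N)); apply: cvgM; last exact: cvg_cst.
  by apply: cvg_expr; rewrite ger0_norm.
move=> /cvgrPdist_le/(_ _ (divr_gt0 e0 (ltr0n R 2)))[M _ hM].
exists (N + M)%N => // n /= hn; rewrite sub0r normrN ger0_norm//.
have nN : (N <= n)%N by apply: leq_trans hn; exact: leq_addr.
have := ind (n - N)%N; rewrite subnKC// => /le_trans; apply.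
have := hM (n - N)%N; rewrite /= leq_subRL// => /(_ hn).
rewrite sub0r normrN ger0_norm ?mulr_ge0 ?exprn_ge0//; lra.
Qed.

(** Roots are peeled off one at a time: x T^(k+1) = z x T^k + x (T - z) T^k, where the second term
    is null by induction and |z| < 1 contracts the first. *)
Lemma power_null n (T : 'M[C]_n.+1) (r : seq C) (x : 'rV[C]_n.+1) :
  (forall z, z \in r -> nm z < 1) ->
  x *m horner_mx T (\prod_(z <- r) ('X - z%:P)) = 0 ->
  forall i, clim (fun k => iter k (mulmxr T) x 0 i) 0.
Proof.
elim: r x => [|z r IH] x hr.
  rewrite big_nil rmorph1 mulmx1 => -> i.
  have -> : (fun k => iter k (mulmxr T) (0 : 'rV[C]_n.+1) 0 i) = (fun=> (0 : C)); last exact: clim_cst.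
  rewrite funeqE => k; suff -> : iter k (mulmxr T) 0 = 0 :> 'rV_n.+1 by rewrite mxE.
  by elim: k => //= j ->; rewrite mul0mx.
rewrite big_cons rmorphM /= -mulmxE mulmxA rmorphB /= horner_mx_X horner_mx_C.
move=> /IH h i; have /h/(_ i)/clim0 {}h : forall z, z \in r -> nm z < 1.
  by move=> w wr; apply: hr; rewrite inE wr orbT.
apply/clim0; apply: (null_contraction (q := nm z) _ _ _ h).
- by rewrite nm_ge0 hr// mem_head.
- by move=> k; exact: nm_ge0.
move=> k; rewrite -nmM; apply: le_trans (nmD _ _).
suff -> : iter k.+1 (mulmxr T) x = z *: iter k (mulmxr T) x + iter k (mulmxr T) (x *m (T - z%:M)).
  by rewrite !mxE.
elim: k => [|k IHk] /=; first by rewrite mulmxBr mul_mx_scalar addrC subrK.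
by rewrite {1}[iter k (mulmxr T) x *m T]IHk mulmxDl -scalemxAl.
Qed.

Variable X : lmodType C.

(** If all eigenvalues had modulus < 1, the iterates of [t0] would tend to 0, whereas the form stays
    below its negative value at [t0] along them. *)
Lemma expanding_eigenvector (Q : X -> X -> C) n (e : 'I_n -> X) (T : 'M[C]_n) (t0 : 'rV[C]_n) :
  hermitian_sesquilinear Q ->
  (forall t, qf Q (lcomb (t *m T) e) <= qf Q (lcomb t e)) ->
  qf Q (lcomb t0 e) < 0 ->
  exists (mu : C) (v : 'rV[C]_n), [/\ v != 0, v *m T = mu *: v & 1 <= nm mu].
Proof.
move=> hQ; case: n e T t0 => [|n] e T t0 hT ht0.
  by move: ht0; rewrite /lcomb big_ord0 (qf0 hQ) ltxx.
have [r hr] := closed_field_poly_normal (char_poly T).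
rewrite (monicP (char_poly_monic T)) scale1r in hr.
have [/hasP[mu mur hmu]|/hasPn hlt] := boolP (has (fun z => 1 <= nm z) r).
  have : eigenvalue T mu by rewrite eigenvalue_root_char hr root_prod_XsubC.
  by move=> /eigenvalueP[v hv v0]; exists mu, v.
exfalso; have hn : forall i, clim (fun k => iter k (mulmxr T) t0 0 i) 0.
  apply: (@power_null _ _ r); last by rewrite -hr Cayley_Hamilton mulmx0.
  by move=> z /hlt; rewrite -ltNge.
pose t k := iter k (mulmxr T) t0.
have le k : qf Q (lcomb (t k) e) <= qf Q (lcomb t0 e).
  by elim: k => //= k; apply: le_trans; exact: hT.
have lim : clim (fun k => Q (lcomb (t k) e) (lcomb (t k) e)) 0.
  have -> : (fun k => Q (lcomb (t k) e) (lcomb (t k) e)) =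
      (fun k => \sum_i \sum_j t k 0 i * (t k 0 j)^* * Q (e i) (e j)).
    by apply/funext => k; rewrite (hs_lcomb hQ).
  have climS (F : nat -> 'I_n.+1 -> C) : (forall i, clim (F^~ i) 0) ->
      clim (fun k => \sum_i F k i) 0.
    move=> hF; elim: (index_enum _) => [|i s IH].
      have -> : (fun k => \sum_(i <- [::]) F k i) = (fun=> (0 : C)).
        by rewrite funeqE => k; rewrite big_nil.
      exact: clim_cst.
    have -> : (fun k => \sum_(j <- i :: s) F k j) = (fun k => F k i + \sum_(j <- s) F k j).
      by rewrite funeqE => k; rewrite big_cons.
    by have := climD (hF i) IH; rewrite addr0.
  apply: (climS) => i; apply: (climS) => j; apply/clim0.
  have /clim0 hi := hn i; have /clim0 hj := hn j.
  have : (fun k => nm (t k 0 i) * nm (t k 0 j) * nm (Q (e i) (e j))) @ \oo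
      --> (0 : R) * 0 * nm (Q (e i) (e j)).
    by apply: cvgM; [exact: cvgM|exact: cvg_cst].
  rewrite mulr0 mul0r; apply: null_le => k; rewrite ?nm_ge0//.
  by rewrite !nmM nm_conj.
have /clim0/cvgrPdist_le/(_ (- qf Q (lcomb t0 e) / 2))[] := lim.
  by rewrite divr_gt0 ?oppr_gt0.
move=> N _ /(_ N (leqnn N)); rewrite sub0r normrN ger0_norm ?nm_ge0//.
have := nm_Re (Q (lcomb (t N) e) (lcomb (t N) e)); rewrite -/(qf _ _).
have := le N; have := ler_norm (- qf Q (lcomb (t N) e)); rewrite normrN; lra.
Qed.

End Powers.

Section Pencil.
Variables (R : realType) (X : lmodType R[i]).
Local Notation C := R[i].

Definition linear_functional (b : X -> C) : Prop :=
  forall a x y, b (a *: x + y) = a * b x + b y.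

Section Functional.
Variable b : X -> C.
Hypothesis hb : linear_functional b.

Lemma lfD x y : b (x + y) = b x + b y.
Proof. by have := hb 1 x y; rewrite scale1r mul1r. Qed.

Lemma lf0 : b 0 = 0.
Proof. by have := lfD 0 0; rewrite addr0 => /(congr1 (+%R (- b 0))); rewrite addNr addKr. Qed.

Lemma lf_lcomb n (t : 'rV[C]_n) w : b (lcomb t w) = \sum_i t 0 i * b (w i).
Proof.
rewrite /lcomb; elim/big_rec2: _ => [|i y1 y2 _ <-]; first exact: lf0.
by rewrite hb.
Qed.

End Functional.

Lemma hs_add_rank1 (Q : X -> X -> C) (b : X -> C) (s : R) :
  hermitian_sesquilinear Q -> linear_functional b ->
  hermitian_sesquilinear (fun x y => Q x y + s%:C%C * (b x * (b y)^*)).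
Proof.
move=> hQ hb; split=> [a x y z|x y]; first by rewrite (hsPl hQ) hb; ring.
rewrite rmorphD !rmorphM /= conjCK -(hsC hQ) (conjE s%:C%C) conjc_real; ring.
Qed.

Variables (Q : X -> X -> C) (A : {linear X -> X}) (b0 c0 : X -> C).
Hypotheses (hQ : hermitian_sesquilinear Q) (hb : linear_functional b0).
Hypothesis stein : forall x y,
  Q x y + b0 x * (b0 y)^* = Q (A x) (A y) + c0 x * (c0 y)^*.

Let G x y := Q x y + b0 x * (b0 y)^*.

Let hG : hermitian_sesquilinear G.
Proof.
have := hs_add_rank1 1 hQ hb; congr hermitian_sesquilinear.
by apply/funext => x; apply/funext => y; rewrite mul1r.
Qed.

Let qfG x : qf G x = qf Q x + nm (b0 x) ^+ 2.
Proof. by rewrite /qf /G nm_sqr raddfD. Qed.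

Variables (N n : nat) (e : 'I_N -> X) (L : 'M[C]_(n, N)).
Hypothesis Gunit : gram G e \in unitmx.
(** On X + C with the form Q(u, u) + |g|^2, the Stein identity gives (A l, c0 l) the square that l
    has for [G]. When this is negative on as many vectors as Q has negative squares, their
    orthogonal complement has to be positive. *)
Hypothesis pos : forall u g,
  (forall i, Q (A (lcomb (row i L) e)) u + c0 (lcomb (row i L) e) * g^* = 0) ->
  0 <= qf Q u + nm g ^+ 2 /\ (u != 0 -> 0 < qf Q u + nm g ^+ 2).
Hypothesis shift_free : forall t mu, t != 0 -> lcomb t e - mu *: A (lcomb t e) != 0.

(** [T] is an adjoint of [A] between two forms: G(x, T y) = Q(A x, y). It satisfies G(T x) <= Q(x)
    <= G(x), so [expanding_eigenvector] yields an eigenvalue mu with |mu| >= 1. Strictness of the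
    first inequality excludes |mu| = 1 and gives both the sign of Q(g) and the bound on b0(g). *)
Lemma pencil_eigenvector (t0 : 'rV[C]_N) : qf G (lcomb t0 e) < 0 ->
  exists (t : 'rV[C]_N) (a : C), let g := lcomb t e in
  [/\ nm a < 1, qf Q g < 0, nm (b0 g) ^+ 2 <= (1 - nm a ^+ 2) * (- qf Q g)
    & forall s, let w := lcomb s e in Q w g = a * Q (A w) g - b0 w * (b0 g)^*].
Proof.
move=> ht0.
pose M : 'M[C]_N := \matrix_(i, j) Q (A (e i)) (e j).
pose T : 'M[C]_N := ((invmx (gram G e) *m M) ^t Num.Def.conjC)%sesqui.
have Te t i : G (e i) (lcomb (t *m T) e) = Q (A (e i)) (lcomb t e).
  have E (H : X -> X -> C) x u : hermitian_sesquilinear H ->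
      H x (lcomb u e) = \sum_j H x (e j) * (u 0 j)^*.
    move=> hH; rewrite /lcomb (hs_sumr hH); apply: eq_bigr => j _.
    by rewrite (hsZr hH) mulrC.
  rewrite !E//.
  transitivity ((gram G e *m ((t *m T) ^t Num.Def.conjC)%sesqui) i 0).
    by rewrite mxE; apply: eq_bigr => j _; rewrite !mxE.
  rewrite trmx_mul map_mxM trmxCK !mulmxA mulmxV// mul1mx mxE.
  by apply: eq_bigr => j _; rewrite !mxE.
have T1 s t : G (lcomb s e) (lcomb (t *m T) e) = Q (A (lcomb s e)) (lcomb t e).
  rewrite {1}/lcomb (hs_suml hG) /(lcomb s) linear_sum (hs_suml hQ).
  by apply: eq_bigr => i _; rewrite (hsZl hG) linearZ (hsZl hQ) Te.
(* The vector (u, - c0 z) is orthogonal to all (A l, c0 l), and its square is exactly Q(x) -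
   G(z). *)
have key t (x := lcomb t e) (z := lcomb (t *m T) e) (u := x - A z) :
    qf G z <= qf Q x /\ (u != 0 -> qf G z < qf Q x).
  have E : qf Q u + nm (- c0 z) ^+ 2 = qf Q x - qf G z.
    rewrite nmN /u (qfD hQ) (qfN hQ) (hsNr hQ) (hsC hQ x).
    have -> : Q (A z) x = G z z by rewrite T1.
    have : qf G z = qf Q (A z) + nm (c0 z) ^+ 2 by rewrite /qf /G stein nm_sqr raddfD.
    rewrite (qfE hG) conjE conjc_real raddfN /=; lra.
  have [|h1 h2] := @pos u (- c0 z).
    move=> i; rewrite /u (hsDr hQ) (hsNr hQ) -T1 -/z rmorphN mulrN.
    by rewrite /G stein; ring.
  by rewrite !E !subr_ge0 !subr_gt0 in h1 h2.
have [|mu [v [v0 vT mu1]]] := @expanding_eigenvector R X G N e T t0 hG _ ht0.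
  move=> t; apply: le_trans (key t).1 _; rewrite qfG lerDl; exact: sqr_ge0.
set g := lcomb v e.
have zE : lcomb (v *m T) e = mu *: g by rewrite vT lcombZ.
have mu0 : mu != 0 by rewrite -nm_eq0 gt_eqF// (lt_le_trans ltr01).
have := (key v).2; rewrite zE linearZ /= -/g (qfZ hG) qfG => /(_ (shift_free _ v0)) lt.
have nmu : 1 < nm mu.
  rewrite lt_neqAle mu1 andbT; apply/negP => /eqP mu_eq.
  move: lt; rewrite -mu_eq expr1n mul1r; have := sqr_ge0 (nm (b0 g)); lra.
have nm2 : 1 < nm mu ^+ 2 by rewrite exprn_egt1.
have nap : 0 < nm mu ^+ 2 by rewrite (lt_trans ltr01).
(* The eigenvector equation says conj(mu) G(w, g) = Q(A w, g); dividing by conj(mu) gives the last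
   clause. *)
exists v, (mu^*)^-1; rewrite -/g.
have na : nm (mu^*)^-1 = (nm mu)^-1.
  apply: (mulfI (x := nm mu)); first by rewrite gt_eqF// (lt_trans ltr01).
  rewrite -{1}(nm_conj mu) -nmM divff ?conjC_eq0// nm1 divff//.
  by rewrite gt_eqF// (lt_trans ltr01).
have b2 := sqr_ge0 (nm (b0 g)).
split.
- by rewrite na invf_lt1// (lt_trans ltr01).
- rewrite ltNge; apply/negP => h; nra.
- rewrite na exprVn -(ler_pM2l nap).
  have -> : nm mu ^+ 2 * ((1 - (nm mu ^+ 2)^-1) * - qf Q g) = (nm mu ^+ 2 - 1) * - qf Q g.
    by rewrite mulrA mulrBr mulr1 mulfV ?gt_eqF.
  lra.
move=> s /=; have := T1 s v; rewrite zE (hsZr hG) /G => <-.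
by rewrite mulrA mulVf ?conjC_eq0// mul1r; ring.
Qed.

End Pencil.

(** * Polynomials as formal combinations along orbits *)

Section PolynomialModel.
Variables (R : realType) (W : lmodType R[i]) (g : nat -> W).
Local Notation C := R[i].
Implicit Types p q : {poly C}.

(** Polynomials make the vectors [g k] formally independent. When [g (j + n) = A (g j)],
    multiplication by ['X^n] represents [A]. *)
Definition polysum p : W := \sum_(k < size p) p`_k *: g k.

Lemma polysum_widen p m : (size p <= m)%N -> polysum p = \sum_(k < m) p`_k *: g k.
Proof.
move=> pm; rewrite -(subnKC pm) big_split_ord /= [X in _ + X]big1 ?addr0// => i _.
by rewrite nth_default ?scale0r// leq_addr.
Qed.

Lemma polysum_linear a p q : polysum (a *: p + q) = a *: polysum p + polysum q.
Proof.
pose m := maxn (size (a *: p + q)) (maxn (size p) (size q)).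
rewrite !(@polysum_widen _ m) /m ?leq_max ?leqnn ?orbT//.
rewrite scaler_sumr -big_split /=; apply: eq_bigr => i _.
by rewrite coefD coefZ scalerDl scalerA.
Qed.

Lemma polysumX j : polysum 'X^j = g j.
Proof.
rewrite /polysum size_polyXn big_ord_recr /= coefXn eqxx scale1r big1 ?add0r// => i _.
by rewrite coefXn (ltn_eqF (ltn_ord i)) scale0r.
Qed.

Lemma polysumMX n (A : {linear W -> W}) p : (forall j, g (j + n)%N = A (g j)) ->
  polysum (p * 'X^n) = A (polysum p).
Proof.
move=> hg; rewrite (@polysum_widen _ (n + size p)).
  rewrite big_split_ord /= big1 ?add0r => [|i _]; last first.
    by rewrite coefMXn ltn_ord scale0r.
  rewrite /polysum linear_sum; apply: eq_bigr => i _.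
  by rewrite linearZ coefMXn ltnNge leq_addr /= addKn addnC hg.
by rewrite (leq_trans (size_polyMleq _ _))// size_polyXn addnS addnC.
Qed.

(** Positive definite and invariant under multiplication by ['X^n]: a multiple of it can be added to
    the pulled back form without disturbing the Stein identity. *)
Definition coefip (p q : {poly C}) : C := \sum_(k < size p) p`_k * (q`_k)^*.

Lemma coefip_widen p q m : (size p <= m)%N -> coefip p q = \sum_(k < m) p`_k * (q`_k)^*.
Proof.
move=> pm; rewrite -(subnKC pm) big_split_ord /= [X in _ + X]big1 ?addr0// => i _.
by rewrite nth_default ?mul0r// leq_addr.
Qed.

Lemma coefip_hs : hermitian_sesquilinear (coefip : {poly C} -> {poly C} -> C).
Proof.
split=> [a p q r|p q].
  pose m := maxn (size (a *: p + q)) (maxn (size p) (size q)).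
  rewrite !(@coefip_widen _ _ m) /m ?leq_max ?leqnn ?orbT//.
  rewrite mulr_sumr -big_split /=; apply: eq_bigr => i _.
  by rewrite coefD coefZ; ring.
pose m := maxn (size p) (size q).
rewrite !(@coefip_widen _ _ m) /m ?leq_max ?leqnn ?orbT// rmorph_sum.
by apply: eq_bigr => i _; rewrite rmorphM /= conjCK mulrC.
Qed.

Lemma coefipMX n p q : coefip (p * 'X^n) (q * 'X^n) = coefip p q.
Proof.
rewrite (@coefip_widen _ _ (n + size p)).
  rewrite big_split_ord /= big1 ?add0r => [|i _]; last first.
    by rewrite coefMXn ltn_ord mul0r.
  by apply: eq_bigr => i _; rewrite !coefMXn ltnNge leq_addr /= addKn.
by rewrite (leq_trans (size_polyMleq _ _))// size_polyXn addnS addnC.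
Qed.

Lemma qf_coefip p : qf coefip p = \sum_(k < size p) nm p`_k ^+ 2.
Proof.
apply: complexI; rewrite -(qfE coefip_hs) /coefip rmorph_sum.
by apply: eq_bigr => i _; rewrite nm_sqr.
Qed.

Lemma qf_coefip_ge0 p : 0 <= qf coefip p.
Proof. by rewrite qf_coefip; apply: sumr_ge0 => i _; exact: sqr_ge0. Qed.

Lemma qf_coefip_ge_coef p j : nm p`_j ^+ 2 <= qf coefip p.
Proof.
have [jp|pj] := ltnP j (size p); last by rewrite nth_default// nm0 expr0n qf_coefip_ge0.
rewrite qf_coefip (bigD1 (Ordinal jp))//= lerDl.
by apply: sumr_ge0 => i _; exact: sqr_ge0.
Qed.

Lemma qf_coefip_eq0 p : qf coefip p <= 0 -> p = 0.
Proof.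
move=> h; apply/polyP => j; rewrite coef0; apply/eqP; rewrite -nm_eq0 -sqrf_eq0.
by rewrite eq_le sqr_ge0 andbT (le_trans (qf_coefip_ge_coef p j)).
Qed.

Lemma coef_lcombX N (t : 'rV[C]_N) j :
  (lcomb t (fun i => 'X^i : {poly C}))`_j = if insub j is Some i then t 0 i else 0.
Proof.
rewrite /lcomb coef_sum; case: insubP => [i _ ij|hj].
  rewrite (bigD1 i)//= coefZ coefXn -ij eqxx mulr1 big1 ?addr0// => i' ii'.
  by rewrite coefZ coefXn val_eqE eq_sym (negPf ii') mulr0.
rewrite big1// => i _; rewrite coefZ coefXn; case: eqP => [ji|]; last by rewrite mulr0.
by move: hj; rewrite ji ltn_ord.
Qed.

Lemma size_lcombX N (t : 'rV[C]_N) : (size (lcomb t (fun i => 'X^i : {poly C})) <= N)%N.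
Proof.
apply/leq_sizeP => j hj; rewrite coef_lcombX insubN// -leqNgt.
by [].
Qed.

Lemma poly_lcombX N p : (size p <= N)%N ->
  p = lcomb (\row_(i < N) p`_i) (fun i => 'X^i : {poly C}).
Proof.
move=> pN; apply/polyP => j; rewrite coef_lcombX; case: insubP => [i _ <-|].
  by rewrite mxE.
by rewrite -leqNgt => hj; rewrite nth_default// (leq_trans pN).
Qed.

Lemma lcombX_neq0 N (t : 'rV[C]_N) : t != 0 -> lcomb t (fun i => 'X^i : {poly C}) != 0.
Proof.
apply: contra => /eqP h; apply/eqP/rowP => i; rewrite mxE.
by have /(congr1 (fun p : {poly C} => p`_i)) := h; rewrite coef_lcombX coef0 valK.
Qed.

(* Comparing lowest terms: a nonzero polynomial is not a multiple of its shift. *)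
Lemma sub_shift_neq0 n (mu : C) p : (0 < n)%N -> p != 0 -> p - mu *: (p * 'X^n) != 0.
Proof.
move=> n0 p0; apply/negP => /eqP h.
have all0 j : p`_j = 0.
  have [m] := ubnP j; elim: m j => // m IH j jm.
  have := congr1 (fun q : {poly C} => q`_j) h; rewrite /= coefB coefZ coefMXn coef0.
  case: ltnP => [_|nj]; first by rewrite mulr0 subr0.
  have -> : p`_(j - n) = 0 by apply: IH; move: jm nj n0; clear; lia.
  by rewrite mulr0 subr0.
by move/eqP: p0; apply; apply/polyP => j; rewrite all0 coef0.
Qed.

End PolynomialModel.
Arguments coefip {R} p q.
Arguments coefip_hs {R}.

(** * The perturbed pencil on polynomials of bounded size *)

Section PerturbedPencil.
Variables (R : realType) (W : lmodType R[i]).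
Local Notation C := R[i].
Variables (Q : W -> W -> C) (A : {linear W -> W}) (b0 c0 : W -> C).
Hypotheses (hQ : hermitian_sesquilinear Q) (hb : linear_functional b0)
  (hc : linear_functional c0).
Hypothesis stein : forall x y,
  Q x y + b0 x * (b0 y)^* = Q (A x) (A y) + c0 x * (c0 y)^*.
Variable k : nat.
Hypothesis Qneg : negsq_le k.+1 Q.
Variables (g : nat -> W) (n : nat).
Hypotheses (n_gt0 : (0 < n)%N) (kn : (k.+1 <= n)%N).
Hypothesis gA : forall j, g (j + n)%N = A (g j).

Let l (i : 'I_k.+1) := g i.

Variable d0 : R.
Hypothesis d0_gt0 : 0 < d0.
Hypothesis lneg : forall t : 'rV[C]_k.+1,
  qf Q (lcomb t l) + nm (b0 (lcomb t l)) ^+ 2 <= - d0 * sqnorm t.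

Local Notation psum := (polysum g).

Definition perturbed (eps : R) (p q : {poly C}) : C :=
  Q (psum p) (psum q) + eps%:C%C * coefip p q.

Lemma perturbed_hs eps : hermitian_sesquilinear (perturbed eps).
Proof.
split=> [a p q r|p q]; rewrite /perturbed.
  by rewrite polysum_linear (hsPl hQ) (hsPl coefip_hs); ring.
by rewrite rmorphD rmorphM /= -(hsC hQ) -(hsC coefip_hs) conjE conjc_real.
Qed.

Lemma qf_perturbed eps p :
  qf (perturbed eps) p = qf Q (psum p) + eps * qf coefip p.
Proof.
rewrite /qf raddfD /= (qfE coefip_hs); congr (_ + _).
by rewrite -rmorphM.
Qed.

(** Singularity means that - e is one of finitely many eigenvalues. One more candidate than there
    are roots is tried; [j.+2] keeps each of them strictly below [e0]. *)
Lemma generic_perturbation N (M : 'M[C]_N) (e0 : R) : 0 < e0 ->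
  exists2 e : R, 0 < e < e0 & M + e%:C%C%:M \in unitmx.
Proof.
move=> e00; have [r hr] := closed_field_poly_normal (char_poly M).
rewrite (monicP (char_poly_monic M)) scale1r in hr.
pose s := [seq (- (e0 / j.+2%:R))%:C%C | j <- iota 0 (size r).+1] : seq C.
have us : uniq s.
  rewrite map_inj_uniq ?iota_uniq// => i j /complexI /oppr_inj /(mulfI (lt0r_neq0 e00)).
  by move=> /invr_inj /eqP; rewrite eqr_nat !eqSS => /eqP.
have [z zs zr] : exists2 z, z \in s & z \notin r.
  apply/hasP; rewrite has_predC; apply/negP => /allP /(uniq_leq_size us).
  by rewrite size_map size_iota ltnn.
move: zs zr => /mapP[j _ ->] zr; exists (e0 / j.+2%:R).
  rewrite divr_gt0// ltr_pdivrMr// mulrC ltr_pMl//.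
  by rewrite ltr1n.
have : ~~ eigenvalue M (- (e0 / j.+2%:R))%:C%C.
  by rewrite eigenvalue_root_char hr root_prod_XsubC.
rewrite /eigenvalue negbK /eigenspace kermx_eq0 row_free_unit.
by rewrite !rmorphN opprK.
Qed.

(** [pencil_eigenvector] is applied in [{poly C}] to the span of the powers of ['X] below [N].
    Multiplication by ['X^n] leaves this span, which is harmless: the pencil involves shifted
    vectors only through values of the form. *)
Lemma perturbed_eigenvector (N : nat) (e0 : R) : (n <= N)%N -> 0 < e0 ->
  exists (eps : R) (p : {poly C}) (a : C),
  [/\ 0 < eps < e0, (size p <= N)%N, nm a < 1, qf (perturbed eps) p < 0
    & nm (b0 (psum p)) ^+ 2 <= (1 - nm a ^+ 2) * (- qf (perturbed eps) p) /\
      forall q : {poly C}, (size q <= N)%N -> perturbed eps q p =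
        a * perturbed eps (q * 'X^n) p - b0 (psum q) * (b0 (psum p))^*].
Proof.
(* The perturbation adds eps * [sqnorm s] on the negative tuple, so eps < d0 preserves its
   negativity. *)
move=> nN e00; have e1 : 0 < Num.min e0 d0 by rewrite lt_min e00.
pose M := \matrix_(i < N, j < N) (Q (g i) (g j) + b0 (g i) * (b0 (g j))^*).
have [eps /andP[eps0]] := generic_perturbation M e1.
rewrite lt_min => /andP[epse epsd] Mu.
have hH := perturbed_hs eps; set H := perturbed eps in hH *.
have AXlin : linear (fun p : {poly C} => p * 'X^n).
  by move=> a p q; rewrite mulrDl scalerAl.
pose AX : {linear {poly C} -> {poly C}} :=
  HB.pack (fun p : {poly C} => p * 'X^n) (GRing.isLinear.Build _ _ _ _ _ AXlin).
have AXE p : AX p = p * 'X^n by [].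
pose bX p := b0 (psum p); pose cX p := c0 (psum p).
have hbX : linear_functional bX by move=> a x y; rewrite /bX polysum_linear hb.
have hcX : linear_functional cX by move=> a x y; rewrite /cX polysum_linear hc.
have steinX x y : H x y + bX x * (bX y)^* = H (AX x) (AX y) + cX x * (cX y)^*.
  rewrite /H /perturbed !AXE coefipMX !(polysumMX _ gA) addrAC stein.
  by rewrite addrAC.
pose e (i : 'I_N) : {poly C} := 'X^i.
have gramu : gram (fun x y => H x y + bX x * (bX y)^*) e \in unitmx.
  suff -> : gram (fun x y => H x y + bX x * (bX y)^*) e = M + eps%:C%C%:M by [].
  apply/matrixP => i j; rewrite !mxE /H /perturbed /bX !polysumX addrAC; congr (_ + _).
  rewrite /coefip size_polyXn big_ord_recr /= big1 ?add0r => [|i' _]; last first.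
    by rewrite coefXn (ltn_eqF (ltn_ord i')) mul0r.
  by rewrite !coefXn eqxx mul1r val_eqE rmorph_nat mulr_natr.
pose L : 'M[C]_(k.+1, N) := \matrix_(i, j) (i == j :> nat)%:R.
have kN (i : 'I_k.+1) : (i < N)%N by apply: leq_trans nN; apply: leq_trans kn; exact: ltn_ord.
have LE i : lcomb (row i L) e = 'X^i.
  rewrite /lcomb (bigD1 (Ordinal (kN i)))//= !mxE eqxx scale1r big1 ?addr0// => j ji.
  rewrite !mxE; case: eqP => [ij|]; last by rewrite scale0r.
  by move: ji; rewrite -val_eqE /= ij eqxx.
have qfH p : qf H p = qf Q (psum p) + eps * qf coefip p by exact: qf_perturbed.
pose v (s : 'rV[C]_k.+1) : {poly C} := lcomb s (fun i => 'X^i).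
have vsum s : psum (v s) = lcomb s l.
  rewrite (@polysum_widen _ _ g _ k.+1) ?size_lcombX//; apply: eq_bigr => i _.
  by rewrite coef_lcombX valK.
have vip s : qf coefip (v s) = sqnorm s.
  apply: complexI; rewrite -(qfE coefip_hs) (@coefip_widen _ _ _ k.+1) ?size_lcombX//.
  by rewrite rmorph_sum; apply: eq_bigr => i _; rewrite coef_lcombX valK nm_sqr.
(* Some combination of the vectors [A (l j)] and [psum u] is nonnegative for Q. By orthogonality its
   square in the form extended by |.|^2 splits into a term for [s], negative by the Stein identity
   and [lneg], and |r|^2 times [qu]; hence [qu] is nonnegative. *)
have pos u ga :
    (forall i, H (AX (lcomb (row i L) e)) u + cX (lcomb (row i L) e) * ga^* = 0) ->
    0 <= qf H u + nm ga ^+ 2 /\ (u != 0 -> 0 < qf H u + nm ga ^+ 2).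
  move=> hu; set qu := qf H u + nm ga ^+ 2.
  have [s [r [r2 ht]]] := negsq_le_extend (fun j : 'I_k.+1 => A (l j)) (psum u) Qneg.
  have lE : lcomb s (fun j : 'I_k.+1 => A (l j)) + r *: psum u = psum (AX (v s) + r *: u).
    rewrite [in RHS]addrC polysum_linear AXE (polysumMX _ gA) vsum /lcomb addrC; congr (_ + _).
    by rewrite [A _]linear_sum; apply: eq_bigr => j _; rewrite linearZ.
  rewrite lE in ht.
  have hv : H (AX (v s)) u + cX (v s) * ga^* = 0.
    rewrite /v /lcomb linear_sum (hs_suml hH) (_ : cX _ = \sum_i s 0 i * cX 'X^i).
      rewrite mulr_suml -big_split big1 // => i _; rewrite linearZ (hsZl hH).
      transitivity (s 0 i * (H (AX 'X^i) u + cX 'X^i * ga^*)); first by rewrite [RHS]mulrDr mulrA.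
      by have := hu i; rewrite LE => ->; rewrite mulr0.
    exact: (lf_lcomb hcX s).
  have E : qf H (AX (v s) + r *: u) + nm (cX (v s) + r * ga) ^+ 2 =
      qf H (v s) + nm (bX (v s)) ^+ 2 + nm r ^+ 2 * qu.
    apply: complexI; rewrite /qu !rmorphD [X in _ = _ + X]rmorphM rmorphD /= -!nm_sqr -!(qfE hH).
    rewrite (hsDl hH) !(hsDr hH).
    rewrite !(hsZl hH) !(hsZr hH) rmorphD rmorphM /=.
    have := steinX (v s) (v s) => E1.
    have -> : H (AX (v s)) (AX (v s)) = H (v s) (v s) + bX (v s) * (bX (v s))^* - cX (v s) * (cX (v s))^*.
      by rewrite E1 addrK.
    have -> : H (AX (v s)) u = - (cX (v s) * ga^*) by apply/eqP; rewrite -addr_eq0 hv.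
    have -> : H u (AX (v s)) = - ((cX (v s))^* * ga).
      rewrite (hsC hH); have -> : H (AX (v s)) u = - (cX (v s) * ga^*) by apply/eqP; rewrite -addr_eq0 hv.
      by rewrite rmorphN rmorphM /= conjCK.
    rewrite /qu; ring.
  have vneg : qf H (v s) + nm (bX (v s)) ^+ 2 <= - (d0 - eps) * sqnorm s.
    rewrite qfH /bX vsum vip; have := lneg s; lra.
  have T0 : eps * qf coefip (AX (v s) + r *: u) <= qf H (AX (v s) + r *: u).
    by rewrite qfH lerDr.
  have P0 := qf_coefip_ge0 (AX (v s) + r *: u).
  have C0 := sqr_ge0 (nm (cX (v s) + r * ga)).
  have S0 := sqnorm_ge0 s.
  have dp : 0 < d0 - eps by rewrite subr_gt0.
  have ep : 0 <= eps * qf coefip (AX (v s) + r *: u) by rewrite mulr_ge0// ltW.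
  case: r2 => [/sqnorm_gt0 sp|[s0 r0]].
    have : 0 < nm r ^+ 2 * qu by nra.
    by rewrite pmulr_rgt0 ?sqr_ge0//; [move=> h; split=> //; exact: ltW|
      rewrite lt_neqAle sqr_ge0 andbT eq_sym; apply/eqP => r0;
      move: E; rewrite r0 mul0r; nra].
  have rp : 0 < nm r ^+ 2 by rewrite exprn_even_gt0//= nm_eq0.
  have v0 : v s = 0 by rewrite s0 /v /lcomb big1// => i _; rewrite mxE scale0r.
  have Pu : nm r ^+ 2 * qu = qf H (r *: u) + nm (r * ga) ^+ 2.
    have := E; rewrite v0 linear0 add0r (qf0 hH) (lf0 hbX) (lf0 hcX) nm0 expr0n /= addr0 !add0r.
    by move=> ->.
  have Pu' : eps * qf coefip (r *: u) <= nm r ^+ 2 * qu.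
    by rewrite Pu qfH; have := sqr_ge0 (nm (r * ga)); have := ht; rewrite v0 linear0 add0r; lra.
  split=> [|u0]; first by rewrite -(pmulr_rge0 _ rp) (le_trans _ Pu')// mulr_ge0 ?qf_coefip_ge0// ltW.
  rewrite -(pmulr_rgt0 _ rp) (lt_le_trans _ Pu')// mulr_gt0// (qfZ coefip_hs) mulr_gt0//.
  rewrite lt_neqAle qf_coefip_ge0 andbT eq_sym; apply: contra u0 => /eqP u0.
  by rewrite (qf_coefip_eq0 (p := u)) ?u0.
have free (t : 'rV[C]_N) mu : t != 0 -> lcomb t e - mu *: AX (lcomb t e) != 0.
  by move=> t0; rewrite AXE sub_shift_neq0// lcombX_neq0.
pose t0 : 'rV[C]_N := row ord0 L.
have neg0 : qf (fun x y => H x y + bX x * (bX y)^*) (lcomb t0 e) < 0.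
  have -> : qf (fun x y => H x y + bX x * (bX y)^*) (lcomb t0 e) =
      qf H (lcomb t0 e) + nm (bX (lcomb t0 e)) ^+ 2.
    by rewrite /qf nm_sqr raddfD.
  have dE : lcomb t0 e = v (delta_mx 0 ord0) by rewrite /t0 LE /v lcomb_delta.
  have s1 : 0 < sqnorm (delta_mx 0 ord0 : 'rV[C]_k.+1).
    by apply: sqnorm_gt0; apply/eqP => /rowP/(_ ord0); rewrite !mxE !eqxx => /eqP; rewrite oner_eq0.
  have dp : 0 < d0 - eps by rewrite subr_gt0.
  rewrite dE qfH /bX vsum vip; have := lneg (delta_mx 0 ord0); nra.
have [t [a [h1 h2 h3 h4]]] := pencil_eigenvector hH hbX steinX gramu pos free neg0.
exists eps, (lcomb t e), a; split => //.
- by rewrite eps0.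
- exact: size_lcombX.
split=> // q qN; have := h4 (\row_(i < N) q`_i).
by rewrite -/e -(poly_lcombX qN).
Qed.

End PerturbedPencil.

(** * Observability Gramians *)

Section Szego.
Variable R : realType.
Local Notation C := R[i].
Implicit Types (u v : nat -> C) (a : C).

Lemma climM u v (l m : C) : clim u l -> clim v m -> clim (fun n => u n * v n) (l * m).
Proof.
move=> hu hv.
have : (fun n => nm (u n - l) * nm (v n - m) + nm l * nm (v n - m) + nm m * nm (u n - l))
    @ \oo --> (0 : R) * 0 + nm l * 0 + nm m * 0.
  apply: cvgD; last by apply: cvgM hu; exact: cvg_cst.
  by apply: cvgD; [exact: cvgM|apply: cvgM hv; exact: cvg_cst].
rewrite !mulr0 !addr0; apply: null_le => n; first exact: nm_ge0.
have -> : u n * v n - l * m = (u n - l) * (v n - m) + l * (v n - m) + m * (u n - l) by ring.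
apply: (le_trans (nmD _ _)); rewrite nmM lerD2r.
by apply: (le_trans (nmD _ _)); rewrite !nmM.
Qed.

Lemma clim_shiftn m u (l : C) : clim u l -> clim (fun n => u (n + m)%N) l.
Proof. by rewrite /clim -(cvg_shiftn m). Qed.

Lemma clim_sum N (F : nat -> 'I_N -> C) (l : 'I_N -> C) :
  (forall i, clim (F^~ i) (l i)) -> clim (fun n => \sum_i F n i) (\sum_i l i).
Proof.
move=> hF; elim: (index_enum _) => [|i s IH].
  rewrite big_nil; have -> : (fun n => \sum_(i <- [::]) F n i) = (fun=> (0 : C)).
    by rewrite funeqE => n; rewrite big_nil.
  exact: clim_cst.
rewrite big_cons; have -> : (fun n => \sum_(j <- i :: s) F n j) =
    (fun n => F n i + \sum_(j <- s) F n j).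
  by rewrite funeqE => n; rewrite big_cons.
exact: climD.
Qed.

Lemma clim_exp u (l : C) n : clim u l -> clim (fun m => u m ^+ n) (l ^+ n).
Proof.
move=> hu; elim: n => [|n IH]; first exact: clim_cst.
have -> : (fun m => u m ^+ n.+1) = (fun m => u m * u m ^+ n).
  by rewrite funeqE => m; rewrite exprS.
by rewrite exprS; exact: climM.
Qed.

Lemma cauchy_schwarz_sum m (x y : 'I_m -> C) :
  nm (\sum_j x j * y j) ^+ 2 <= (\sum_j nm (x j) ^+ 2) * (\sum_j nm (y j) ^+ 2).
Proof.
pose F (p q : 'rV[C]_m) := \sum_j p 0 j * (q 0 j)^*.
have hF : hermitian_sesquilinear F.
  split=> [a p q r|p q]; rewrite /F.
    by rewrite mulr_sumr -big_split; apply: eq_bigr => j _; rewrite !mxE /=; ring.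
  by rewrite rmorph_sum; apply: eq_bigr => j _; rewrite rmorphM /= conjCK mulrC.
have qF (p : 'rV[C]_m) : qf F p = \sum_j nm (p 0 j) ^+ 2.
  apply: complexI; rewrite -(qfE hF) /F rmorph_sum.
  by apply: eq_bigr => j _; rewrite nm_sqr.
have pF p : 0 <= qf F p by rewrite qF; apply: sumr_ge0 => j _; exact: sqr_ge0.
have := hs_cauchy_schwarz hF pF (\row_j x j) (\row_j (y j)^*).
have -> : F (\row_j x j) (\row_j (y j)^*) = \sum_j x j * y j.
  by apply: eq_bigr => j _; rewrite !mxE conjCK.
rewrite !qF; congr (_ <= _ * _); apply: eq_bigr => j _; rewrite mxE ?nm_conj//.
Qed.

Lemma geometric_le (r : R) m : 0 <= r <= 1 -> (1 - r ^+ 2) * \sum_(j < m) (r ^+ j) ^+ 2 <= 1.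
Proof.
move=> /andP[r0 r1].
have -> : (1 - r ^+ 2) * \sum_(j < m) (r ^+ j) ^+ 2 = 1 - (r ^+ m) ^+ 2.
  elim: m => [|m IH]; first by rewrite big_ord0 mulr0 expr0 expr1n subrr.
  by rewrite big_ord_recr /= mulrDr IH (exprS r m); ring.
by rewrite gerBl sqr_ge0.
Qed.

Definition szego_term a u j : C := (Num.sqrt (1 - nm a ^+ 2))%:C%C * (a ^+ j * u j).

(* The inner product with the normalised Szego kernel at the conjugate of [a];
   it vanishes when [a] is on the unit circle. *)
Definition szego a u : C := csum (szego_term a u).

Lemma sqrt_defect a : nm a <= 1 -> Num.sqrt (1 - nm a ^+ 2) ^+ 2 = 1 - nm a ^+ 2.
Proof. by move=> a1; rewrite sqr_sqrtr// subr_ge0 expr_le1 ?nm_ge0. Qed.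

(** Cauchy-Schwarz against the powers |a|^j, whose energy is at most 1 after multiplication by 1 -
    |a|^2. *)
Lemma szego_term_sum a u m : nm a <= 1 ->
  (\sum_(j < m) nm (szego_term a u j)) ^+ 2 <= \sum_(j < m) nm (u j) ^+ 2.
Proof.
move=> a1; set s := Num.sqrt (1 - nm a ^+ 2).
have := cauchy_schwarz_sum (fun j : 'I_m => (nm a ^+ j)%:C%C) (fun j : 'I_m => (nm (u j))%:C%C).
have -> : \sum_(j < m) (nm a ^+ j)%:C%C * (nm (u j))%:C%C = (\sum_(j < m) nm a ^+ j * nm (u j))%:C%C.
  by rewrite rmorph_sum; apply: eq_bigr => j _; rewrite rmorphM.
rewrite nm_real real_normK ?num_real//.
have E1 : \sum_(j < m) nm ((nm a ^+ j)%:C%C) ^+ 2 = \sum_(j < m) (nm a ^+ j) ^+ 2.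
  by apply: eq_bigr => j _; rewrite nm_real real_normK ?num_real.
have E2 : \sum_(j < m) nm ((nm (u j))%:C%C) ^+ 2 = \sum_(j < m) nm (u j) ^+ 2.
  by apply: eq_bigr => j _; rewrite nm_real real_normK ?num_real.
rewrite E1 E2 => h.
have -> : \sum_(j < m) nm (szego_term a u j) = s * \sum_(j < m) nm a ^+ j * nm (u j).
  rewrite mulr_sumr; apply: eq_bigr => j _; rewrite /szego_term !nmM nmX nm_real.
  by rewrite ger0_norm ?sqrtr_ge0// mulrA.
rewrite exprMn sqrt_defect//.
have g := @geometric_le (nm a) m; rewrite nm_ge0 a1 in g; have {}g := g isT.
have d0 : 0 <= 1 - nm a ^+ 2 by rewrite subr_ge0 expr_le1 ?nm_ge0.
apply: (le_trans (ler_wpM2l d0 h)); rewrite mulrA ler_piMl//.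
by apply: sumr_ge0 => j _; exact: sqr_ge0.
Qed.

Lemma szego_bound a u m : l2 u -> nm a <= 1 ->
  \sum_(j < m) nm (szego_term a u j) <= Num.sqrt (sq u).
Proof.
move=> hu a1; rewrite -[leLHS]ger0_norm; last by apply: sumr_ge0 => j _; exact: nm_ge0.
rewrite -sqrtr_sqr ler_wsqrtr// (le_trans (szego_term_sum _ _ a1))//.
exact: sq_ub.
Qed.

Lemma szegoP a u : l2 u -> nm a <= 1 ->
  clim (fun m => \sum_(j < m) szego_term a u j) (szego a u).
Proof. by move=> hu a1; apply: csumP => m; exact: szego_bound. Qed.

Lemma szego_psum_le a u m : l2 u -> nm a <= 1 ->
  nm (\sum_(j < m) szego_term a u j) <= Num.sqrt (sq u).
Proof. by move=> hu a1; rewrite (le_trans (nm_sum _ _ _))// szego_bound. Qed.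

Lemma szego_le a u : l2 u -> nm a <= 1 -> nm (szego a u) <= Num.sqrt (sq u).
Proof.
by move=> hu a1; apply: (clim_nmle (szegoP hu a1)) => n; exact: szego_psum_le.
Qed.

Lemma szego_split a u m : l2 u -> nm a <= 1 ->
  szego a u = \sum_(j < m) szego_term a u j + a ^+ m * szego a (iter m (@seqshift R) u).
Proof.
move=> hu a1; apply: (clim_unique (u := fun n => \sum_(j < m + n) szego_term a u j)).
  have := clim_shiftn m (szegoP hu a1).
  by congr clim; apply/funext => n; rewrite addnC.
have := climD (clim_cst (\sum_(j < m) szego_term a u j))
  (climZ (a ^+ m) (szegoP (l2_shiftn m hu) a1)).
congr clim; apply/funext => n; rewrite big_split_ord mulr_sumr; congr (_ + _).
by apply: eq_bigr => j _; rewrite /szego_term shiftnE exprD; ring.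
Qed.

Lemma szego_tail a u m : l2 u -> nm a <= 1 ->
  nm (szego a u - \sum_(j < m) szego_term a u j) <= Num.sqrt (sq (iter m (@seqshift R) u)).
Proof.
move=> hu a1; rewrite (szego_split m hu a1) addrC addKr nmM nmX.
apply: (le_trans (ler_piMl (nm_ge0 _) _)); first by rewrite exprn_ile1 ?nm_ge0.
by apply: szego_le => //; exact: l2_shiftn.
Qed.

Lemma szego_linear a x u v : l2 u -> l2 v -> nm a <= 1 ->
  szego a (fun j => x * u j + v j) = x * szego a u + szego a v.
Proof.
move=> hu hv a1; apply: csum_eq.
have := climD (climZ x (szegoP hu a1)) (szegoP hv a1).
congr clim; apply/funext => n; rewrite mulr_sumr -big_split.
by apply: eq_bigr => j _; rewrite /szego_term /=; ring.
Qed.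

Lemma szego_circle a u : nm a = 1 -> szego a u = 0.
Proof.
move=> a1; apply: csum_eq; have := @clim_cst R 0; congr clim; apply/funext => n.
by rewrite big1// => j _; rewrite /szego_term a1 expr1n subrr sqrtr0 mul0r.
Qed.

(** Each partial sum is continuous in the point, and the tail bound [szego_tail] is uniform over the
    closed disk. The normalising square root is what extends this up to the circle. *)
Lemma szego_continuous (z : nat -> C) a u : l2 u -> (forall n, nm (z n) <= 1) ->
  nm a <= 1 -> clim z a -> clim (fun n => szego (z n) u) (szego a u).
Proof.
move=> hu z1 a1 za.
have part m : clim (fun n => \sum_(j < m) szego_term (z n) u j) (\sum_(j < m) szego_term a u j).
  apply: clim_sum => j; apply: climM; last first.
    by apply: climM; [exact: clim_exp|exact: clim_cst].
  have : (fun n => Num.sqrt (1 - nm (z n) ^+ 2)) @ \oo --> Num.sqrt (1 - nm a ^+ 2).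
    apply: continuous_cvg; first exact: sqrt_continuous.
    apply: cvgB; first exact: cvg_cst.
    by rewrite expr2; under eq_fun do rewrite expr2; apply: cvgM; exact: clim_nm.
  move=> /cvg_dist0; apply: null_le => n; first exact: nm_ge0.
  by rewrite -rmorphB nm_real.
apply/cvgrPdist_le => e e0.
have e3 : 0 < e / 3 by rewrite divr_gt0.
have [m hm] : exists m, Num.sqrt (sq (iter m (@seqshift R) u)) <= e / 3.
  have := sq_shiftn_cvg hu => /cvgrPdist_le/(_ ((e / 3) ^+ 2)).
  rewrite exprn_gt0// => /(_ isT)[m _ /(_ m (leqnn m))].
  rewrite sub0r normrN ger0_norm ?sq_ge0//; last exact: l2_shiftn.
  by move=> h; exists m; rewrite -(ger0_norm (ltW e3)) -sqrtr_sqr; exact: ler_wsqrtr.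
have /cvgrPdist_le/(_ _ e3) := part m; apply: filterS => n /=.
rewrite !sub0r !normrN !(ger0_norm (nm_ge0 _)) => hn.
have -> : szego (z n) u - szego a u = (szego (z n) u - \sum_(j < m) szego_term (z n) u j)
   + (\sum_(j < m) szego_term (z n) u j - \sum_(j < m) szego_term a u j)
   + (\sum_(j < m) szego_term a u j - szego a u) by ring.
apply: (le_trans (nmD _ _)); have := nmD (szego (z n) u - \sum_(j < m) szego_term (z n) u j)
  (\sum_(j < m) szego_term (z n) u j - \sum_(j < m) szego_term a u j).
have := szego_tail m hu (z1 n); have := szego_tail m hu a1; rewrite [X in X <= _ -> _]nmB; lra.
Qed.

End Szego.

Section Observability.
Variables (R : realType) (W : lmodType R[i]) (A : {linear W -> W}).
Local Notation C := R[i].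
Implicit Types (b : W -> C) (x y : W).

Definition orb b x : nat -> C := fun j => b (iter j A x).

Definition l2_functional b : Prop := linear_functional b /\ forall x, l2 (orb b x).

Lemma iter_linear j a x y : iter j A (a *: x + y) = a *: iter j A x + iter j A y.
Proof. by elim: j => //= j ->; rewrite linearP. Qed.

Lemma orb_linear b a x y : linear_functional b ->
  orb b (a *: x + y) = (fun j => a * orb b x j + orb b y j).
Proof. by move=> hb; apply/funext => j; rewrite /orb iter_linear hb. Qed.

Lemma orb_iterS b x : orb b (A x) = seqshift (orb b x).
Proof. by apply/funext => j; rewrite /orb /seqshift iterSr. Qed.

Lemma orb_iter b m x : orb b (iter m A x) = iter m (@seqshift R) (orb b x).
Proof. by elim: m x => //= m IH x; rewrite orb_iterS IH. Qed.

Definition gramian b x y : C := ip (orb b x) (orb b y).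

Lemma gramian_hs b : l2_functional b -> hermitian_sesquilinear (gramian b).
Proof.
move=> [hb h2]; split=> [a x y z|x y]; rewrite /gramian; last exact: ipC.
by rewrite orb_linear// ip_linear.
Qed.

Lemma qf_gramian b x : qf (gramian b) x = sq (orb b x).
Proof. by []. Qed.

Lemma gramian_ge0 b x : l2_functional b -> 0 <= qf (gramian b) x.
Proof. by move=> [hb h2]; exact: sq_ge0. Qed.

Lemma gramianA b x y : l2_functional b ->
  gramian b x y = b x * (b y)^* + gramian b (A x) (A y).
Proof. by move=> [hb h2]; rewrite /gramian ip_shift// !orb_iterS. Qed.

Lemma gramian_iter_cvg b x : l2_functional b ->
  (fun m => qf (gramian b) (iter m A x)) @ \oo --> (0 : R).
Proof.
move=> [hb h2]; have -> : (fun m => qf (gramian b) (iter m A x)) =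
    (fun m => sq (iter m (@seqshift R) (orb b x))).
  by apply/funext => m; rewrite qf_gramian orb_iter.
exact: sq_shiftn_cvg.
Qed.

Lemma gramian_iter_null b x y : l2_functional b -> clim (fun m => gramian b (iter m A x) y) 0.
Proof.
move=> hb; apply/clim0; apply/cvgrPdist_le => e e0.
have hp z : 0 <= qf (gramian b) z by exact: gramian_ge0.
have p1 : 0 < qf (gramian b) y + 1 by rewrite ltr_pwDr.
have /cvgrPdist_le/(_ (e ^+ 2 / (qf (gramian b) y + 1))) := gramian_iter_cvg x hb.
rewrite divr_gt0 ?exprn_gt0// => /(_ isT); apply: filterS => m.
rewrite !sub0r !normrN (ger0_norm (nm_ge0 _)) (ger0_norm (hp _)) => h.
rewrite -(@ler_pXn2r _ 2) ?nnegrE ?nm_ge0 ?(ltW e0)//.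
apply: (le_trans (hs_cauchy_schwarz (gramian_hs hb) hp _ _)).
by move: h; rewrite ler_pdivlMr//; have := hp (iter m A x); nra.
Qed.

(** Nonnegativity of this form says that sending the orbit under [c] to the orbit under [b] is a
    contraction. *)
Definition defect c b x y : C := gramian c x y - gramian b x y.

Lemma qf_defect c b x : qf (defect c b) x = qf (gramian c) x - qf (gramian b) x.
Proof. by rewrite /qf raddfB. Qed.

Lemma defect_hs c b : l2_functional c -> l2_functional b ->
  hermitian_sesquilinear (defect c b).
Proof.
move=> hc hb; have hC := gramian_hs hc; have hB := gramian_hs hb.
split=> [a x y z|x y]; rewrite /defect.
  by rewrite (hsPl hC) (hsPl hB); ring.
by rewrite rmorphB /= -(hsC hC) -(hsC hB).
Qed.

Lemma defect_stein c b x y : l2_functional c -> l2_functional b ->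
  defect c b x y + b x * (b y)^* = defect c b (A x) (A y) + c x * (c y)^*.
Proof.
move=> hc hb; rewrite /defect (gramianA x y hc) (gramianA x y hb); ring.
Qed.

Lemma defect_iter_cvg c b x : l2_functional c -> l2_functional b ->
  (fun m => qf (defect c b) (iter m A x)) @ \oo --> (0 : R).
Proof.
move=> hc hb; have -> : (fun m => qf (defect c b) (iter m A x)) =
    (fun m => qf (gramian c) (iter m A x) - qf (gramian b) (iter m A x)).
  by apply/funext => m; rewrite qf_defect.
by rewrite -(subrr (0 : R)); apply: cvgB; exact: gramian_iter_cvg.
Qed.

Lemma defect_iter_null c b x y : l2_functional c -> l2_functional b ->
  clim (fun m => defect c b (iter m A x) y) 0.
Proof.
move=> hc hb; have := climB (gramian_iter_null x y hc) (gramian_iter_null x y hb).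
by rewrite subrr.
Qed.

End Observability.

(** * Removing a negative square *)

Section Majorant.
Variables (R : realType) (W : lmodType R[i]).
Local Notation C := R[i].
Variable Q : W -> W -> C.
Hypothesis hQ : hermitian_sesquilinear Q.
Variable k : nat.
Hypothesis Qneg : negsq_le k.+1 Q.
Variable l : 'I_k.+1 -> W.
Hypothesis lorth : forall i j, Q (l i) (l j) = - (i == j)%:R.

Definition negpart (x : W) : R := \sum_i nm (Q x (l i)) ^+ 2.

Lemma negpart_ge0 x : 0 <= negpart x.
Proof. by apply: sumr_ge0 => i _; exact: sqr_ge0. Qed.

(** A negative vector orthogonal to [l] would extend [l] to a negative definite tuple of length
    [k.+2]. *)
Lemma qf_ortho_ge0 u : (forall i, Q (l i) u = 0) -> 0 <= qf Q u.
Proof.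
move=> hu.
have [s [r [r2 ht]]] := negsq_le_extend l u Qneg.
have su : Q (lcomb s l) u = 0.
  by rewrite /lcomb (hs_suml hQ) big1// => i _; rewrite (hsZl hQ) hu mulr0.
have ss : qf Q (lcomb s l) = - sqnorm s.
  rewrite /qf (hs_lcomb hQ) /sqnorm -[RHS]/(complex.Re (- sqnorm s)%:C%C); congr complex.Re.
  rewrite rmorphN /sqnorm rmorph_sum -sumrN; apply: eq_bigr => i _.
  rewrite (bigD1 i)//= lorth eqxx big1 ?addr0 => [|j ji].
    by rewrite mulrN1 nm_sqr.
  by rewrite lorth eq_sym (negPf ji) oppr0 mulr0.
rewrite (qfDZ hQ) su mulr0 [complex.Re 0]/= mulr0 addr0 ss in ht.
have nr : 0 <= nm r ^+ 2 by exact: sqr_ge0.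
case: r2 => [/sqnorm_gt0 sp|[s0 r0]].
  by rewrite leNgt; apply/negP => q0; have := mulr_ge0_le0 nr (ltW q0); lra.
have r2 : 0 < nm r ^+ 2 by rewrite exprn_even_gt0//= nm_eq0.
by rewrite -(pmulr_rge0 _ r2); have := sqnorm_ge0 s; lra.
Qed.

(** The right side is Q at the projection of [x] to the orthogonal complement of [l]. The projection
    is x + y, with a plus sign, because each [l i] has square -1. *)
Lemma negpart_bound x : 0 <= qf Q x + negpart x.
Proof.
pose y := \sum_i Q x (l i) *: l i.
have yl i : Q (l i) y = - Q (l i) x.
  rewrite /y (hs_sumr hQ) (bigD1 i)//= big1 ?addr0 => [|j ji].
    by rewrite (hsZr hQ) lorth eqxx mulrN1 -(hsC hQ).
  by rewrite (hsZr hQ) lorth eq_sym (negPf ji) oppr0 mulr0.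
have : 0 <= qf Q (x + y).
  by apply: qf_ortho_ge0 => i; rewrite (hsDr hQ) yl addrN.
suff -> : qf Q (x + y) = qf Q x + negpart x by [].
have yx : Q y x = (negpart x)%:C%C.
  rewrite /y (hs_suml hQ) /negpart rmorph_sum; apply: eq_bigr => i _.
  by rewrite (hsZl hQ) (hsC hQ (l i)) nm_sqr.
have yy : Q y y = - (negpart x)%:C%C.
  rewrite {1}/y (hs_suml hQ) /negpart rmorph_sum -sumrN; apply: eq_bigr => i _.
  by rewrite (hsZl hQ) yl (hsC hQ (l i)) mulrN nm_sqr.
by rewrite /qf (hsDl hQ) !(hsDr hQ) yy (hsC hQ x y) yx conjE conjc_real subrr addr0 raddfD.
Qed.

(** Q with its sign reversed on the span of [l]: a nonnegative quadratic form that serves as a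
    squared seminorm for the indefinite Q. *)
Definition majorant x : R := qf Q x + 2 * negpart x.

Lemma negpart_le_majorant x : negpart x <= majorant x.
Proof. by rewrite /majorant; have := negpart_bound x; lra. Qed.

Lemma majorant_ge0 x : 0 <= majorant x.
Proof. exact: le_trans (negpart_ge0 x) (negpart_le_majorant x). Qed.

Definition majorant_const : R := 1 + 2 * k.+1%:R.

(** The majorant obeys Cauchy-Schwarz with constant 1. Its sesquilinear form differs from Q by twice
    a sum of [k.+1] products, each with the same bound, whence [majorant_const]. *)
Lemma majorant_cs x y :
  nm (Q x y) <= majorant_const * (Num.sqrt (majorant x) * Num.sqrt (majorant y)).
Proof.
pose NN x y := Q x y + 2 * \sum_i Q x (l i) * (Q y (l i))^*.
have hN : hermitian_sesquilinear NN.
  split=> [a u v w|u v]; rewrite /NN.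
    have -> : \sum_i Q (a *: u + v) (l i) * (Q w (l i))^* =
        a * (\sum_i Q u (l i) * (Q w (l i))^*) + \sum_i Q v (l i) * (Q w (l i))^*.
      by rewrite mulr_sumr -big_split; apply: eq_bigr => i _; rewrite (hsPl hQ) /=; ring.
    by rewrite (hsPl hQ); ring.
  rewrite rmorphD rmorphM rmorph_nat /= -(hsC hQ) rmorph_sum; congr (_ + _ * _).
  by apply: eq_bigr => i _; rewrite rmorphM /= conjCK mulrC.
have qN u : qf NN u = majorant u.
  rewrite /qf /NN raddfD /= /majorant /negpart; congr (_ + _).
  rewrite -[RHS]/(complex.Re (2 * \sum_i nm (Q u (l i)) ^+ 2)%:C%C); congr complex.Re.
  by rewrite rmorphM rmorph_nat rmorph_sum; congr (_ * _); apply: eq_bigr => i _; rewrite nm_sqr.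
have cs : nm (NN x y) <= Num.sqrt (majorant x) * Num.sqrt (majorant y).
  rewrite -sqrtrM ?majorant_ge0// -(ger0_norm (nm_ge0 _)) -sqrtr_sqr ler_wsqrtr//.
  rewrite -!qN; apply: hs_cauchy_schwarz => // u; rewrite qN; exact: majorant_ge0.
have one u i : nm (Q u (l i)) <= Num.sqrt (majorant u).
  rewrite -(ger0_norm (nm_ge0 _)) -sqrtr_sqr ler_wsqrtr// (le_trans _ (negpart_le_majorant u))//.
  by rewrite /negpart (bigD1 i)//= lerDl; apply: sumr_ge0 => j _; exact: sqr_ge0.
have -> : Q x y = NN x y - 2 * \sum_i Q x (l i) * (Q y (l i))^* by rewrite /NN addrK.
set z := Num.sqrt _ * Num.sqrt _ in cs *.
have -> : majorant_const * z = z + 2 * (k.+1%:R * z) by rewrite /majorant_const; ring.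
apply: (le_trans (nmD _ _)); rewrite nmN.
apply: lerD => //; rewrite nmM.
have -> : nm (2 : C) = 2 by rewrite -(rmorph_nat (real_complex R)) nm_real ger0_norm.
rewrite ler_wpM2l// (le_trans (nm_sum _ _ _))//.
apply: (@le_trans _ _ (\sum_(i < k.+1) z)).
  by apply: ler_sum => i _; rewrite nmM nm_conj ler_pM ?nm_ge0.
by rewrite sumr_const card_ord mulr_natl.
Qed.

End Majorant.

(** * The iterated eigenvector relation with error terms *)

Section EigenEstimate.
Variables (R : realType) (W : lmodType R[i]) (A : {linear W -> W}).
Local Notation C := R[i].
Variables (c0 b0 : W -> C).
Hypotheses (hc : l2_functional A c0) (hb : l2_functional A b0).
Local Notation Q := (defect A c0 b0).
Variable k : nat.
Hypothesis Qneg : negsq_le k.+1 Q.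
Variables (g : nat -> W) (n : nat).
Hypothesis kn : (k.+1 <= n)%N.
Hypothesis gA : forall j, g (j + n)%N = A (g j).
Local Notation l := (fun i : 'I_k.+1 => g i).
Hypothesis lorth : forall i j, Q (l i) (l j) = - (i == j)%:R.
Variable d0 : R.
Hypothesis d0_gt0 : 0 < d0.
Hypothesis lneg : forall t : 'rV[C]_k.+1,
  qf Q (lcomb t l) + nm (b0 (lcomb t l)) ^+ 2 <= - d0 * sqnorm t.
Local Notation psum := (polysum g).

(** The relation is iterated [m] times on polynomials of size at most n * m. For [r] of size at most
    [n], the polynomial r * 'X^(n * m) shares no exponent with [p], so the perturbation drops out of
    the remainder and only Q(A^m ., G) is left. *)
Lemma eigen_estimate (m : nat) (e0 : R) : (0 < m)%N -> 0 < e0 ->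
  exists (eps : R) (p : {poly C}) (a : C),
    let H := perturbed Q g eps in let G := psum p in
    let q := - qf H p in let s := Num.sqrt (negpart Q l G) in
  [/\ 0 < eps < e0, nm a < 1, 0 < q /\ 0 < s,
      forall r : {poly C}, (size r <= n)%N -> nm (H r p) <=
        nm (Q (iter m A (psum r)) G) +
        Num.sqrt q * nm (\sum_(j < m) szego_term a (orb A b0 (psum r)) j)
    & (forall x, nm (Q x G) <= majorant_const R k * (Num.sqrt (majorant Q l x) * (Num.sqrt 2 * s))) /\
      (forall j, eps * nm p`_j <= Num.sqrt eps * s)].
Proof.
move=> m0 e00; have hQ := defect_hs hc hb.
have stein x y : Q x y + b0 x * (b0 y)^* = Q (A x) (A y) + c0 x * (c0 y)^*.
  exact: defect_stein.
have n0 : (0 < n)%N by apply: leq_trans kn.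
have nN : (n <= n * m)%N by rewrite leq_pmulr.
have [eps [p [a [/andP[eps0 epse] sp a1 qneg [b2 rel]]]]] :=
  perturbed_eigenvector hQ hb.1 hc.1 stein Qneg n0 kn gA d0_gt0 lneg nN e00.
exists eps, p, a => H G q s.
have {}rel (r : {poly C}) : (size r <= n * m)%N ->
  H r p = a * H (r * 'X^n) p - b0 (psum r) * (b0 G)^* := rel r.
have q0 : 0 < q by rewrite oppr_gt0.
have hP := qf_coefip_ge0 p.
have qE : qf H p = qf Q G + eps * qf coefip p by exact: qf_perturbed.
have := negpart_bound hQ Qneg lorth G; set S := negpart Q l G => SB.
have eP : 0 <= eps * qf coefip p by rewrite mulr_ge0// ltW.
have S0 : 0 < S by move: q0; rewrite /q qE; lra.
have s0 : 0 < s by rewrite sqrtr_gt0.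
have ePS : eps * qf coefip p <= S by move: q0; rewrite /q qE; lra.
split => //; first by rewrite eps0.
  move=> r sr.
  have iterH j : (j <= m)%N -> H r p = a ^+ j * H (r * 'X^(n * j)) p -
      (\sum_(i < j) a ^+ i * orb A b0 (psum r) i) * (b0 G)^*.
    elim: j => [|j IH] jm; first by rewrite muln0 expr0 mulr1 mul1r big_ord0 mul0r subr0.
    rewrite (IH (ltnW jm)) rel; last first.
      rewrite (leq_trans (size_polyMleq _ _))// size_polyXn addnS.
      rewrite -(@leq_pmul2l n) // in jm.
      by rewrite (leq_trans _ jm)// mulnS leq_add2r.
    have -> : b0 (psum (r * 'X^(n * j))) = orb A b0 (psum r) j.
      rewrite /orb; congr b0; elim: j {IH jm} => [|j IH]; first by rewrite muln0 mulr1.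
      by rewrite mulnS addnC exprD mulrA (polysumMX _ gA) IH.
    rewrite -mulrA -exprD -mulnSr big_ord_recr exprSr /=.
    by rewrite mulrBr; ring.
  have -> : H r p = a ^+ m * Q (iter m A (psum r)) G -
      (\sum_(i < m) a ^+ i * orb A b0 (psum r) i) * (b0 G)^*.
    rewrite (iterH m)//; congr (_ * _ - _).
    rewrite /H /perturbed; have -> : psum (r * 'X^(n * m)) = iter m A (psum r).
      elim: m {m0 iterH sp rel nN} => [|j IH]; first by rewrite muln0 mulr1.
      by rewrite mulnS addnC exprD mulrA (polysumMX _ gA) IH.
    rewrite /coefip big1 ?mulr0 ?addr0// => i _; rewrite coefMXn.
    case: ltnP => [_|h]; first by rewrite mul0r.
    by rewrite [p`_i]nth_default ?conjC0 ?mulr0// (leq_trans sp).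
  rewrite (le_trans (nmD _ _))// nmN !nmM nm_conj; apply: lerD.
    by rewrite nmX ler_piMl ?nm_ge0// exprn_ile1 ?nm_ge0 ?ltW.
  (* The factor sqrt(1 - |a|^2) in the bound on |b0 G| is exactly the normalisation of the Szego
     functional. *)
  have -> : \sum_(j < m) szego_term a (orb A b0 (psum r)) j =
      (Num.sqrt (1 - nm a ^+ 2))%:C%C * \sum_(i < m) a ^+ i * orb A b0 (psum r) i.
    by rewrite mulr_sumr.
  rewrite nmM nm_real ger0_norm ?sqrtr_ge0// mulrA [leLHS]mulrC ler_wpM2r ?nm_ge0//.
  rewrite -sqrtrM ?(ltW q0)// -(ger0_norm (nm_ge0 (b0 G))) -sqrtr_sqr.
  by apply: ler_wsqrtr; rewrite mulrC.
have sS : s ^+ 2 = S by rewrite sqr_sqrtr// ltW.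
(* Negativity of H(p) yields Q(G) < 0, hence a majorant of at most 2 S; with Q(G) >= - S it also
   yields eps * |p|^2 <= S. *)
split=> [x|j].
  apply: (le_trans (majorant_cs hQ Qneg lorth x G)).
  rewrite ler_wpM2l ?addr_ge0 ?mulr_ge0 ?ler0n// ler_wpM2l ?sqrtr_ge0//.
  rewrite /s -sqrtrM// ler_wsqrtr// /majorant -/S.
  by move: q0; rewrite /q qE; lra.
rewrite -(@ler_pXn2r _ 2) ?nnegrE ?mulr_ge0 ?nm_ge0 ?sqrtr_ge0 ?(ltW eps0)//.
rewrite !exprMn sS sqr_sqrtr ?(ltW eps0)// expr2 -mulrA ler_wpM2l ?(ltW eps0)//.
by apply: le_trans ePS; rewrite ler_wpM2l ?(ltW eps0)// qf_coefip_ge_coef.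
Qed.

End EigenEstimate.

Lemma null_sum (R : realType) (I : finType) (F : nat -> I -> R) :
  (forall i, F^~ i @ \oo --> (0 : R)) -> (fun n => \sum_i F n i) @ \oo --> (0 : R).
Proof.
move=> hF; elim: (index_enum _) => [|i s IH].
  rewrite (_ : (fun n => \sum_(i <- [::]) F n i) = (fun=> 0)); first exact: cvg_cst.
  by rewrite funeqE => n; rewrite big_nil.
rewrite (_ : (fun n => \sum_(j <- i :: s) F n j) = (fun n => F n i + \sum_(j <- s) F n j)).
  by rewrite -[X in _ --> X](addr0 (0 : R)); apply: cvgD.
by rewrite funeqE => n; rewrite big_cons.
Qed.

(** * Approximate removal of a negative square for finitely many tuples *)

Section Approximation.
Variables (R : realType) (W : lmodType R[i]) (A : {linear W -> W}).
Local Notation C := R[i].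
Variables (c0 b0 : W -> C).
Hypotheses (hc : l2_functional A c0) (hb : l2_functional A b0).
Local Notation Q := (defect A c0 b0).
Variable k : nat.
Hypothesis Qneg : negsq_le k.+1 Q.

Lemma polysum_lcomb (g : nat -> W) n (t : 'rV[C]_n) (w : 'I_n -> {poly C}) :
  polysum g (lcomb t w) = lcomb t (fun i => polysum g (w i)).
Proof.
rewrite /lcomb; elim/big_rec2: _ => [|i x y _ <-].
  by rewrite /polysum size_poly0 big_ord0.
by rewrite polysum_linear.
Qed.

Lemma nm_functional_le n (f : W -> C) (t : 'rV[C]_n) (w : 'I_n -> W) :
  linear_functional f -> sqnorm t = 1 -> nm (f (lcomb t w)) <= \sum_i nm (f (w i)).
Proof.
move=> hf t1; rewrite (lf_lcomb hf) (le_trans (nm_sum _ _ _))//.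
apply: ler_sum => i _; rewrite nmM ler_piMl ?nm_ge0//.
rewrite -(@ler_pXn2r _ 2) ?nnegrE ?nm_ge0 ?ler01// expr1n -t1 /sqnorm (bigD1 i)//=.
by rewrite lerDl; apply: sumr_ge0 => j _; exact: sqr_ge0.
Qed.

(* The [A]-orbits of the [J * k.+1] vectors [F s i], interleaved so that
   multiplication by ['X^(J * k.+1)] acts as [A] under [polysum]. *)
Definition orbit_gen (F : nat -> 'I_k.+1 -> W) (J j : nat) : W :=
  let n := (J * k.+1)%N in
  iter (j %/ n) A (F ((j %% n) %/ k.+1)%N (inord ((j %% n) %% k.+1))).

Lemma orbit_genA F J j : (0 < J)%N ->
  orbit_gen F J (j + J * k.+1)%N = A (orbit_gen F J j).
Proof.
move=> J0; have n0 : (0 < J * k.+1)%N by rewrite muln_gt0 J0.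
by rewrite /orbit_gen divnDr ?dvdnn// divnn n0 modnDr addn1.
Qed.

Lemma orbit_gen_tuple F J s (i : 'I_k.+1) : (s < J)%N ->
  orbit_gen F J (s * k.+1 + i) = F s i.
Proof.
move=> sJ; have lt : (s * k.+1 + i < J * k.+1)%N.
  by rewrite -ltn_divLR// divnMDl// divn_small ?addn0.
rewrite /orbit_gen divn_small// modn_small// divnMDl// divn_small// addn0.
by rewrite modnMDl modn_small// inord_val.
Qed.

Variable F : nat -> 'I_k.+1 -> W.
Local Notation l := (F 0).
Hypothesis lorth : forall i j, Q (l i) (l j) = - (i == j)%:R.
Variable d0 : R.
Hypothesis d0_gt0 : 0 < d0.
Hypothesis lneg : forall t : 'rV[C]_k.+1,
  qf Q (lcomb t l) + nm (b0 (lcomb t l)) ^+ 2 <= - d0 * sqnorm t.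

Let hQ : hermitian_sesquilinear Q := defect_hs hc hb.

Lemma majorant_iter_cvg x :
  (fun m => Num.sqrt (majorant Q l (iter m A x))) @ \oo --> (0 : R).
Proof.
rewrite -(sqrtr0 R); apply: continuous_cvg; first exact: sqrt_continuous.
have -> : (0 : R) = 0 + 2 * 0 by rewrite mulr0 addr0.
apply: cvgD; first exact: defect_iter_cvg.
apply: cvgM; first exact: cvg_cst.
apply: null_sum => i.
have /clim0 h := defect_iter_null x (l i) hc hb.
by rewrite -(mulr0 (0 : R)); exact: (cvgM h h).
Qed.

Section Estimate.
Variables (J : nat) (m : nat).
Hypotheses (J0 : (0 < J)%N) (m0 : (0 < m)%N).

Definition family_sum (f : W -> R) : R := \sum_(s < J) \sum_(i < k.+1) f (F s i).

Lemma family_sum_ge f s : (forall x, 0 <= f x) -> (s < J)%N -> \sum_(i < k.+1) f (F s i) <= family_sum f.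
Proof.
move=> f0 sJ; rewrite /family_sum (bigD1 (Ordinal sJ))//= lerDl.
by apply: sumr_ge0 => j _; exact: sumr_ge0.
Qed.

Lemma family_sum_ge0 f : (forall x, 0 <= f x) -> 0 <= family_sum f.
Proof. by move=> f0; apply: sumr_ge0 => s _; exact: sumr_ge0. Qed.

Let eta x := majorant_const R k * (Num.sqrt (majorant Q l (iter m A x)) * Num.sqrt 2).
Let tail x := Num.sqrt (sq (iter m (@seqshift R) (orb A b0 x))).
Let bnorm x := Num.sqrt (sq (orb A b0 x)).

Let eta0 x : 0 <= eta x.
Proof. by rewrite !mulr_ge0 ?sqrtr_ge0// addr_ge0// mulr_ge0// ler0n. Qed.

(** Each tuple, joined with the eigenvector [G], has a nonnegative combination. Eliminating [G] adds
    |H(., p)|^2 / q to the form, and the eigenvector relation bounds this by the squared Szego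
    functional up to [th], which is small for large [m]. *)
Lemma approx_estimate (e0 : R) : 0 < e0 ->
  k.+1%:R * Num.sqrt e0 <= 4^-1 -> family_sum eta <= 4^-1 ->
  exists2 a : C, nm a < 1 & forall s, (s < J)%N ->
    exists2 t : 'rV[C]_k.+1, sqnorm t = 1 &
      let th := 2 * (1 + family_sum bnorm) * family_sum eta + family_sum tail in
      - (e0 + 2 * family_sum bnorm * th + th ^+ 2) <=
      qf Q (lcomb t (F s)) + nm (szego a (orb A b0 (lcomb t (F s)))) ^+ 2.
Proof.
move=> e00 small1 small2.
set g := orbit_gen F J.
have gA j : g (j + J * k.+1)%N = A (g j) by exact: orbit_genA.
have gl : (fun i : 'I_k.+1 => g i) = l.
  by apply/funext => i; rewrite -(orbit_gen_tuple F (s := 0) i J0) mul0n.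
have kn : (k.+1 <= J * k.+1)%N by rewrite leq_pmull.
have [eps [p [a]]] := @eigen_estimate R W A c0 b0 hc hb k Qneg g _ kn gA
  (ltac:(rewrite gl; exact: lorth)) d0 d0_gt0 (ltac:(rewrite gl; exact: lneg)) m e0 m0 e00.
rewrite gl; set H := perturbed Q g eps; set G := polysum g p; set q := - qf H p.
set sg := Num.sqrt (negpart Q l G) => /= -[/andP[eps0 epse] a1 [q0 sg0] hH [hQG hp]].
have {}q0 : 0 < q := q0; have {}sg0 : 0 < sg := sg0.
have {}hp j : eps * nm p`_j <= Num.sqrt eps * sg := hp j.
have {}hQG x : nm (Q x G) <=
  majorant_const R k * (Num.sqrt (majorant Q l x) * (Num.sqrt 2 * sg)) := hQG x.
exists a => // s sJ; set sq_q := Num.sqrt q in hH.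
have sqq : sq_q ^+ 2 = q by rewrite sqr_sqrtr// ltW.
have sqq0 : 0 < sq_q by rewrite sqrtr_gt0.
have etaP x : nm (Q (iter m A x) G) <= eta x * sg.
  by apply: (le_trans (hQG _)); rewrite /eta !mulrA.
have bn0 x : 0 <= bnorm x by exact: sqrtr_ge0.
have tl0 x : 0 <= tail x by exact: sqrtr_ge0.
have a1' := ltW a1.
(* This converts errors relative to [sg] into errors relative to sqrt q. In [sg] <= sum_i |Q(G, l
   i)|, the two smallness hypotheses bound the error terms by sg / 2, which is absorbed on the
   left. *)
have lowq : sg <= 2 * (1 + family_sum bnorm) * sq_q.
  have one (i : 'I_k.+1) : nm (Q G (l i)) <= Num.sqrt e0 * sg + eta (l i) * sg + sq_q * bnorm (l i).
    have lE : polysum g 'X^i = l i by rewrite polysumX -gl.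
    have := hH 'X^i; rewrite size_polyXn lE (leq_trans (ltn_ord i) kn) => /(_ isT) h1.
    have -> : Q G (l i) = (H 'X^i p - eps%:C%C * (p`_i)^*)^*.
      rewrite (hsC hQ); congr (_^*); rewrite /H /perturbed lE.
      rewrite (_ : coefip _ _ = (p`_i)^*) ?addrK//.
      rewrite /coefip size_polyXn big_ord_recr /= coefXn eqxx mul1r big1 ?add0r// => j _.
      by rewrite coefXn (ltn_eqF (ltn_ord j)) mul0r.
    rewrite nm_conj (le_trans (nmD _ _))// nmN nmM nm_conj nm_real (ger0_norm (ltW eps0)).
    have h2 := hp i.
    have h3 : Num.sqrt eps * sg <= Num.sqrt e0 * sg.
      by rewrite ler_wpM2r ?(ltW sg0)//; apply: ler_wsqrtr; exact: ltW.
    have h4 := etaP (l i).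
    have h5 : sq_q * nm (\sum_(j < m) szego_term a (orb A b0 (l i)) j) <= sq_q * bnorm (l i).
      rewrite ler_wpM2l ?(ltW sqq0)//; apply: szego_psum_le => //; exact: hb.2.
    lra.
  have sum1 : sg <= \sum_i nm (Q G (l i)).
    have le1 i : nm (Q G (l i)) <= sg.
      rewrite /sg -(ger0_norm (nm_ge0 (Q G (l i)))) -sqrtr_sqr; apply: ler_wsqrtr.
      by rewrite /negpart (bigD1 i)//= lerDl; apply: sumr_ge0 => j _; exact: sqr_ge0.
    rewrite -(ler_pM2l sg0) -expr2 sqr_sqrtr; last by rewrite ltW// -sqrtr_gt0.
    rewrite mulr_sumr; apply: ler_sum => i _; rewrite expr2 ler_wpM2r ?nm_ge0//.
  have sum2 : \sum_i nm (Q G (l i)) <= k.+1%:R * Num.sqrt e0 * sg + family_sum eta * sg + sq_q * family_sum bnorm.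
    apply: (le_trans (ler_sum _ (fun i _ => one i))); rewrite !big_split /=.
    apply: lerD; [apply: lerD|].
    - by rewrite sumr_const card_ord -mulrA mulr_natl.
    - by rewrite -mulr_suml ler_wpM2r ?(ltW sg0)//; exact: (@family_sum_ge _ 0 eta0 J0).
    - by rewrite -mulr_sumr ler_wpM2l ?(ltW sqq0)//; exact: (@family_sum_ge _ 0 bn0 J0).
  have := ler_wpM2r (ltW sg0) small1; have := ler_wpM2r (ltW sg0) small2; lra.
have [t0 [rho [tr ht]]] := negsq_le_extend (F s) G Qneg.
pose rr (t : 'rV[C]_k.+1) : {poly C} := lcomb t (fun i => 'X^(s * k.+1 + i)).
have rsum t : polysum g (rr t) = lcomb t (F s).
  by rewrite /rr polysum_lcomb /lcomb; apply: eq_bigr => i _; rewrite polysumX /g orbit_gen_tuple.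
have rsize t : (size (rr t) <= J * k.+1)%N.
  apply/leq_sizeP => j hj; rewrite /rr /lcomb coef_sum big1// => i _; rewrite coefZ coefXn.
  case: eqP => [ji|]; last by rewrite mulr0.
  move: hj; rewrite ji leqNgt.
  by have -> : (s * k.+1 + i < J * k.+1)%N by rewrite -ltn_divLR// divnMDl// divn_small ?addn0.
have rip t : qf coefip (rr t) = sqnorm t.
  have -> : rr t = lcomb t (fun i => 'X^i) * 'X^(s * k.+1).
    by rewrite /rr /lcomb mulr_suml; apply: eq_bigr => i _; rewrite -scalerAl -exprD addnC.
  rewrite /qf coefipMX -/(qf _ _); apply: complexI.
  rewrite -(qfE coefip_hs) (@coefip_widen _ _ _ k.+1) ?size_lcombX//.
  by rewrite rmorph_sum; apply: eq_bigr => i _; rewrite coef_lcombX valK nm_sqr.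
have hH' : hermitian_sesquilinear H by exact: perturbed_hs.
have HE t : qf H (rr t) = qf Q (lcomb t (F s)) + eps * sqnorm t.
  by rewrite /H qf_perturbed rsum rip.
have ht' : 0 <= qf H (rr t0 + rho *: p).
  rewrite /H qf_perturbed addrC addrC; have -> : polysum g (rr t0 + rho *: p) = lcomb t0 (F s) + rho *: G.
    by rewrite [in LHS]addrC polysum_linear rsum addrC.
  by rewrite addr_ge0// mulr_ge0 ?qf_coefip_ge0// ltW.
rewrite (qfDZ hH') in ht'.
(* Completing the square in |rho| removes [p] from the combination. If [t0] were 0, the combination
   would be a nonzero multiple of [p], on which [H] is negative. *)
have key : 0 <= qf H (rr t0) + nm (H (rr t0) p) ^+ 2 / q /\ t0 != 0.
  split.
    have h1 := nm_Re (rho^* * H (rr t0) p); rewrite nmM nm_conj in h1.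
    have h2 := ler_norm (complex.Re (rho^* * H (rr t0) p)).
    set h := nm (H (rr t0) p) in h1 *; set rh := nm rho in h1 ht' *.
    have h3 : 2 * (rh * h) <= rh ^+ 2 * q + h ^+ 2 / q.
      have : 0 <= (rh * q - h) ^+ 2 / q by rewrite divr_ge0 ?sqr_ge0// ltW.
      have -> : (rh * q - h) ^+ 2 / q = rh ^+ 2 * q - 2 * (rh * h) + h ^+ 2 / q.
        by field; rewrite gt_eqF.
      lra.
    have : qf H p = - q by rewrite /q opprK.
    move: ht' => + e; rewrite e; lra.
  case: tr => // -[t00 rho0]; exfalso; move: ht'; rewrite t00.
  have -> : rr 0 = 0 by rewrite /rr /lcomb big1// => i _; rewrite mxE scale0r.
  rewrite (qf0 hH') (hs0l hH') mulr0 [complex.Re 0]/= mulr0 !add0r.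
  have rho2 : 0 < nm rho ^+ 2 by rewrite exprn_even_gt0//= nm_eq0.
  by rewrite pmulr_rge0// leNgt -oppr_gt0 q0.
move: key => [key t00].
pose cst := (Num.sqrt (sqnorm t0))^-1; pose t := cst%:C%C *: t0.
have sp := sqnorm_gt0 t00.
have cst2 : cst ^+ 2 * sqnorm t0 = 1.
  by rewrite exprVn sqr_sqrtr ?ltW// mulVf// gt_eqF.
have t1 : sqnorm t = 1.
  rewrite -cst2 /sqnorm mulr_sumr; apply: eq_bigr => i _.
  by rewrite mxE nmM nm_real exprMn real_normK ?num_real.
have rt : rr t = cst%:C%C *: rr t0 by rewrite /rr lcombZ.
exists t => //; set x := lcomb t (F s).
set th := 2 * (1 + family_sum bnorm) * family_sum eta + family_sum tail.
have keyt : 0 <= qf H (rr t) + nm (H (rr t) p) ^+ 2 / q.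
  rewrite rt (qfZ hH') (hsZl hH') nmM.
  rewrite (_ : _ + _ = nm cst%:C%C ^+ 2 * (qf H (rr t0) + nm (H (rr t0) p) ^+ 2 / q)).
    by rewrite mulr_ge0 ?sqr_ge0.
  by ring.
rewrite HE t1 mulr1 -/x in keyt.
have xlin f : linear_functional f -> nm (f x) <= \sum_i nm (f (F s i)).
  by move=> hf; exact: nm_functional_le.
have hx : nm (Q (iter m A x) G) <= family_sum eta * sg.
  have hf : linear_functional (fun y => Q (iter m A y) G).
    by move=> z y1 y2; rewrite iter_linear (hsPl hQ).
  apply: (le_trans (xlin _ hf)); apply: (@le_trans _ _ (\sum_i eta (F s i) * sg)).
    by apply: ler_sum => i _; exact: etaP.
  by rewrite -mulr_suml ler_wpM2r ?(ltW sg0)//; exact: (@family_sum_ge _ s eta0 sJ).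
set Sm := \sum_(j < m) szego_term a (orb A b0 x) j.
set Sx := szego a (orb A b0 x).
have hSz : linear_functional (fun y => szego a (orb A b0 y)).
  by move=> z y1 y2; rewrite (orb_linear _ _ _ _ hb.1) szego_linear//; exact: hb.2.
have hSx : nm Sx <= family_sum bnorm.
  apply: (le_trans (xlin _ hSz)); apply: (@le_trans _ _ (\sum_i bnorm (F s i))).
    by apply: ler_sum => i _; apply: szego_le => //; exact: hb.2.
  exact: (@family_sum_ge _ s bn0 sJ).
have hSm : nm Sm <= nm Sx + family_sum tail.
  have hf : linear_functional (fun y => \sum_(j < m) szego_term a (orb A b0 y) j - szego a (orb A b0 y)).
    move=> z y1 y2; rewrite hSz (orb_linear _ _ _ _ hb.1).
    have -> : \sum_(j < m) szego_term a (fun j => z * orb A b0 y1 j + orb A b0 y2 j) j =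
       z * (\sum_(j < m) szego_term a (orb A b0 y1) j) + \sum_(j < m) szego_term a (orb A b0 y2) j.
      by rewrite mulr_sumr -big_split; apply: eq_bigr => j _; rewrite /szego_term /=; ring.
    ring.
  have := xlin _ hf => h.
  have h' : \sum_i nm (\sum_(j < m) szego_term a (orb A b0 (F s i)) j - szego a (orb A b0 (F s i)))
      <= family_sum tail.
    apply: (@le_trans _ _ (\sum_i tail (F s i))); last exact: (@family_sum_ge _ s tl0 sJ).
    by apply: ler_sum => i _; rewrite nmB; apply: szego_tail => //; exact: hb.2.
  have := nmD Sx (Sm - Sx); rewrite addrC subrK; move: (le_trans h h'); rewrite -/Sm -/Sx; lra.
have hHr : nm (H (rr t) p) <= sq_q * (nm Sx + th).
  apply: (le_trans (hH _ (rsize t))); rewrite rsum -/x -/Sm.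
  have e1 := ler_wpM2l (family_sum_ge0 eta0) lowq.
  have e2 := ler_wpM2l (ltW sqq0) hSm.
  rewrite /th; move: hx e1 e2; lra.
have th0 : 0 <= th.
  rewrite addr_ge0 ?family_sum_ge0// mulr_ge0 ?family_sum_ge0//.
  by rewrite mulr_ge0// addr_ge0// family_sum_ge0.
have h1 : nm (H (rr t) p) ^+ 2 / q <= (nm Sx + th) ^+ 2.
  rewrite ler_pdivrMr// -sqq -exprMn [X in _ <= X ^+ 2]mulrC.
  by rewrite ler_pXn2r// nnegrE ?nm_ge0// mulr_ge0 ?(ltW sqq0)// addr_ge0 ?nm_ge0.
have h2 : (nm Sx + th) ^+ 2 <= nm Sx ^+ 2 + 2 * family_sum bnorm * th + th ^+ 2.
  have := ler_wpM2r th0 hSx; rewrite sqrrD mulr2n; lra.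
lra.
Qed.

End Estimate.
End Approximation.

Section UnitDiskCompactness.
Variable R : realType.
Local Notation C := R[i].

(* Compactness of the closed disk in the form needed here: the points are only
   required to lie in its interior. *)
Lemma unit_disk_fip (I : choiceType) (i0 : I) (Z : I -> set C) :
  (forall s : seq I, exists2 a, nm a < 1 & forall i, i \in s -> Z i a) ->
  exists2 a, nm a <= 1 &
    forall i, exists z : nat -> C,
      [/\ forall n, nm (z n) < 1, forall n, Z i (z n) & clim z a].
Proof.
move=> fip; pose cx (p : R * R) : C := (p.1 +i* p.2)%C.
pose K : set (R * R) := `[-1, 1]%classic `*` `[-1, 1]%classic.
have cK : compact K by apply: compact_setX; exact: segment_compact.
pose Y i : set (R * R) := [set p | nm (cx p) < 1 /\ Z i (cx p)].
have YK p : nm (cx p) < 1 -> K p.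
  move=> p1; have h1 := nm_Re (cx p); have h2 := nm_Im (cx p).
  by split; rewrite /= in_itv /= -ler_norml (le_trans _ (ltW p1)).
(* The filter generated by the sets [Y i]; it is proper by the finite intersection property, and its
   cluster point is approached inside every [Y i]. *)
pose F : set_system (R * R) :=
  [set X | exists s : seq I, forall p, (forall i, i \in s -> Y i p) -> X p].
have FF : ProperFilter F.
  apply: Build_ProperFilter_ex => [X [s hs]|].
    have [a a1 ha] := fip s; exists (complex.Re a, complex.Im a); apply: hs => i si.
    have aE : cx (complex.Re a, complex.Im a) = a by rewrite /cx /=; case: (a).
    by rewrite /Y /= aE; split => //; apply: ha.
  split=> [|X X' [s hs] [s' hs']|X X' XX' [s hs]]; first by exists [::].
    exists (s ++ s') => p hp; split; [apply: hs|apply: hs'] => i si; apply: hp;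
      by rewrite mem_cat si ?orbT.
  by exists s => p hp; apply: XX'; exact: hs.
have FY i : F (Y i) by exists [:: i] => p; apply; rewrite mem_head.
have [|p [_ hp]] := cK F FF.
  by apply: filterS (FY i0) => p [p1 _]; exact: YK.
have seq i : exists z : nat -> C, [/\ forall n, nm (z n) < 1, forall n, Z i (z n) & clim z (cx p)].
  have ex n : exists z, [/\ nm z < 1, Z i z & nm (z - cx p) <= 2 / n.+1%:R].
    have [|q [[q1 q2] bq]] := hp (Y i) (ball p (n.+1%:R^-1)) (FY i).
      by apply: nbhsx_ballx; rewrite invr_gt0.
    exists (cx q); split => //; apply: (le_trans (nm_leReIm _)).
    rewrite mulr_natl mulr2n; case: bq => /=; rewrite /ball /= => b1 b2.
    by apply: lerD; rewrite distrC ltW.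
  exists (fun n => projT1 (cid (ex n))); split=> [n|n|].
  - by case: (projT2 (cid (ex n))).
  - by case: (projT2 (cid (ex n))).
  have : (fun n => 2 / n.+1%:R : R) @ \oo --> (0 : R).
    rewrite -(mulr0 (2 : R)); apply: cvgM; first exact: cvg_cst.
    exact: cvg_harmonic.
  apply: null_le => n; first exact: nm_ge0.
  by case: (projT2 (cid (ex n))).
exists (cx p) => //.
have [z [z1 _ zp]] := seq i0; apply: (clim_nmle zp) => n; exact: ltW.
Qed.

End UnitDiskCompactness.
Section NegativeSquareReduction.
Variables (R : realType) (W : lmodType R[i]) (A : {linear W -> W}).
Local Notation C := R[i].
Variables (c0 b0 : W -> C).
Hypotheses (hc : l2_functional A c0) (hb : l2_functional A b0).
Local Notation Q := (defect A c0 b0).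
Variable k : nat.
Hypothesis Qneg : negsq_le k.+1 Q.

Let hQ : hermitian_sesquilinear Q := defect_hs hc hb.

Definition szego_functional a x : C := szego a (orb A b0 x).

Lemma szego_functional_linear a : nm a <= 1 -> linear_functional (szego_functional a).
Proof.
move=> a1 z x y; rewrite /szego_functional (orb_linear _ _ _ _ hb.1).
by rewrite szego_linear//; exact: hb.2.
Qed.

Definition reduced a x y : C := Q x y + szego_functional a x * (szego_functional a y)^*.

Lemma qf_reduced a x : qf (reduced a) x = qf Q x + nm (szego_functional a x) ^+ 2.
Proof. by rewrite /qf /reduced nm_sqr raddfD. Qed.

Lemma reduced_hs a : nm a <= 1 -> hermitian_sesquilinear (reduced a).
Proof.
move=> a1; have := hs_add_rank1 1 hQ (szego_functional_linear a1).
congr hermitian_sesquilinear; apply/funext => x; apply/funext => y.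
by rewrite /reduced mul1r.
Qed.

Lemma szego_functional0 x : szego_functional 0 x = b0 x.
Proof.
rewrite /szego_functional (szego_split 1 (hb.2 x)) ?nm0// expr1 mul0r addr0 big_ord1.
by rewrite /szego_term nm0 expr0n /= subr0 sqrtr1 expr0 mul1r mul1r.
Qed.

Section Pole.
Variable F : nat -> 'I_k.+1 -> W.
Hypothesis lorth : forall i j, Q (F 0 i) (F 0 j) = - (i == j)%:R.
Variable d0 : R.
Hypothesis d0_gt0 : 0 < d0.
Hypothesis lneg : forall t : 'rV[C]_k.+1,
  qf Q (lcomb t (F 0)) + nm (b0 (lcomb t (F 0))) ^+ 2 <= - d0 * sqnorm t.

(** A single [a] serves finitely many tuples at once, which is the finite intersection property
    needed for compactness. *)
Lemma approximate_pole (J : nat) (e : R) : 0 < e ->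
  exists2 a : C, nm a < 1 & forall s, (s < J)%N ->
    exists2 t : 'rV[C]_k.+1, sqnorm t = 1 & - e <= qf (reduced a) (lcomb t (F s)).
Proof.
case: J => [|J] e0; first by exists 0; rewrite ?nm0.
pose eta m x := majorant_const R k *
  (Num.sqrt (majorant Q (F 0) (iter m A x)) * Num.sqrt 2).
pose tail m x := Num.sqrt (sq (iter m (@seqshift R) (orb A b0 x))).
pose bnorm x := Num.sqrt (sq (orb A b0 x)).
pose B := family_sum F J.+1 bnorm.
have B0 : 0 <= B by apply: family_sum_ge0 => x; exact: sqrtr_ge0.
have eta_cvg : (fun m => family_sum F J.+1 (eta m)) @ \oo --> (0 : R).
  apply: null_sum => s; apply: null_sum => i.
  have := cvgM (cvg_cst (majorant_const R k))
    (cvgM (majorant_iter_cvg hc hb F (F s i)) (cvg_cst (Num.sqrt (2 : R)))).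
  by rewrite mul0r mulr0; apply.
have tail_cvg : (fun m => family_sum F J.+1 (tail m)) @ \oo --> (0 : R).
  apply: null_sum => s; apply: null_sum => i; rewrite -(sqrtr0 R).
  apply: continuous_cvg; first exact: sqrt_continuous.
  exact: (sq_shiftn_cvg (hb.2 _)).
pose th m := 2 * (1 + B) * family_sum F J.+1 (eta m) + family_sum F J.+1 (tail m).
have th_cvg : th @ \oo --> (0 : R).
  have : th @ \oo --> 2 * (1 + B) * 0 + 0.
    by apply: cvgD => //; apply: cvgM eta_cvg; exact: cvg_cst.
  by rewrite mulr0 addr0.
(* For th <= 1 the error 2 B th + th^2 is at most (2 B + 1) th, hence at most e / 2 when th <= d. *)
pose d := Num.min 1 (e / (2 * (2 * B + 1))).
have B1 : 0 < 2 * (2 * B + 1) by lra.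
have d_gt0 : 0 < d by rewrite lt_min ltr01 divr_gt0.
have [m [m0 hth heta]] : exists m, [/\ (0 < m)%N, th m <= d & family_sum F J.+1 (eta m) <= 4^-1].
  have /cvgrPdist_le/(_ _ d_gt0)[N1 _ h1] := th_cvg.
  have q0 : 0 < 4^-1 :> R by rewrite invr_gt0.
  have /cvgrPdist_le/(_ _ q0)[N2 _ h2] := eta_cvg.
  pose m := (N1 + N2).+1; exists m; split => //.
    have := h1 m; rewrite /= sub0r normrN => h; apply: le_trans (ler_norm _) (h _).
    by rewrite /m; lia.
  have := h2 m; rewrite /= sub0r normrN => h; apply: le_trans (ler_norm _) (h _).
  by rewrite /m; lia.
(* Chosen so that sqrt e1 <= s4 gives the bound 1/4 required by [approx_estimate]. *)
pose s4 : R := (4 * k.+1%:R)^-1.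
have s40 : 0 < s4 by rewrite invr_gt0 mulr_gt0.
pose e1 := Num.min (e / 2) (s4 ^+ 2).
have e10 : 0 < e1 by rewrite lt_min divr_gt0 ?exprn_gt0.
have small1 : k.+1%:R * Num.sqrt e1 <= 4^-1.
  have -> : 4^-1 = k.+1%:R * s4 by rewrite /s4 invfM mulrCA mulfV ?mulr1 ?pnatr_eq0.
  rewrite ler_wpM2l// -(ger0_norm (ltW s40)) -sqrtr_sqr; apply: ler_wsqrtr.
  by rewrite ge_min lexx orbT.
have [a a1 ha] := approx_estimate hc hb Qneg lorth d0_gt0 lneg (ltn0Sn J) m0 e10 small1 heta.
exists a => // s sJ; have [t t1 ht] := ha s sJ; exists t => //.
rewrite qf_reduced; apply: le_trans ht; rewrite -/bnorm -/B -/(eta m) -/(tail m) -/(th m).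
have th0 : 0 <= th m.
  rewrite addr_ge0// ?mulr_ge0 ?addr_ge0//; apply: family_sum_ge0 => x; rewrite ?sqrtr_ge0//.
  by rewrite !mulr_ge0 ?sqrtr_ge0// addr_ge0// mulr_ge0// ler0n.
have e1e : e1 <= e / 2 by rewrite ge_min lexx.
have d1 : d <= 1 by rewrite ge_min lexx.
have de : d * (2 * B + 1) <= e / 2.
  apply: (@le_trans _ _ (e / (2 * (2 * B + 1)) * (2 * B + 1))).
    by rewrite ler_wpM2r ?ge_min ?lexx ?orbT//; lra.
  by rewrite invfM mulrA -mulrA mulVf ?mulr1//; apply: lt0r_neq0; lra.
have t1m : th m <= 1 := le_trans hth d1.
have sq1 : th m ^+ 2 <= th m by rewrite expr2 ler_piMl.
have : (2 * B + 1) * th m <= (2 * B + 1) * d by rewrite ler_wpM2l//; lra.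
lra.
Qed.

End Pole.

(** The conditions on [a] are indexed by a tuple and a tolerance, and compactness produces a common
    limit point. The coefficient vectors [t] may vary along the approximating points; their unit
    norm makes the convergence of the Szego functionals uniform in them. *)
Lemma limit_pole (l : 'I_k.+1 -> W) (d0 : R) :
  (forall i j, Q (l i) (l j) = - (i == j)%:R) -> 0 < d0 ->
  (forall t : 'rV[C]_k.+1,
     qf Q (lcomb t l) + nm (b0 (lcomb t l)) ^+ 2 <= - d0 * sqnorm t) ->
  exists2 a, nm a <= 1 & negsq_le k (reduced a).
Proof.
move=> lorth d00 lneg.
pose I := ({ffun 'I_k.+1 -> W} * nat)%type.
pose Z (i : I) : set C := [set a | exists2 t : 'rV[C]_k.+1, sqnorm t = 1 &
  - i.2.+1%:R^-1 <= qf (reduced a) (lcomb t i.1)].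
have [s|a a1 ha] := unit_disk_fip ((finfun l, 0%N) : I) (Z := Z).
  (* Index 0 is reserved for the reference tuple [l], hence the shift by one below. *)
  pose F j : 'I_k.+1 -> W := if j is j'.+1 then (nth (finfun l, 0%N) s j').1 else l.
  pose M := \max_(i <- s) i.2.
  have M0 : 0 < M.+1%:R^-1 :> R by rewrite invr_gt0.
  have [a a1 ha] := @approximate_pole F lorth d0 d00 lneg (size s).+1 _ M0.
  exists a => // i si; have := ha (index i s).+1; rewrite ltnS index_mem si => /(_ isT).
  move=> [t t1]; rewrite /F nth_index// => ht; exists t => //; apply: le_trans ht.
  rewrite lerN2 lef_pV2 ?posrE// ler_nat ltnS /M.
  by rewrite (big_rem _ si) /= leq_maxl.
exists a => //; apply: (negsq_le_approx (reduced_hs a1)) => w e e0.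
pose u i := orb A b0 (w i).
pose B := \sum_i Num.sqrt (sq (u i)).
have B0 : 0 <= B by apply: sumr_ge0 => i _; exact: sqrtr_ge0.
have [n hn] : exists n : nat, n.+1%:R^-1 <= e / 2.
  have /cvgrPdist_le/(_ (e / 2)) := @cvg_harmonic R.
  rewrite divr_gt0// => /(_ isT)[N _ /(_ N (leqnn N))].
  by rewrite /= sub0r normrN ger0_norm// => h; exists N.
have [z [z1 zZ za]] := ha (finfun w, n).
have d_cvg : (fun j => \sum_i nm (szego (z j) (u i) - szego a (u i))) @ \oo --> (0 : R).
  apply: null_sum => i; apply: szego_continuous => //; first exact: hb.2.
  by move=> j; exact: ltW.
pose d := Num.min 1 (e / (2 * (2 * B + 1))).
have B1 : 0 < 2 * (2 * B + 1) by lra.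
have d_gt0 : 0 < d by rewrite lt_min ltr01 divr_gt0.
have /cvgrPdist_le/(_ _ d_gt0)[j _ /(_ j (leqnn j))] := d_cvg.
set dj := \sum_i _; have dj0 : 0 <= dj by apply: sumr_ge0 => i _; exact: nm_ge0.
rewrite /= sub0r normrN ger0_norm// => hdj.
have [t t1 ht] := zZ j; exists t; first by apply/eqP => t0; move: t1;
  rewrite t0 /sqnorm big1 => [/esym/eqP|i _]; rewrite ?oner_eq0// mxE nm0 expr0n.
rewrite t1 mulr1; move: ht => /=.
have -> : lcomb t (finfun w) = lcomb t w by apply: eq_bigr => i _; rewrite ffunE.
set x := lcomb t w => ht.
have e1 := qf_reduced (z j) x; have e2 := qf_reduced a x.
have zj1 := ltW (z1 j).
have h1 : nm (szego_functional a x) <= B.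
  apply: (le_trans (nm_functional_le w (szego_functional_linear a1) t1)).
  by apply: ler_sum => i _; apply: szego_le => //; exact: hb.2.
have h2 : nm (szego_functional (z j) x - szego_functional a x) <= dj.
  have hf : linear_functional (fun y => szego_functional (z j) y - szego_functional a y).
    move=> v y1 y2; have f1 := szego_functional_linear zj1 v y1 y2.
    have f2 := szego_functional_linear a1 v y1 y2.
    by rewrite (congr2 (fun p q => p - q) f1 f2) mulrBr opprD addrACA.
  exact: (nm_functional_le w hf t1).
have {}ht := eq_ind _ (fun v => - n.+1%:R^-1 <= v) ht _ e1.
have -> : qf (reduced a) x = qf Q x + nm (szego_functional a x) ^+ 2 := e2.
move: h1 h2 ht {e1 e2}; move: (szego_functional (z j) x) (szego_functional a x) => p q h1 h2 ht.
have h3 : nm p <= nm q + dj.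
  by have := nmD q (p - q); rewrite addrC subrK; lra.
have h4 : nm p ^+ 2 <= nm q ^+ 2 + (2 * B + 1) * dj.
  have dj1 : dj <= 1 by apply: (le_trans hdj); rewrite ge_min lexx.
  apply: (@le_trans _ _ ((nm q + dj) ^+ 2)).
    by rewrite ler_pXn2r// nnegrE ?nm_ge0// addr_ge0 ?nm_ge0.
  have := ler_wpM2r dj0 h1; have := ler_wpM2r dj0 dj1; rewrite sqrrD mulr2n expr2; lra.
have de : dj * (2 * B + 1) <= e / 2.
  apply: (@le_trans _ _ (e / (2 * (2 * B + 1)) * (2 * B + 1))).
    rewrite ler_wpM2r//; first lra.
    by apply: (le_trans hdj); rewrite ge_min lexx orbT.
  by rewrite invfM mulrA -mulrA mulVf ?mulr1//; apply: lt0r_neq0; lra.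
have {}ht := le_trans (etrans (lerN2 _ _) hn) ht; lra.
Qed.

Lemma negsq_le_mono (Q1 Q2 : W -> W -> C) j :
  (forall x, qf Q1 x <= qf Q2 x) -> negsq_le j Q1 -> negsq_le j Q2.
Proof.
by move=> h h1 w; have [t t0 ht] := h1 w; exists t => //; exact: le_trans ht (h _).
Qed.

(** If a = 0 fails, a tuple negative even for Q + b0 conj(b0) supplies the margin demanded by
    [limit_pole]. A limit point on the circle is impossible: its Szego functional vanishes, so Q,
    and a fortiori the larger [reduced 0], would have at most [k] negative squares. *)
Theorem negative_square_reduction : exists2 a, nm a < 1 & negsq_le k (reduced a).
Proof.
have [h0|] := pselect (negsq_le k (reduced 0)); first by exists 0; rewrite ?nm0.
move=> /[dup] nneg0 /negsq_leN[l hl].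
have h01 : nm (0 : C) <= 1 by rewrite nm0.
have hlQ : negdef Q l.
  by move=> t /hl; apply: le_lt_trans; rewrite qf_reduced lerDl sqr_ge0.
have [P Pu lorth] := negdef_orthonormal hQ hlQ.
pose l' i := lcomb (row i P) l.
have hl' : negdef (reduced 0) l'.
  move=> t t0; rewrite /l' -lcombM; apply: hl; apply: contra t0 => /eqP h.
  by rewrite -(mulmxK Pu t) h mul0mx.
have [d0 d00 hd] := negdef_margin (reduced_hs h01) hl'.
have [|a a1 ha] := @limit_pole l' d0 lorth d00.
  by move=> t; have := hd t; rewrite qf_reduced szego_functional0.
have [lt|ge] := ltP (nm a) 1; first by exists a.
exfalso; apply: nneg0; apply: negsq_le_mono ha => x.
have e1 := qf_reduced a x; have e2 := qf_reduced 0 x.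
have e3 : szego_functional a x = 0 by apply: szego_circle; apply/eqP; rewrite eq_le a1.
have e4 := sqr_ge0 (nm (szego_functional 0 x)); rewrite e3 nm0 expr0n /= addr0 in e1.
by rewrite [leLHS]e1 [leRHS]e2 lerDl.
Qed.

End NegativeSquareReduction.

(** * Blaschke factors *)

Section BlaschkeStep.
Variables (R : realType) (W : lmodType R[i]) (A : {linear W -> W}).
Local Notation C := R[i].
Variable a : C.
Hypothesis a1 : nm a < 1.

Let sa : R := Num.sqrt (1 - nm a ^+ 2).

Let sa_gt0 : 0 < sa.
Proof. by rewrite sqrtr_gt0 subr_gt0 expr_lt1 ?nm_ge0. Qed.

Let sa_neq0 : sa%:C%C != 0 :> C.
Proof. by rewrite fmorph_eq0 gt_eqF. Qed.

Let defectE : (1 - nm a ^+ 2)%:C%C = 1 - a * a^* :> C.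
Proof. by rewrite nm_sqr rmorphB rmorph1. Qed.

(* The value at [a] of the power series with coefficients [u]. *)
Definition h2_eval (u : nat -> C) : C := sa%:C%C^-1 * szego a u.

Lemma h2_eval_linear x u v : l2 u -> l2 v ->
  h2_eval (fun j => x * u j + v j) = x * h2_eval u + h2_eval v.
Proof. by move=> hu hv; rewrite /h2_eval szego_linear ?ltW//; ring. Qed.

Lemma h2_eval_shift u : l2 u -> u 0%N = h2_eval u - a * h2_eval (seqshift u).
Proof.
move=> hu; rewrite /h2_eval (szego_split 1 hu (ltW a1)) big_ord1 /szego_term expr0 mul1r.
by rewrite expr1 -/sa mulrDr mulKf//= mulrCA addrK.
Qed.

Lemma nm_h2_eval u : l2 u -> nm (h2_eval u) <= sa^-1 * Num.sqrt (sq u).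
Proof.
move=> hu; have i0 : 0 <= sa^-1 by rewrite invr_ge0 ltW.
rewrite /h2_eval nmM -fmorphV nm_real (ger0_norm i0) ler_wpM2l//.
exact: szego_le (ltW a1).
Qed.

Lemma szego_h2_eval u : szego a u = sa%:C%C * h2_eval u.
Proof. by rewrite /h2_eval mulVKf. Qed.

(* The Blaschke factor with zero at the conjugate of [a], applied to the backward
   shift: the orbit of [blaschke_step b] is [(S - a^* )(1 - a S)^-1 (orb A b x)]. *)
Definition blaschke_step (b : W -> C) (x : W) : C :=
  h2_eval (orb A b (A x)) - a^* * h2_eval (orb A b x).

Section Functional.
Variable b : W -> C.
Hypothesis hb : l2_functional A b.

Let y x j := h2_eval (orb A b (iter j A x)).

Lemma orb_blaschke_step x j : orb A (blaschke_step b) x j = y x j.+1 - a^* * y x j.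
Proof. by []. Qed.

Lemma orb_h2_eval x j : orb A b x j = y x j - a * y x j.+1.
Proof.
rewrite /y (_ : iter j.+1 A x = A (iter j A x))// orb_iterS -h2_eval_shift//; exact: hb.2.
Qed.

Lemma blaschke_step_linear : linear_functional (blaschke_step b).
Proof.
move=> z u v; rewrite /blaschke_step linearP !(orb_linear _ _ _ _ hb.1).
by rewrite !h2_eval_linear; try exact: hb.2; ring.
Qed.

(** With u = p - a q and v = q - conj(a) p one has |u|^2 - |v|^2 = (1 - |a|^2) (|p|^2 - |q|^2), here
    in polarised form. As p and q are consecutive terms of [y], the sum over j telescopes. *)
Lemma blaschke_step_term x z j :
  orb A b x j * (orb A b z j)^* -
  orb A (blaschke_step b) x j * (orb A (blaschke_step b) z j)^* =
  (1 - nm a ^+ 2)%:C%C * (y x j * (y z j)^* - y x j.+1 * (y z j.+1)^*).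
Proof.
rewrite !orb_h2_eval !orb_blaschke_step defectE.
move: (y x j) (y x j.+1) (y z j) (y z j.+1) => p q r t.
rewrite !rmorphB !rmorphM /= conjCK; ring.
Qed.

Lemma y_null x : clim (y x) 0.
Proof.
apply/clim0; have : (fun j => sa^-1 * Num.sqrt (sq (iter j (@seqshift R) (orb A b x))))
    @ \oo --> sa^-1 * 0.
  apply: cvgM; first exact: cvg_cst.
  rewrite -(sqrtr0 R); apply: continuous_cvg; first exact: sqrt_continuous.
  exact: sq_shiftn_cvg (hb.2 x).
rewrite mulr0; apply: null_le => j; first exact: nm_ge0.
by rewrite -orb_iter; apply: nm_h2_eval; exact: hb.2.
Qed.

Lemma blaschke_step_psum x z n :
  \sum_(j < n) orb A (blaschke_step b) x j * (orb A (blaschke_step b) z j)^* =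
  \sum_(j < n) orb A b x j * (orb A b z j)^* -
  (1 - nm a ^+ 2)%:C%C * (y x 0 * (y z 0)^* - y x n * (y z n)^*).
Proof.
elim: n => [|n IH]; first by rewrite !big_ord0 subrr mulr0 subr0.
rewrite !big_ord_recr /= IH.
have h := blaschke_step_term x z n.
have -> : orb A b x n * (orb A b z n)^* = (1 - nm a ^+ 2)%:C%C *
  (y x n * (y z n)^* - y x n.+1 * (y z n.+1)^*) +
  orb A (blaschke_step b) x n * (orb A (blaschke_step b) z n)^* by rewrite -h subrK.
move: (\sum_(j < n) _) (_ * (orb A (blaschke_step b) z n)^*) => S T.
move: (y x 0 * _) (y x n * _) (y x n.+1 * _) => p q r; ring.
Qed.

Lemma blaschke_step_l2 : l2_functional A (blaschke_step b).
Proof.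
split; first exact: blaschke_step_linear.
move=> x; exists (sq (orb A b x) + (1 - nm a ^+ 2) * (sa^-1 * Num.sqrt (sq (orb A b x))) ^+ 2) => n.
have sa0 : 0 <= 1 - nm a ^+ 2 by rewrite subr_ge0 expr_le1 ?nm_ge0 ?ltW.
have -> : \sum_(j < n) nm (orb A (blaschke_step b) x j) ^+ 2 =
  \sum_(j < n) nm (orb A b x j) ^+ 2 - (1 - nm a ^+ 2) * (nm (y x 0) ^+ 2 - nm (y x n) ^+ 2).
  have S (f : nat -> C) : (\sum_(j < n) nm (f j) ^+ 2)%:C%C = \sum_(j < n) f j * (f j)^*.
    by rewrite rmorph_sum; apply: eq_bigr => i _; rewrite nm_sqr.
  by apply: complexI; rewrite S blaschke_step_psum -S !nm_sqr -rmorphB -rmorphM -rmorphB.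
have h1 := sq_ub n (hb.2 x).
have h2 : nm (y x n) ^+ 2 <= (sa^-1 * Num.sqrt (sq (orb A b x))) ^+ 2.
  have sq0 : 0 <= sa^-1 by rewrite invr_ge0 ltW.
  rewrite ler_pXn2r ?nnegrE ?nm_ge0 ?mulr_ge0 ?sqrtr_ge0//.
  rewrite (le_trans (nm_h2_eval (hb.2 _)))// ler_wpM2l//; apply: ler_wsqrtr.
  rewrite orb_iter sq_shiftn; last exact: hb.2.
  by rewrite gerBl; apply: sumr_ge0 => i _; exact: sqr_ge0.
have h3 := ler_wpM2l sa0 h2; have h4 := mulr_ge0 sa0 (sqr_ge0 (nm (y x 0))).
lra.
Qed.

(** In the telescoped sum the last term tends to 0 and the first one is the rank one form of the
    normalised Szego functional. *)
Lemma gramian_blaschke_step x z :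
  gramian A b x z = gramian A (blaschke_step b) x z +
    szego_functional A b a x * (szego_functional A b a z)^*.
Proof.
apply: (clim_unique (u := fun n => \sum_(j < n) orb A b x j * (orb A b z j)^*)).
  by apply: ipP; exact: hb.2.
have hy : clim (fun n => y x n * (y z n)^*) 0.
  by have := climM (y_null x) (clim_conj (y_null z)); rewrite mul0r.
have -> : (fun n => \sum_(j < n) orb A b x j * (orb A b z j)^*) =
  (fun n => \sum_(j < n) orb A (blaschke_step b) x j * (orb A (blaschke_step b) z j)^* +
    (1 - nm a ^+ 2)%:C%C * (y x 0 * (y z 0)^* - y x n * (y z n)^*)).
  by rewrite funeqE => n; rewrite blaschke_step_psum subrK.
apply: climD; first by apply: ipP; exact: blaschke_step_l2.2.
have -> : szego_functional A b a x * (szego_functional A b a z)^* =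
  (1 - nm a ^+ 2)%:C%C * (y x 0 * (y z 0)^* - 0).
  rewrite subr0 /szego_functional !szego_h2_eval -(sqrt_defect (ltW a1)) -/sa.
  rewrite (_ : y x 0 = h2_eval (orb A b x))// (_ : y z 0 = h2_eval (orb A b z))//.
  move: (h2_eval (orb A b x)) (h2_eval (orb A b z)) => p q.
  by rewrite rmorphM /= (conjE sa%:C%C) conjc_real rmorphXn /=; ring.
by apply: climZ; apply: climB hy; exact: clim_cst.
Qed.

(* Taylor coefficients of [w(z) / (1 - a z)] and of the product of [w] by the
   Blaschke factor with zero at the conjugate of [a]. *)
Fixpoint div_coef (w : nat -> C) (j : nat) : C :=
  if j is j'.+1 then a * div_coef w j' + w j else w 0%N.

Definition blaschke_coef (w : nat -> C) (j : nat) : C :=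
  (if j is j'.+1 then div_coef w j' else 0) - a^* * div_coef w j.

Lemma div_coef_bounded (w : nat -> C) (M : R) j : (forall j, nm (w j) <= M) ->
  nm (div_coef w j) <= M / (1 - nm a).
Proof.
move=> wM; have d0 : 0 < 1 - nm a by rewrite subr_gt0.
have M0 : 0 <= M := le_trans (nm_ge0 _) (wM 0%N).
have na := nm_ge0 a.
elim: j => [|j IH] /=.
  by apply: (le_trans (wM 0%N)); rewrite ler_pdivlMr// ler_piMr// gerBl.
apply: (le_trans (nmD _ _)); rewrite nmM.
have := ler_wpM2l na IH; have := wM j.+1.
have KE : M / (1 - nm a) = nm a * (M / (1 - nm a)) + M by field; rewrite gt_eqF.
lra.
Qed.

Lemma blaschke_coef_bounded (w : nat -> C) (M : R) j : (forall j, nm (w j) <= M) ->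
  nm (blaschke_coef w j) <= 2 * (M / (1 - nm a)).
Proof.
move=> wM; have h j' := div_coef_bounded j' wM.
have M0 : 0 <= M / (1 - nm a) := le_trans (nm_ge0 _) (h 0%N).
rewrite /blaschke_coef (le_trans (nmD _ _))// nmN nmM nm_conj.
have h1 : nm (if j is j'.+1 then div_coef w j' else 0) <= M / (1 - nm a).
  by case: j => [|j]; rewrite ?nm0.
have h2 : nm a * nm (div_coef w j) <= M / (1 - nm a).
  apply: le_trans (h j); rewrite ler_piMl ?nm_ge0 ?(ltW a1)//.
lra.
Qed.

(* Summation by parts: the difference of the two partial sums telescopes. *)
Lemma blaschke_coef_psum (w : nat -> C) (x : W) n :
  \sum_(j < n) w j * orb A (blaschke_step b) x j =
  \sum_(j < n) blaschke_coef w j * orb A b x j +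
  (1 - nm a ^+ 2)%:C%C * (if n is n'.+1 then div_coef w n' * y x n else 0).
Proof.
elim: n => [|n IH]; first by rewrite !big_ord0 mulr0 addr0.
rewrite !big_ord_recr /= IH orb_blaschke_step orb_h2_eval defectE.
move: (\sum_(j < n) _) (y x n) (y x n.+1) => S p q.
by case: n {IH} => [|n]; rewrite /blaschke_coef /=; ring.
Qed.

(** The boundary term of the summation by parts is a bounded sequence times the null sequence
    [y x]. *)
Lemma blaschke_coef_clim (w : nat -> C) (M : R) (x : W) s : (forall j, nm (w j) <= M) ->
  clim (fun n => \sum_(j < n) w j * orb A (blaschke_step b) x j) s <->
  clim (fun n => \sum_(j < n) blaschke_coef w j * orb A b x j) s.
Proof.
move=> wM.
have h : clim (fun n => (1 - nm a ^+ 2)%:C%C * (if n is n'.+1 then div_coef w n' * y x n else 0)) 0.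
  suff : clim (fun n => if n is n'.+1 then div_coef w n' * y x n else 0) 0.
    by move=> /(climZ (1 - nm a ^+ 2)%:C%C); rewrite mulr0.
  apply/clim0; have /clim0 hy := y_null x.
  have : (fun n => M / (1 - nm a) * nm (y x n)) @ \oo --> M / (1 - nm a) * 0.
    by apply: cvgM hy; exact: cvg_cst.
  rewrite mulr0; apply: null_le => n; first exact: nm_ge0.
  have M0 : 0 <= M / (1 - nm a) := le_trans (nm_ge0 _) (div_coef_bounded 0%N wM).
  case: n => [|n]; first by rewrite nm0 mulr_ge0// nm_ge0.
  by rewrite nmM ler_wpM2r ?nm_ge0// div_coef_bounded.
split=> [hs|hs].
  have := climB hs h; rewrite subr0; congr clim; apply/funext => n.
  by rewrite blaschke_coef_psum addrK.
have := climD hs h; rewrite addr0; congr clim; apply/funext => n.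
by rewrite blaschke_coef_psum.
Qed.

End Functional.

Lemma blaschke_coef_pseries (w : nat -> C) (M : R) z L : (forall j, nm (w j) <= M) -> nm z < 1 ->
  clim (fun n => \sum_(j < n) w j * z ^+ j) L ->
  clim (fun n => \sum_(j < n) blaschke_coef w j * z ^+ j)
    (L * ((z - a^*) / (1 - z * a))).
Proof.
move=> wM z1 hL.
have d0 : 1 - z * a != 0.
  rewrite subr_eq0; apply/eqP => /(congr1 (@nm R)); rewrite nm1 nmM => h.
  have := nm_ge0 z; have := nm_ge0 a; have : nm z * nm a < 1 by rewrite mulr_ilt1 ?nm_ge0.
  by rewrite -h ltxx.
have tail : clim (fun n => (if n is n'.+1 then div_coef w n' else 0) * z ^+ n) 0.
  apply/clim0; have : (fun n => M / (1 - nm a) * nm z ^+ n) @ \oo --> M / (1 - nm a) * 0.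
    apply: cvgM; first exact: cvg_cst.
    by apply: cvg_expr; rewrite ger0_norm ?nm_ge0.
  rewrite mulr0; apply: null_le => n; first exact: nm_ge0.
  have M0 : 0 <= M / (1 - nm a) := le_trans (nm_ge0 _) (div_coef_bounded 0%N wM).
  rewrite nmM nmX ler_wpM2r ?exprn_ge0 ?nm_ge0//.
  by case: n => [|n]; rewrite ?nm0// div_coef_bounded.
have E n : (1 - z * a) * \sum_(j < n) div_coef w j * z ^+ j =
    \sum_(j < n) w j * z ^+ j - a * ((if n is n'.+1 then div_coef w n' else 0) * z ^+ n).
  elim: n => [|n IH]; first by rewrite !big_ord0 mulr0 mul0r mulr0 subr0.
  rewrite !big_ord_recr /= mulrDr IH exprS.
  by case: n {IH} => [|n] /=; ring.
have hV : clim (fun n => \sum_(j < n) div_coef w j * z ^+ j) (L / (1 - z * a)).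
  have := climZ (1 - z * a)^-1 (climB hL (climZ a tail)).
  rewrite mulr0 subr0 [_^-1 * L]mulrC; congr clim; apply/funext => n.
  by rewrite -E mulKf.
have E2 n : \sum_(j < n) blaschke_coef w j * z ^+ j =
    (z - a^*) * \sum_(j < n) div_coef w j * z ^+ j -
    (if n is n'.+1 then div_coef w n' else 0) * z ^+ n.
  elim: n => [|n IH]; first by rewrite !big_ord0 mulr0 mul0r subr0.
  rewrite !big_ord_recr [LHS]/= IH /blaschke_coef [z ^+ n.+1]exprS [in RHS]/=.
  move: (\sum_(j < n) _) (if n is _.+1 then _ else _) (div_coef w n) (z ^+ n) => S p q r; ring.
have := climB (climZ (z - a^*) hV) tail; rewrite subr0 mulrCA.
by congr clim; apply/funext => n; rewrite E2.
Qed.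

End BlaschkeStep.

(** * Commutant lifting *)

Section FunctionalExtension.
Variables (R : realType) (X Y : lmodType R[i]).
Local Notation C := R[i].
Variables (E : X -> X -> C) (inj : Y -> X) (v : X) (phi : Y -> C).
Hypotheses (hE : hermitian_sesquilinear E) (Epos : forall x, 0 <= qf E x).
Hypothesis inj_lin : forall a y z, inj (a *: y + z) = a *: inj y + inj z.
Hypothesis phi_lin : linear_functional phi.
Hypothesis phiE : forall y, nm (phi y) ^+ 2 <= qf E (inj y).

Let e y := qf E (inj y + v).

Let e_convex (s : R) y z :
  e ((1 - s)%:C%C *: y + s%:C%C *: z) = (1 - s) * e y + s * e z - s * (1 - s) * qf E (inj (z - y)).
Proof.
have inj0 : inj 0 = 0 by have := inj_lin (-1) 0 0; rewrite scaleN1r addNr scaleN1r addNr.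
have injZ a y' : inj (a *: y') = a *: inj y' by have := inj_lin a y' 0; rewrite !addr0 inj0 addr0.
have -> : inj (z - y) = - ((inj y + v) - (inj z + v)).
  by rewrite addrC -scaleN1r inj_lin scaleN1r opprB opprD addrACA subrr addr0 addrC.
rewrite (qfN hE) /e -(qf_convex hE); congr qf.
rewrite inj_lin injZ !scalerDr addrACA; congr (_ + _).
by rewrite -scalerDl -rmorphD subrK rmorph1 scale1r.
Qed.

Let m := inf [set e y | y in setT].

Let e_ge y : m <= e y.
Proof.
apply: ge_inf; last by exists y.
by exists 0 => _ [z _ <-]; exact: Epos.
Qed.

Let m_ge0 : 0 <= m.
Proof. by apply: lb_le_inf; [exists (e 0), 0|move=> _ [z _ <-]; exact: Epos]. Qed.

Let minimizing (d : R) : 0 < d -> exists y, e y <= m + d.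
Proof.
move=> d0; have [|_ [y _ <-] h] := @inf_adherent R [set e y | y in setT] d d0.
  by split; [exists (e 0), 0|exists 0 => _ [z _ <-]; exact: Epos].
by exists y; exact: ltW.
Qed.

(** A Hahn-Banach step for a Hilbert seminorm. The points inj y + v of nearly minimal seminorm
    approximate the component of [v] orthogonal to the range of [inj], and the extension is made to
    vanish on it: tau = - lim phi(y n). Only these scalars have to converge, so completeness of the
    space is avoided. *)
Lemma functional_extension :
  exists tau : C, forall y a, nm (phi y + a * tau) ^+ 2 <= qf E (inj y + a *: v).
Proof.
(* The minimality gap is [d n ^+ 2]: its square root is summable, which makes [phi (y n)] converge,
   and the gap divided by [d n] still tends to 0, as [key] requires. *)
pose d n : R := 2^-1 ^+ n.
have d0 n : 0 < d n by rewrite exprn_gt0// invr_gt0.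
have d2 n : d n.+1 = d n / 2 by rewrite /d exprSr.
have dsq n : 0 < d n ^+ 2 by rewrite exprn_gt0.
pose y n := projT1 (cid (minimizing (dsq n))).
have ey n : e (y n) <= m + d n ^+ 2 by exact: (projT2 (cid (minimizing (dsq n)))).
have phiB y1 y2 : phi (y1 - y2) = phi y1 - phi y2.
  by rewrite -scaleN1r addrC phi_lin mulN1r addrC.
(* The convexity identity at the midpoint bounds the form of the difference by 5/2 of the gap. *)
have step n : nm (phi (y n.+1) - phi (y n)) <= 2 * d n.
  rewrite -(@ler_pXn2r _ 2) ?nnegrE ?nm_ge0 ?mulr_ge0 ?(ltW (d0 n))// -phiB.
  apply: (le_trans (phiE _)); have := e_convex 2^-1 (y n) (y n.+1).
  have := e_ge ((1 - 2^-1)%:C%C *: y n + 2^-1%:C%C *: y n.+1).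
  have := ey n; have := ey n.+1; rewrite d2 exprMn => h1 h2 h3 h4.
  have := dsq n; lra.
pose u n := phi (y n.+1) - phi (y n).
have dsum n : \sum_(j < n) d j = 2 - 2 * d n.
  elim: n => [|n IH]; first by rewrite big_ord0 /d expr0; lra.
  by rewrite big_ord_recr /= IH d2; lra.
have hL : clim (fun n => \sum_(j < n) u j) (csum u).
  apply: (@csumP R u 4) => n; apply: (@le_trans _ _ (\sum_(j < n) 2 * d j)); first by apply: ler_sum => j _; exact: step.
  by rewrite -mulr_sumr dsum; have := d0 n; lra.
set L0 := csum u in hL.
have hl : clim (fun n => phi (y n)) (phi (y 0) + L0).
  have := climD (clim_cst (phi (y 0))) hL; congr clim; apply/funext => n.
  elim: n => [|n IH]; first by rewrite big_ord0 addr0.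
  by rewrite big_ord_recr /= addrA IH /u addrC subrK.
set L := phi (y 0) + L0 in hl.
exists (- L).
(* Minimality at (1 - s) y + s z, with s = [d n.+1], gives (1 - s) |phi z - phi y|^2 <= s + e z
   after division by s; then s tends to 0. *)
have key z : nm (phi z - L) ^+ 2 <= e z.
  have hz : (fun n => nm (phi z - phi (y n.+1)) ^+ 2) @ \oo --> nm (phi z - L) ^+ 2.
    have h1 : clim (fun n => phi z - phi (y n.+1)) (phi z - L).
      apply: climB; first exact: clim_cst.
      by have := clim_shiftn 1 hl; congr clim; apply/funext => n; rewrite addn1.
    exact: (cvgM (clim_nm h1) (clim_nm h1)).
  have dn0 : (fun n => d n.+1) @ \oo --> (0 : R).
    rewrite (cvg_shiftS d); apply: cvg_expr; rewrite ger0_norm ?invr_ge0//.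
    by rewrite invf_lt1// ltr1n.
  have lim1 : (fun n => (1 - d n.+1) * nm (phi z - phi (y n.+1)) ^+ 2) @ \oo
      --> (1 - 0) * nm (phi z - L) ^+ 2.
    by apply: cvgM => //; apply: cvgB => //; exact: cvg_cst.
  have lim2 : (fun n => d n.+1 + e z) @ \oo --> 0 + e z.
    by apply: cvgD => //; exact: cvg_cst.
  rewrite subr0 mul1r in lim1; rewrite add0r in lim2.
  apply: (ler_cvg_to lim1 lim2); apply: nearW => n.
  have := e_convex (d n.+1) (y n.+1) z; have := e_ge ((1 - d n.+1)%:C%C *: y n.+1 + (d n.+1)%:C%C *: z).
  have := ey n.+1; have := phiE (z - y n.+1); rewrite phiB.
  have dn := d0 n.+1; have d1 : 0 <= 1 - d n.+1.
    by rewrite subr_ge0 /d exprn_ile1 ?invr_ge0// invf_le1// ler1n.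
  set s := d n.+1 in dn d1 *; set F := qf E _; set p := nm _ ^+ 2 => h1 h2 h3 h4.
  have k1 : s * (1 - s) * F <= s ^+ 2 + s * e z.
    have := ler_wpM2l d1 h2; have := mulr_ge0 (ltW dn) m_ge0; have := mulr_ge0 (ltW dn) (ltW (dsq n.+1)).
    rewrite -/s; lra.
  rewrite -(ler_pM2l dn); apply: le_trans (_ : s * ((1 - s) * F) <= _).
    by rewrite ler_wpM2l ?(ltW dn)// ler_wpM2l.
  by rewrite mulrDr -expr2 mulrA.
move=> z a; have [->|a0] := eqVneq a 0.
  by rewrite mul0r scale0r !addr0 phiE.
have zE : z = a *: (a^-1 *: z) by rewrite scalerA mulfV// scale1r.
have phi0 : phi 0 = 0 by exact: (lf0 phi_lin).
have inj0 : inj 0 = 0 by have := inj_lin (-1) 0 0; rewrite scaleN1r addNr scaleN1r addNr.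
have -> : phi z + a * - L = a * (phi (a^-1 *: z) - L).
  by rewrite {1}zE -[a *: _]addr0 phi_lin phi0 addr0; ring.
have -> : inj z + a *: v = a *: (inj (a^-1 *: z) + v).
  by rewrite {1}zE -[a *: (_ *: _)]addr0 inj_lin inj0 addr0 scalerDr.
by rewrite nmM exprMn (qfZ hE) ler_wpM2l ?sqr_ge0.
Qed.

End FunctionalExtension.

Section Lifting.
Variables (R : realType) (W : lmodType R[i]) (A : {linear W -> W}).
Local Notation C := R[i].
Variables (c0 b0 : W -> C).
Hypotheses (hc : l2_functional A c0) (hb : l2_functional A b0).
Hypothesis contr : forall x, 0 <= qf (defect A c0 b0) x.

Local Notation X := (W * (nat -> C))%type.
Implicit Types (f t : nat -> C) (p : X) (k : nat).

Definition trunc k t : nat -> C := fun j => if (j < k)%N then t j else 0.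

Lemma trunc_sum_le k t n : \sum_(j < n) nm (trunc k t j) ^+ 2 <= \sum_(j < k) nm (t j) ^+ 2.
Proof.
have [nk|kn] := leqP n k.
  rewrite -[in leRHS](subnKC nk) big_split_ord /= -[leLHS]addr0; apply: lerD.
    by apply: ler_sum => j _; rewrite /trunc (leq_trans (ltn_ord j) nk).
  by apply: sumr_ge0 => j _; exact: sqr_ge0.
rewrite -(subnKC (ltnW kn)) big_split_ord /= [X in _ + X]big1 ?addr0 => [|j _].
  by apply: ler_sum => j _; rewrite /trunc ltn_ord.
by rewrite /trunc ltnNge leq_addr nm0 expr0n.
Qed.

Lemma l2_trunc k t : l2 (trunc k t).
Proof. by exists (\sum_(j < k) nm (t j) ^+ 2) => n; exact: trunc_sum_le. Qed.

Lemma trunc_linear k a t s : trunc k (a *: t + s) = (fun j => a * trunc k t j + trunc k s j).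
Proof. by apply/funext => j; rewrite /trunc; case: ifP; rewrite ?mulr0 ?addr0. Qed.

Lemma trunc_trunc k k' t : (k <= k')%N -> trunc k' (trunc k t) = trunc k t.
Proof.
move=> kk'; apply/funext => j; rewrite /trunc; have [jk|//] := ltnP j k.
  by rewrite (leq_trans jk kk').
by rewrite if_same.
Qed.

Lemma trunc_shift k t : trunc k (seqshift t) = seqshift (trunc k.+1 t).
Proof. by []. Qed.

(* Adjoining to the graph of [c |-> b] the unit vectors [e_j], [j < k], with
   images [(f_j, ..., f_0, 0, ...)]. *)
Definition ext_c k p : nat -> C := fun j => orb A c0 p.1 j + trunc k p.2 j.

Definition ext_b f k p : nat -> C :=
  fun n => orb A b0 p.1 n + \sum_(i < k) trunc k p.2 (n + i)%N * f i.

Lemma ext_c_l2 k p : l2 (ext_c k p).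
Proof.
have := l2D 1 (hc.2 p.1) (l2_trunc k p.2).
by congr l2; apply/funext => j; rewrite mul1r.
Qed.

Lemma ext_b_l2 f k p : l2 (ext_b f k p).
Proof.
have := l2D 1 (hb.2 p.1) (l2_trunc k (fun n => \sum_(i < k) trunc k p.2 (n + i)%N * f i)).
congr l2; apply/funext => n; rewrite mul1r /ext_b; congr (_ + _).
rewrite {1}/trunc; case: ltnP => // kn; rewrite big1// => i _.
by rewrite /trunc ltnNge (leq_trans kn (leq_addr _ _)) mul0r.
Qed.

Lemma ext_c_linear k a p q : ext_c k (a *: p + q) = (fun j => a * ext_c k p j + ext_c k q j).
Proof.
apply/funext => j; rewrite /ext_c [(a *: p + q).2]/= [(a *: p + q).1]/= trunc_linear.
by rewrite (orb_linear _ _ _ _ hc.1); ring.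
Qed.

Lemma ext_b_linear f k a p q :
  ext_b f k (a *: p + q) = (fun j => a * ext_b f k p j + ext_b f k q j).
Proof.
apply/funext => j; rewrite /ext_b [(a *: p + q).2]/= [(a *: p + q).1]/= trunc_linear.
rewrite (orb_linear _ _ _ _ hb.1) mulrDr addrACA mulr_sumr -big_split; congr (_ + _).
by apply: eq_bigr => i _ /=; ring.
Qed.

Definition ext_form f k p q : C := ip (ext_c k p) (ext_c k q) - ip (ext_b f k p) (ext_b f k q).

Lemma ext_form_hs f k : hermitian_sesquilinear (ext_form f k).
Proof.
split=> [a p q r|p q]; rewrite /ext_form.
  rewrite ext_c_linear ext_b_linear !ip_linear; try exact: ext_c_l2; try exact: ext_b_l2.
  by ring.
rewrite rmorphB /= -(ipC (ext_c_l2 k p) (ext_c_l2 k q)).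
by rewrite -(ipC (ext_b_l2 f k p) (ext_b_l2 f k q)).
Qed.

Lemma qf_ext_form f k p : qf (ext_form f k) p = sq (ext_c k p) - sq (ext_b f k p).
Proof. by rewrite /qf raddfB. Qed.

Definition ext_contractive f k := forall p, 0 <= qf (ext_form f k) p.

Definition ext_shift p : X := (A p.1, seqshift p.2).

Lemma ext_c_shift k p : seqshift (ext_c k.+1 p) = ext_c k (ext_shift p).
Proof. by apply/funext => j; rewrite /ext_c /= orb_iterS. Qed.

Lemma ext_b_shift f k p : seqshift (ext_b f k.+1 p) = ext_b f k (ext_shift p).
Proof.
apply/funext => n; rewrite /ext_b /seqshift orb_iterS; congr (_ + _).
rewrite big_ord_recr /= {2}/trunc ltnNge addSn ltnS leq_addl mul0r addr0.
by [].
Qed.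

Lemma ext_b_eq f f' k p : (forall i, (i < k)%N -> f i = f' i) -> ext_b f k p = ext_b f' k p.
Proof.
move=> ff; apply/funext => n; rewrite /ext_b; congr (_ + _).
by apply: eq_bigr => i _; rewrite ff.
Qed.

Lemma ext_contractive0 f : ext_contractive f 0.
Proof.
move=> p; rewrite qf_ext_form; have := contr p.1; rewrite qf_defect !qf_gramian.
have -> : ext_c 0 p = orb A c0 p.1 by apply/funext => j; rewrite /ext_c /trunc addr0.
by have -> : ext_b f 0 p = orb A b0 p.1 by apply/funext => j; rewrite /ext_b big_ord0 addr0.
Qed.

Definition update f k (tau : C) : nat -> C := fun j => if j == k then tau else f j.

Lemma sq_split (u : nat -> C) : l2 u -> sq u = nm (u 0%N) ^+ 2 + sq (seqshift u).
Proof. by move=> hu; have := sq_shiftn 1 hu; rewrite big_ord1 /= => ->; ring. Qed.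

(* The one-step extension: all the coordinates of the image of [e_k] but the
   first are prescribed, and the first one is a functional to be extended. *)
Lemma ext_step f k : ext_contractive f k ->
  exists tau, ext_contractive (update f k tau) k.+1.
Proof.
move=> hf.
(* The energy of [ext_c k.+1 p] minus that of the shifted [ext_b _ k.+1 p]; the shift removes the
   unknown coefficient [f k]. Contractivity at level [k.+1] thus bounds the squared first coordinate
   by [E], and level [k] is this bound on the range of [inj]. *)
pose E p q := (c0 p.1 + p.2 0%N) * (c0 q.1 + q.2 0%N)^* +
   ext_form f k (ext_shift p) (ext_shift q).
have hE : hermitian_sesquilinear E.
  split=> [a p q r|p q]; rewrite /E.
    have -> : ext_shift (a *: p + q) = a *: ext_shift p + ext_shift q.
      by rewrite /ext_shift /= linearP.
    rewrite (hsPl (ext_form_hs f k)) [(a *: p + q).1]/= hc.1.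
    rewrite (_ : (a *: p + q).2 0%N = a * p.2 0%N + q.2 0%N)//; ring.
  rewrite [RHS]rmorphD [X in _ = X + _]rmorphM /= (hsC (ext_form_hs f k)).
  by rewrite [((_ + _)^*)^*]conjCK mulrC.
have qE p : qf E p = nm (c0 p.1 + p.2 0%N) ^+ 2 + qf (ext_form f k) (ext_shift p).
  by rewrite /qf /E nm_sqr raddfD.
have Epos p : 0 <= qf E p by rewrite qE addr_ge0 ?sqr_ge0.
pose inj p : X := (p.1, trunc k p.2).
have inj_lin a p q : inj (a *: p + q) = a *: inj p + inj q.
  rewrite /inj trunc_linear; congr pair.
pose phi p := ext_b f k p 0%N.
have phi_lin : linear_functional phi by move=> a p q; rewrite /phi ext_b_linear.
pose ek : nat -> C := fun j => (j == k)%:R.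
pose v : X := (0, ek).
have E_trunc p p' : p.1 = p'.1 -> trunc k.+1 p.2 = trunc k.+1 p'.2 -> qf E p = qf E p'.
  move=> e1 e2; rewrite !qE e1; congr (nm (_ + _) ^+ 2 + _).
    by have /(congr1 (fun g => g 0%N)) := e2.
  rewrite !qf_ext_form /ext_c /ext_b /ext_shift /= e1.
  by rewrite (trunc_shift k p.2) (trunc_shift k p'.2) e2.
have qsplit g j p : (forall i, (i < k)%N -> g i = f i) -> (j = k)%N ->
    qf (ext_form g j.+1) p = qf E p - nm (ext_b g j.+1 p 0%N) ^+ 2.
  move=> gf ->; rewrite qf_ext_form qE qf_ext_form.
  rewrite (sq_split (ext_c_l2 k.+1 p)) (sq_split (ext_b_l2 g k.+1 p)).
  rewrite ext_c_shift ext_b_shift (ext_b_eq _ gf) {1}/ext_c /trunc /=; ring.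
have phiE p : nm (phi p) ^+ 2 <= qf E (inj p).
  have := hf p; rewrite qf_ext_form (sq_split (ext_c_l2 k p)) (sq_split (ext_b_l2 f k p)).
  have -> : seqshift (ext_c k p) = ext_c k (ext_shift (inj p)).
    apply/funext => j; rewrite /ext_c /ext_shift /= trunc_shift trunc_trunc//.
    by rewrite orb_iterS.
  have -> : seqshift (ext_b f k p) = ext_b f k (ext_shift (inj p)).
    apply/funext => n; rewrite /ext_b /ext_shift /= orb_iterS trunc_shift trunc_trunc//.
  rewrite qE qf_ext_form {1}/ext_c -/(phi p) /=; lra.
have [tau htau] := functional_extension v hE Epos inj_lin phi_lin phiE.
exists tau => p; rewrite (qsplit _ k)//; last by move=> i ik; rewrite /update (ltn_eqF ik).
rewrite subr_ge0; have := htau p (p.2 k).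
have -> : qf E (inj p + p.2 k *: v) = qf E p.
  apply: E_trunc; first by rewrite /= scaler0 addr0.
  apply/funext => j; rewrite /trunc ltnS; case: (leqP j k) => // jk.
  rewrite -[LHS]/(trunc k p.2 j + p.2 k * ek j) /trunc /ek.
  have [->|jk'] := eqVneq j k; first by rewrite ltnn add0r mulr1.
  by rewrite ltn_neqAle jk' jk mulr0 addr0.
suff -> : ext_b (update f k tau) k.+1 p 0 = phi p + p.2 k * tau by [].
rewrite /phi /ext_b big_ord_recr /= addrA /update eqxx /trunc !add0n ltnSn; congr (_ + _ + _).
by apply: eq_bigr => i _; rewrite add0n ltnS (ltnW (ltn_ord i)) (ltn_ord i) (ltn_eqF (ltn_ord i)).
Qed.

Lemma lifting_coef : exists f, forall k, ext_contractive f k.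
Proof.
pose S k := {f | ext_contractive f k}.
pose tau k (s : S k) := projT1 (cid (ext_step (proj2_sig s))).
have tauP k (s : S k) : ext_contractive (update (proj1_sig s) k (tau k s)) k.+1.
  exact: (projT2 (cid (ext_step (proj2_sig s)))).
pose g := fix g k : S k := if k is k'.+1 return S k then
  exist _ (update (proj1_sig (g k')) k' (tau k' (g k'))) (tauP k' (g k'))
  else exist _ (fun=> 0) (ext_contractive0 (fun=> 0)).
(* Stage [k] changes no coefficient of index below [k], so this diagonal sequence agrees with every
   stage on the coefficients that the stage uses. *)
pose f j := proj1_sig (g j.+1) j.
have gf k i : (i < k)%N -> proj1_sig (g k) i = f i.
  elim: k => // k IH; rewrite ltnS leq_eqVlt => /orP[/eqP->//|ik].
  by rewrite /= /update (ltn_eqF ik) IH.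
exists f => k p; have := proj2_sig (g k) p; rewrite !qf_ext_form.
by rewrite (ext_b_eq p (gf k)).
Qed.

(** The first clause is contractivity on pairs (0, t). For the second it is applied to (x, - c):
    truncation at [k] leaves the tail of the orbit c on one side, and the first coordinate of the
    other is b0 x - sum_(j < k) f j c j, so the error is at most the norm of the tail. *)
Theorem commutant_lifting : exists f,
  (forall k t N, \sum_(n < N) nm (\sum_(i < k) trunc k t (n + i)%N * f i) ^+ 2 <=
     \sum_(j < k) nm (t j) ^+ 2) /\
  forall x, clim (fun n => \sum_(j < n) f j * orb A c0 x j) (b0 x).
Proof.
have [f hf] := lifting_coef; exists f; split=> [k t N|x].
  have := hf k (0, t); rewrite qf_ext_form subr_ge0 => h.
  have orb0 b : linear_functional b -> orb A b 0 = (fun=> 0).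
    move=> lb; apply/funext => j; rewrite /orb (_ : iter j A 0 = 0) ?(lf0 lb)//.
    by elim: j => //= j ->; rewrite linear0.
  have bE : ext_b f k (0, t) = (fun n => \sum_(i < k) trunc k t (n + i)%N * f i).
    by apply/funext => n; rewrite /ext_b /= orb0 ?add0r//; exact: hb.1.
  have cE : ext_c k (0, t) = trunc k t.
    by apply/funext => j; rewrite /ext_c /= orb0 ?add0r//; exact: hc.1.
  rewrite cE in h; have := sq_ub N (ext_b_l2 f k (0, t)); rewrite {1}bE => h1.
  apply: (le_trans h1); apply: (le_trans h); apply: sq_le => n; exact: trunc_sum_le.
pose c := orb A c0 x.
have key k : nm (\sum_(j < k) f j * c j - b0 x) <= Num.sqrt (sq (iter k (@seqshift R) c)).
  rewrite -(ger0_norm (nm_ge0 _)) -sqrtr_sqr; apply: ler_wsqrtr.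
  have := hf k (x, fun j => - c j); rewrite qf_ext_form subr_ge0 => h.
  have h0 := sq_ub 1 (ext_b_l2 f k (x, fun j => - c j)); rewrite big_ord1 in h0.
  have bE : ext_b f k (x, fun j => - c j) 0 = b0 x - \sum_(j < k) f j * c j.
    rewrite /ext_b -sumrN; congr (_ + _); apply: eq_bigr => i _.
    by rewrite /trunc add0n ltn_ord mulNr mulrC.
  rewrite bE nmB in h0; apply: (le_trans h0); apply: (le_trans h).
  apply: sq_le => n; apply: le_trans (sq_ub n (l2_shiftn k (hc.2 x))).
  have [nk|kn] := leqP n k.
    rewrite [leLHS]big1 ?sumr_ge0// => [j _|j _]; first exact: sqr_ge0.
    by rewrite /ext_c /trunc /= (leq_trans (ltn_ord j) nk) subrr nm0 expr0n.
  rewrite -[in leLHS](subnKC (ltnW kn)) big_split_ord /= [X in X + _]big1 ?add0r => [|j _]; last first.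
    by rewrite /ext_c /trunc /= ltn_ord subrr nm0 expr0n.
  rewrite -[in leRHS](subnKC (leq_subr k n)) [leRHS]big_split_ord /= -[leLHS]addr0; apply: lerD.
    by apply: ler_sum => j _; rewrite /ext_c /trunc /= ltnNge leq_addr /= addr0 shiftnE.
  by apply: sumr_ge0 => j _; exact: sqr_ge0.
apply: null_le key _ => [n|]; first exact: nm_ge0.
rewrite -(sqrtr0 R); apply: continuous_cvg; first exact: sqrt_continuous.
exact: sq_shiftn_cvg (hc.2 x).
Qed.

End Lifting.

(** * Schur functions *)

Section RootsOfUnity.
Variable R : realType.
Local Notation C := R[i].

Lemma prim_root_exists_closed n : (0 < n)%N -> exists z : C, n.-primitive_root z.
Proof.
pose p : {poly C} := 'X^n - 1; have [r Dp] := closed_field_poly_normal p.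
move=> n_gt0; rewrite (monicP _) ?monicXnsubC// scale1r in Dp.
have rn1 : all n.-unity_root r by apply/allP=> z; rewrite -root_prod_XsubC -Dp.
have sz_r : (n < (size r).+1)%N by rewrite -(size_prod_XsubC r id) -Dp size_XnsubC.
have [|z] := hasP (cyclic.has_prim_root n_gt0 rn1 _ sz_r); last by exists z.
by rewrite -separable.separable_prod_XsubC -Dp cyclotomic.separable_Xn_sub_1// pnatr_eq0 -lt0n.
Qed.

Lemma nm_root_of_unity n (z : C) : (0 < n)%N -> z ^+ n = 1 -> nm z = 1.
Proof.
move=> n0 /(congr1 (@nm R)); rewrite nmX nm1 => h; apply/eqP.
by rewrite -(pexpr_eq1 n0 (nm_ge0 z)) h.
Qed.

Lemma roots_of_unity_orthogonal M (w : C) (k l : 'I_M) : M.-primitive_root w ->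
  \sum_(i < M) (w ^+ i) ^+ k * ((w ^+ i) ^+ l)^* = M%:R *+ (k == l).
Proof.
move=> pw; have M0 := prim_order_gt0 pw; have w1 := nm_root_of_unity M0 (prim_expr_order pw).
have ww : w * w^* = 1 by rewrite nm_sqr w1 expr1n.
have E (i : 'I_M) : (w ^+ i) ^+ k * ((w ^+ i) ^+ l)^* = (w ^+ k * (w^*) ^+ l) ^+ i.
  by rewrite !rmorphXn /= exprMn -!exprM mulnC [(l * i)%N]mulnC.
under eq_bigr do rewrite E.
have [->|kl] := eqVneq k l.
  by rewrite -exprMn ww expr1n; under eq_bigr do rewrite expr1n; rewrite sumr_const card_ord.
set z := w ^+ k * _; have z1 : z != 1.
  apply/eqP => /(congr1 ( *%R^~ (w ^+ l))); rewrite /z -mulrA -exprMn [w^* * w]mulrC ww.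
  rewrite expr1n mulr1 mul1r => /eqP; rewrite (eq_prim_root_expr pw) !modn_small//.
  by rewrite val_eqE (negPf kl).
have zM : z ^+ M = 1.
  rewrite /z exprMn -!exprM mulnC exprM (prim_expr_order pw) expr1n mul1r mulnC exprM.
  by rewrite -rmorphXn /= (prim_expr_order pw) rmorph1 expr1n.
apply: (mulfI (x := z - 1)); first by rewrite subr_eq0.
by rewrite -subrX1 zM subrr mulr0n mulr0.
Qed.

(** A discrete substitute for integration over the circle of radius [r]; the bound on the size of
    [q] excludes aliasing. *)
Lemma parseval_roots_of_unity M (w : C) (q : {poly C}) (r : R) :
  M.-primitive_root w -> (size q <= M)%N ->
  \sum_(i < M) nm q.[r%:C%C * w ^+ i] ^+ 2 =
  M%:R * \sum_(k < M) nm q`_k ^+ 2 * (r ^+ k) ^+ 2.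
Proof.
move=> pw qM; apply: complexI; rewrite rmorph_sum.
transitivity (\sum_(i < M) \sum_(k < M) \sum_(l < M)
   (q`_k * (q`_l)^* * (r ^+ k * r ^+ l)%:C%C) * ((w ^+ i) ^+ k * ((w ^+ i) ^+ l)^*)).
  apply: eq_bigr => i _; set x := r%:C%C * _.
  transitivity (q.[x] * (q.[x])^*); first by rewrite nm_sqr.
  rewrite /x (horner_coef_wide _ qM) rmorph_sum mulr_suml.
  apply: eq_bigr => k _; rewrite mulr_sumr; apply: eq_bigr => l _.
  rewrite !exprMn !rmorphM /= !rmorphXn /= (conjE r%:C%C) conjc_real; ring.
rewrite exchange_big rmorphM rmorph_sum mulr_sumr /=; apply: eq_bigr => k _.
rewrite exchange_big (bigD1 k)//= -mulr_sumr (roots_of_unity_orthogonal _ _ pw) eqxx.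
rewrite big1 ?addr0 => [|l lk]; last first.
  by rewrite -mulr_sumr (roots_of_unity_orthogonal _ _ pw) eq_sym (negPf lk) mulr0.
rewrite mulr1n nm_sqr -[in LHS](rmorph_nat (real_complex R) M) -!rmorphM.
by congr (real_complex R _); ring.
Qed.

End RootsOfUnity.

Section PowerSeriesBounds.
Variable R : realType.
Local Notation C := R[i].
Implicit Types u v : nat -> C.

Lemma clim_bounded u l : clim u l -> exists2 B : R, 0 < B & forall n, nm (u n) <= B.
Proof.
move=> /cvgrPdist_le/(_ 1 ltr01)[N _ hN].
exists (\sum_(i < N) nm (u i) + (nm l + 1)).
  rewrite ltr_wpDl ?sumr_ge0// => [i _|]; first exact: nm_ge0.
  by rewrite ltr_wpDl ?nm_ge0.
move=> n; have s0 (m : nat) : 0 <= \sum_(i < m) nm (u i) by apply: sumr_ge0 => i _; exact: nm_ge0.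
have [nN|Nn] := ltnP n N.
  rewrite (bigD1 (Ordinal nN))//= -addrA lerDl addr_ge0 ?addr_ge0 ?nm_ge0//.
  by apply: sumr_ge0 => i _; exact: nm_ge0.
have := hN n Nn; rewrite sub0r normrN ger0_norm ?nm_ge0// => h.
have := nmD l (u n - l); rewrite addrC subrK => h2; have := s0 N; lra.
Qed.

Lemma pseries_coef_bounded u (rho : R) l : 0 <= rho ->
  clim (fun n => \sum_(j < n) u j * rho%:C%C ^+ j) l ->
  exists2 B : R, 0 < B & forall j, nm (u j) * rho ^+ j <= B.
Proof.
move=> rho0 h; have [B B0 hB] := clim_bounded h.
exists (2 * B); first lra.
move=> j; have := hB j.+1; rewrite big_ord_recr /= => h1; have h2 := hB j.
have -> : nm (u j) * rho ^+ j = nm (u j * rho%:C%C ^+ j) by rewrite nmM nmX nm_real ger0_norm.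
set S := \sum_(i < j) _ in h1 h2; have := nmD (S + u j * rho%:C%C ^+ j) (- S).
by rewrite addrC addKr nmN; lra.
Qed.

Lemma geometric_tail u (B th : R) z : 0 <= th < 1 -> 0 <= B ->
  (forall j, nm (u j * z ^+ j) <= B * th ^+ j) -> forall m n, (m <= n)%N ->
  nm (\sum_(j < n) u j * z ^+ j - \sum_(j < m) u j * z ^+ j) <= B * th ^+ m / (1 - th).
Proof.
move=> /andP[th0 th1] B0 h m n mn; rewrite -(subnKC mn) big_split_ord /= addrAC subrr add0r.
have d0 : 0 < 1 - th by rewrite subr_gt0.
apply: (le_trans (nm_sum _ _ _)).
apply: (@le_trans _ _ (\sum_(i < n - m) B * th ^+ m * th ^+ i)).
  by apply: ler_sum => i _; rewrite -mulrA -exprD; exact: h.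
rewrite -mulr_sumr ler_wpM2l ?mulr_ge0 ?exprn_ge0//.
rewrite -div1r ler_pdivlMr//.
have -> : (\sum_(i < n - m) th ^+ i) * (1 - th) = 1 - th ^+ (n - m).
  by rewrite -opprB mulrN [_ * (th - 1)]mulrC -subrX1 opprB.
by rewrite gerBl exprn_ge0.
Qed.

End PowerSeriesBounds.

(** * Schur functions act contractively on square summable sequences *)

Section SchurContraction.
Variables (R : realType) (fs : nat -> R[i]).
Local Notation C := R[i].
Hypothesis schur : forall z : C, nm z < 1 ->
  exists2 L, clim (fun n => \sum_(j < n) fs j * z ^+ j) L & nm L <= 1.

(** Convergence at a radius rho between r and 1 bounds the coefficients, so on |z| = r the tails are
    geometric with ratio r / rho, uniformly in z. *)
Lemma schur_partial_sum (r e : R) : 0 <= r < 1 -> 0 < e ->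
  exists m0, forall m z, (m0 <= m)%N -> nm z = r -> nm (\sum_(j < m) fs j * z ^+ j) <= 1 + e.
Proof.
move=> /andP[r0 r1] e0; pose rho := (r + 1) / 2.
have [rho0 rho1 rr] : [/\ 0 < rho, rho < 1 & r < rho] by rewrite /rho; split; lra.
have [|L hL _] := schur (z := rho%:C%C); first by rewrite nm_real ger0_norm ?ltW.
have [B B0 hB] := pseries_coef_bounded (ltW rho0) hL.
pose th := r / rho; have th0 : 0 <= th by rewrite divr_ge0 // ltW.
have th1 : th < 1 by rewrite ltr_pdivrMr// mul1r.
have d0 : 0 < 1 - th by rewrite subr_gt0.
have : (fun m => B / (1 - th) * th ^+ m) @ \oo --> B / (1 - th) * 0.
  apply: cvgM; first exact: cvg_cst.
  by apply: cvg_expr; rewrite ger0_norm.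
rewrite mulr0 => /cvgrPdist_le/(_ e e0)[m0 _ hm0]; exists m0 => m z mm zr.
have [|Lz hLz Lz1] := schur (z := z); first by rewrite zr.
have ht j : nm (fs j * z ^+ j) <= B * th ^+ j.
  rewrite nmM nmX zr /th expr_div_n mulrA ler_pdivlMr ?exprn_gt0//.
  by rewrite mulrAC ler_wpM2r ?exprn_ge0.
have th01 : 0 <= th < 1 by rewrite th0.
have tail := geometric_tail th01 (ltW B0) ht.
have h1 : nm (Lz - \sum_(j < m) fs j * z ^+ j) <= B * th ^+ m / (1 - th).
  apply: (clim_nmle (u := fun n => \sum_(j < n + m) fs j * z ^+ j - \sum_(j < m) fs j * z ^+ j)).
    apply: climB; last exact: clim_cst.
    exact: (clim_shiftn m hLz).
  by move=> n; apply: tail; exact: leq_addl.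
have h2 := hm0 m mm; rewrite sub0r normrN in h2; have h3 := le_trans (ler_norm _) h2.
have h4 : B * th ^+ m / (1 - th) = B / (1 - th) * th ^+ m by ring.
have := nmD Lz (\sum_(j < m) fs j * z ^+ j - Lz); rewrite addrC subrK nmB; rewrite h4 in h1; lra.
Qed.

Definition toeplitz (h : nat -> C) N k : C :=
  \sum_(i < k.+1) (if (i < N)%N then h i else 0) * fs (k - i).

(** [toeplitz h N] lists coefficients of a polynomial H times the Schur series. On a circle of
    radius r < 1 the series is replaced by a partial sum bounded by 1 + e, and Parseval compares the
    product with H; finally r tends to 1 and e to 0. *)
Lemma toeplitz_contraction h N K :
  \sum_(k < K) nm (toeplitz h N k) ^+ 2 <= \sum_(n < N) nm (h n) ^+ 2.
Proof.
set T := \sum_(k < K) _; set S := \sum_(n < N) _.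
have T0 : 0 <= T by apply: sumr_ge0 => k _; exact: sqr_ge0.
have S0 : 0 <= S by apply: sumr_ge0 => k _; exact: sqr_ge0.
have key (r e : R) : 0 <= r < 1 -> 0 < e -> (r ^+ K) ^+ 2 * T <= (1 + e) ^+ 2 * S.
  move=> r01 e0; have [m0 hm] := schur_partial_sum r01 e0.
  have /andP[r0 r1] := r01; have r1' := ltW r1.
  (* As m >= K, truncating the series at [m] leaves the first [K] coefficients of the product
     intact. *)
  pose m := (m0 + K)%N; pose H : {poly C} := \poly_(n < N) h n.
  pose p : {poly C} := \poly_(j < m) fs j; pose M := (N + m).+1.
  have [w pw] := @prim_root_exists_closed R M (ltn0Sn _).
  have M0 : 0 < M%:R :> R by rewrite ltr0n.
  have sHp : (size (H * p)%R <= M)%N.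
    apply: (leq_trans (size_polyMleq _ _)); apply: (leq_trans (leq_pred _)).
    by rewrite /M ltnW// ltnS leq_add// size_poly.
  have sH : (size H <= M)%N by apply: leq_trans (size_poly _ _) (leqW (leq_addr _ _)).
  have P1 := parseval_roots_of_unity r pw sHp; have P2 := parseval_roots_of_unity r pw sH.
  have le1 : \sum_(k < M) nm (H * p)`_k ^+ 2 * (r ^+ k) ^+ 2 <=
      (1 + e) ^+ 2 * \sum_(k < M) nm H`_k ^+ 2 * (r ^+ k) ^+ 2.
    rewrite -(ler_pM2l M0) -P1 mulrCA -P2 mulr_sumr; apply: ler_sum => i _.
    rewrite hornerM nmM exprMn mulrC ler_wpM2r ?sqr_ge0//.
    rewrite ler_pXn2r ?nnegrE ?nm_ge0 ?addr_ge0 ?(ltW e0)// horner_poly.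
    apply: hm; first by rewrite /m leq_addr.
    rewrite nmM nm_real nmX (nm_root_of_unity (ltn0Sn _) (prim_expr_order pw)) expr1n mulr1.
    by rewrite ger0_norm.
  have le2 : \sum_(k < M) nm H`_k ^+ 2 * (r ^+ k) ^+ 2 <= S.
    apply: (@le_trans _ _ (\sum_(k < M) nm H`_k ^+ 2)).
      by apply: ler_sum => k _; rewrite ler_piMr ?sqr_ge0// expr_le1 ?exprn_ge0 ?exprn_ile1.
    have NM : (N <= M)%N by exact: leqW (leq_addr _ _).
    rewrite -(subnKC NM) big_split_ord /= [X in _ + X]big1 ?addr0 => [|k _].
      by apply: ler_sum => k _; rewrite coef_poly ltn_ord.
    by rewrite coef_poly ltnNge leq_addr nm0 expr0n.
  have le3 : (r ^+ K) ^+ 2 * T <= \sum_(k < M) nm (H * p)`_k ^+ 2 * (r ^+ k) ^+ 2.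
    have KM : (K <= M)%N by rewrite /M /m addnA; exact: leqW (leq_addl _ _).
    rewrite -(subnKC KM) big_split_ord /= -[leLHS]addr0; apply: lerD; last first.
      by apply: sumr_ge0 => k _; rewrite mulr_ge0 ?sqr_ge0.
    rewrite mulr_sumr; apply: ler_sum => k _.
    have -> : (H * p)`_k = toeplitz h N k.
      rewrite coefM /toeplitz; apply: eq_bigr => i _; rewrite !coef_poly.
      have -> : (k - i < m)%N.
        exact: leq_ltn_trans (leq_subr _ _) (leq_trans (ltn_ord k) (leq_addl _ _)).
      by [].
    rewrite mulrC ler_wpM2l ?sqr_ge0// ler_pXn2r ?nnegrE ?exprn_ge0//.
    by apply: ler_wiXn2l => //; exact: ltnW.
  apply: (le_trans le3); apply: (le_trans le1).
  by rewrite ler_wpM2l ?sqr_ge0.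
pose q n : R := n.+2%:R^-1.
have q0 n : 0 < q n by rewrite invr_gt0.
have q1 n : 0 <= 1 - q n < 1.
  rewrite subr_ge0 ltrBlDr ltrDl q0 andbT /q invf_le1// ler1n//.
have qc : q @ \oo --> (0 : R).
  have := @cvg_harmonic R; rewrite -(cvg_shiftS (@harmonic R)); exact.
have c1 : (fun n => 1 - q n) @ \oo --> (1 : R).
  by rewrite -[X in _ --> X](subr0 (1 : R)); apply: cvgB => //; exact: cvg_cst.
have c2 : (fun n => 1 + q n) @ \oo --> (1 : R).
  by rewrite -[X in _ --> X](addr0 (1 : R)); apply: cvgD => //; exact: cvg_cst.
have c1X j : (fun n => (1 - q n) ^+ j) @ \oo --> (1 : R).
  elim: j => [|j IH]; first exact: cvg_cst.
  rewrite -[X in _ --> X](mulr1 (1 : R)); under eq_fun do rewrite exprS.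
  exact: cvgM.
have lim1 : (fun n => ((1 - q n) ^+ K) ^+ 2 * T) @ \oo --> 1 * 1 * T.
  exact: (cvgM (cvgM (c1X K) (c1X K)) (cvg_cst T)).
have lim2 : (fun n => (1 + q n) ^+ 2 * S) @ \oo --> 1 * 1 * S.
  exact: (cvgM (cvgM c2 c2) (cvg_cst S)).
rewrite !mul1r in lim1 lim2.
by apply: (ler_cvg_to lim1 lim2); apply: nearW => n; exact: key.
Qed.

Lemma triangular_exchange (G : nat -> nat -> C) m :
  \sum_(k < m) \sum_(i < k.+1) G i (k - i)%N = \sum_(i < m) \sum_(j < m - i) G i j.
Proof.
elim: m => [|m IH]; first by rewrite !big_ord0.
rewrite big_ord_recr /= IH [RHS]big_ord_recr /= subSn// subnn big_ord1.
rewrite [X in _ + X]big_ord_recr /= subnn addrA -big_split; congr (_ + _).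
by apply: eq_bigr => i _; rewrite /= subSn ?(ltnW (ltn_ord i))// big_ord_recr.
Qed.

(** Duality: [d] is the image of [c] under the transpose of the Toeplitz operator. Pairing it with
    its own conjugate and moving the operator to that side gives S <= sqrt(sq c) * sqrt S. *)
Lemma schur_contraction (c d : nat -> C) N : l2 c ->
  (forall n, clim (fun m => \sum_(j < m) fs j * c (n + j)%N) (d n)) ->
  \sum_(n < N) nm (d n) ^+ 2 <= sq c.
Proof.
move=> hc hd; set S := \sum_(n < N) _.
have S0 : 0 <= S by apply: sumr_ge0 => k _; exact: sqr_ge0.
pose h n := (d n)^*.
have hS : S = \sum_(n < N) nm (h n) ^+ 2 by apply: eq_bigr => n _; rewrite nm_conj.
have E m : (N <= m)%N -> \sum_(k < m) c k * toeplitz h N k =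
    \sum_(n < N) h n * \sum_(j < m - n) fs j * c (n + j)%N.
  move=> Nm; pose G i j := (if (i < N)%N then h i else 0) * (fs j * c (i + j)%N).
  transitivity (\sum_(k < m) \sum_(i < k.+1) G i (k - i)%N).
    apply: eq_bigr => k _; rewrite mulr_sumr; apply: eq_bigr => i _.
    by rewrite /G subnKC ?[c k * _]mulrC ?mulrA// -ltnS.
  rewrite triangular_exchange.
  rewrite (big_ord_widen m (fun n => h n * \sum_(j < m - n) fs j * c (n + j)%N) Nm) [RHS]big_mkcond.
  apply: eq_bigr => i _; rewrite /G; case: ifP => _; first by rewrite mulr_sumr.
  by rewrite big1// => j _; rewrite mul0r.
have lim : clim (fun m => \sum_(n < N) h n * \sum_(j < m + N - n) fs j * c (n + j)%N)
    (\sum_(n < N) h n * d n).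
  apply: clim_sum => n; apply: climZ; have := clim_shiftn (N - n) (hd n).
  by congr clim; apply/funext => m; rewrite addnBA// ltnW.
have SE : \sum_(n < N) h n * d n = S%:C%C.
  by rewrite rmorph_sum; apply: eq_bigr => n _; rewrite /h mulrC nm_sqr.
have bound : nm (S%:C%C) <= Num.sqrt (sq c) * Num.sqrt S.
  rewrite -SE; apply: (clim_nmle lim) => m; rewrite -E ?leq_addl//.
  have := cauchy_schwarz_sum (fun k : 'I_(m + N) => c k) (fun k => toeplitz h N k) => cs.
  rewrite -sqrtrM ?sq_ge0// -(ger0_norm (nm_ge0 _)) -sqrtr_sqr; apply: ler_wsqrtr.
  apply: (le_trans cs); apply: ler_pM; rewrite ?sumr_ge0//; try by move=> i _; exact: sqr_ge0.
    exact: sq_ub.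
  by rewrite hS; exact: toeplitz_contraction.
rewrite nm_real ger0_norm// in bound.
have [->|Sn0] := eqVneq S 0; first exact: sq_ge0.
have Sp : 0 < S by rewrite lt_neqAle eq_sym Sn0.
have sS : 0 < Num.sqrt S by rewrite sqrtr_gt0.
rewrite -{1}(sqr_sqrtr S0) expr2 ler_pM2r// in bound.
rewrite -(sqr_sqrtr S0) -(sqr_sqrtr (sq_ge0 hc)).
by rewrite ler_pXn2r ?nnegrE ?sqrtr_ge0.
Qed.

End SchurContraction.

(** * Functions given by power series with bounded coefficients *)

Section BoundedPowerSeries.
Variable R : realType.
Local Notation C := R[i].
Implicit Types (u : nat -> C) (z w : C).

Definition pval u z : C := csum (fun j => u j * z ^+ j).

Lemma geometric_sum_le (r : R) n : 0 <= r < 1 -> \sum_(j < n) r ^+ j <= (1 - r)^-1.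
Proof.
move=> /andP[r0 r1]; have d0 : 0 < 1 - r by rewrite subr_gt0.
rewrite -div1r ler_pdivlMr//.
have -> : (\sum_(i < n) r ^+ i) * (1 - r) = 1 - r ^+ n.
  by rewrite -opprB mulrN [_ * (r - 1)]mulrC -subrX1 opprB.
by rewrite gerBl exprn_ge0.
Qed.

Section Bounded.
Variables (u : nat -> C) (M : R).
Hypothesis uM : forall j, nm (u j) <= M.

Let M0 : 0 <= M := le_trans (nm_ge0 _) (uM 0%N).

Lemma pval_term_sum z n : nm z < 1 -> \sum_(j < n) nm (u j * z ^+ j) <= M / (1 - nm z).
Proof.
move=> z1; apply: (@le_trans _ _ (\sum_(j < n) M * nm z ^+ j)).
  by apply: ler_sum => j _; rewrite nmM nmX ler_wpM2r ?exprn_ge0 ?nm_ge0.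
by rewrite -mulr_sumr ler_wpM2l// geometric_sum_le// nm_ge0.
Qed.

Lemma pvalP z : nm z < 1 -> clim (fun n => \sum_(j < n) u j * z ^+ j) (pval u z).
Proof. by move=> z1; apply: csumP => n; exact: pval_term_sum. Qed.

Lemma pval_bound z : nm z < 1 -> nm (pval u z) <= M / (1 - nm z).
Proof.
move=> z1; apply: (clim_nmle (pvalP z1)) => n.
by apply: (le_trans (nm_sum _ _ _)); exact: pval_term_sum.
Qed.

End Bounded.

(* The coefficients of [w |-> (pval u w - pval u z) / (w - z)]. *)
Definition divdiff u z i : C := pval (fun j => u (i.+1 + j)%N) z.

Lemma divdiff_bound u (M : R) z i : (forall j, nm (u j) <= M) -> nm z < 1 ->
  nm (divdiff u z i) <= M / (1 - nm z).
Proof. by move=> uM z1; exact: pval_bound. Qed.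

Lemma pval_divdiff u (M : R) z w : (forall j, nm (u j) <= M) -> nm z < 1 -> nm w < 1 ->
  pval u w - pval u z = (w - z) * pval (divdiff u z) w.
Proof.
move=> uM z1 w1; have dM i := divdiff_bound i uM z1.
have rec u' : (forall j, nm (u' j) <= M) -> pval u' z = u' 0%N + z * pval (fun j => u' j.+1) z.
  move=> uM'; apply: (clim_unique (u := fun n => \sum_(j < n.+1) u' j * z ^+ j)).
    by have := clim_shiftn 1 (pvalP uM' z1); congr clim; apply/funext => n; rewrite addn1.
  have := climD (clim_cst (u' 0%N)) (climZ z (pvalP (fun j => uM' j.+1) z1)).
  congr clim; apply/funext => n; rewrite big_ord_recl expr0 mulr1 mulr_sumr; congr (_ + _).
  by apply: eq_bigr => j _; rewrite lift0 exprS; ring.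
(* Horner tails: [p i] = [u i] + z [p i.+1], and [divdiff u z i] is [p i.+1], so multiplication by w
   - z telescopes. *)
pose p i := pval (fun j => u (i + j)%N) z.
have pE i : p i = u i + z * divdiff u z i.
  rewrite /p rec => [|j]; last exact: uM.
  rewrite addn0 /divdiff; congr (_ + _ * pval _ _).
  by apply/funext => j; rewrite addnS.
have S n : (w - z) * \sum_(i < n) divdiff u z i * w ^+ i =
    p n * w ^+ n - p 0 + \sum_(i < n) u i * w ^+ i.
  elim: n => [|n IH]; first by rewrite !big_ord0 mulr0 expr0 mulr1 subrr add0r.
  rewrite !big_ord_recr /= mulrDr IH pE.
  have -> : p n.+1 = divdiff u z n by [].
  by rewrite exprS; ring.
apply: (clim_unique (u := fun n => p n * w ^+ n - p 0 + \sum_(i < n) u i * w ^+ i)).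
  rewrite addrC; have -> : p 0 = pval u z by [].
  apply: climD; last exact: (pvalP uM w1).
  rewrite -[X in clim _ X]add0r; apply: climB; last exact: clim_cst.
  apply/clim0; have : (fun n => M / (1 - nm z) * nm w ^+ n) @ \oo --> M / (1 - nm z) * 0.
    apply: cvgM; first exact: cvg_cst.
    by apply: cvg_expr; rewrite ger0_norm ?nm_ge0.
  rewrite mulr0; apply: null_le => n; first exact: nm_ge0.
  by rewrite nmM nmX ler_wpM2r ?exprn_ge0 ?nm_ge0//; apply: pval_bound.
have := climZ (w - z) (pvalP dM w1); congr clim; apply/funext => n.
by rewrite -S.
Qed.

(** The difference quotient is [pval (divdiff u z)] at z + h; a second divided difference bounds its
    distance to the value at z by K |h|. *)
Lemma pval_derivable u (M : R) (z : C) : (forall j, nm (u j) <= M) -> nm z < 1 ->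
  derivable (pval u : C^o -> C^o) (z : C^o) 1.
Proof.
move=> uM z1; have dM i := divdiff_bound i uM z1.
set M1 := M / (1 - nm z) in dM; have M10 : 0 <= M1 := le_trans (nm_ge0 _) (dM 0%N).
apply/cvg_ex; exists (pval (divdiff u z) z : C^o); apply/cvgrPdist_le => e e0.
have /complex_realP[e' eE] : e \is Num.real by rewrite gtr0_real.
have e'0 : 0 < e' by rewrite -ltcR -eE.
pose d := (1 - nm z) / 2; have d0 : 0 < d by rewrite divr_gt0 ?subr_gt0.
pose M2 := M1 / (1 - nm z).
have M20 : 0 <= M2 by rewrite divr_ge0 ?subr_ge0// (ltW z1).
pose K := M2 / d; have K0 : 0 <= K by rewrite divr_ge0 // ltW.
pose r := Num.min d (e' / (K + 1)).
have r0 : 0 < r by rewrite lt_min d0 divr_gt0// ltr_wpDl.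
rewrite near_withinE /=; apply/nbhs_ballP; exists r%:C%C => /=.
  by rewrite -[X in X < _](rmorph0 (real_complex R)) ltcR.
move=> h; rewrite /ball /= sub0r normrN nmE ltcR => hr h0.
have hd : nm h < d by apply: (lt_le_trans hr); rewrite ge_min lexx.
have z2 : nm z + d < 1 by rewrite /d; lra.
have zh1 : nm (h + z) < 1 by apply: le_lt_trans (nmD _ _) _; lra.
rewrite [h *: 1]mulr1 (pval_divdiff uM z1 zh1) addrK.
rewrite [_ *: _]mulrA mulVf// mul1r.
rewrite -normrN opprB (pval_divdiff dM z1 zh1) addrK eE nmE lecR nmM.
have dM2 i : nm (divdiff (divdiff u z) z i) <= M2 by exact: divdiff_bound.
have b := pval_bound dM2 zh1.
have b2 : M2 / (1 - nm (h + z)) <= K.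
  rewrite /K ler_wpM2l// lef_pV2 ?posrE ?subr_gt0//.
  by have := nmD h z; rewrite /d in hd *; lra.
apply: (@le_trans _ _ (nm h * K)); first by rewrite ler_wpM2l ?nm_ge0// (le_trans b).
apply: (@le_trans _ _ (e' / (K + 1) * K)).
  by rewrite ler_wpM2r// ltW// (lt_le_trans hr)// ge_min lexx orbT.
by rewrite -mulrA ler_piMr ?(ltW e'0)// mulrC ler_pdivrMr ?mul1r ?lerDl// ltr_wpDl.
Qed.

Lemma pseries_bounded_eq0 u (M : R) : (forall j, nm (u j) <= M) ->
  (forall z, nm z < 1 -> clim (fun n => \sum_(j < n) u j * z ^+ j) 0) -> forall n, u n = 0.
Proof.
move=> uM h n; have M0 : 0 <= M := le_trans (nm_ge0 _) (uM 0%N).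
have [m] := ubnP n; elim: m n => // m IH n nm_; apply/eqP; rewrite -nm_eq0.
rewrite eq_le nm_ge0 andbT leNgt; apply/negP => un0.
(* All earlier coefficients vanish, so the tail bound at t gives |u n| <= M t / (1 - t) <= 2 M t,
   which this t makes smaller than |u n|. *)
pose t := Num.min 2^-1 (nm (u n) / (4 * M + 1)).
have M4 : 0 < 4 * M + 1 by lra.
have t0 : 0 < t by rewrite lt_min invr_gt0 ltr0n divr_gt0.
have t2 : t <= 2^-1 by rewrite ge_min lexx.
have tM : t * (4 * M + 1) <= nm (u n) by rewrite -ler_pdivlMr// ge_min lexx orbT.
have nt : nm t%:C%C = t by rewrite nm_real ger0_norm// ltW.
have t1 : nm t%:C%C < 1 by rewrite nt; lra.
have ht := h _ t1.
have z0 : pval u t%:C%C = 0 by exact: csum_eq.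
have tail : nm (0 - u n * t%:C%C ^+ n) <= M * t ^+ n.+1 / (1 - t).
  apply: (clim_nmle (u := fun k => \sum_(j < k + n.+1) u j * t%:C%C ^+ j - u n * t%:C%C ^+ n)).
    by apply: climB; [exact: (clim_shiftn n.+1 ht)|exact: clim_cst].
  move=> k; have -> : u n * t%:C%C ^+ n = \sum_(j < n.+1) u j * t%:C%C ^+ j.
    rewrite big_ord_recr /= big1 ?add0r// => j _.
    by rewrite (IH j) ?mul0r// (leq_trans (ltn_ord j)).
  have t01 : 0 <= t < 1 by rewrite (ltW t0) /=; rewrite nt in t1.
  apply: (geometric_tail t01 M0) => [j|]; last exact: leq_addl.
  by rewrite nmM nmX nt ler_wpM2r ?exprn_ge0// (ltW t0).
rewrite sub0r nmN nmM nmX nt exprS in tail.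
have tn : 0 < t ^+ n by rewrite exprn_gt0.
have h1 : nm (u n) <= M * t / (1 - t).
  rewrite -(ler_pM2r tn); apply: (le_trans tail).
  by have -> : M * (t * t ^+ n) / (1 - t) = M * t / (1 - t) * t ^+ n by ring.
have h2 : M * t / (1 - t) <= 2 * (M * t).
  rewrite ler_pdivrMr; last by rewrite subr_gt0; lra.
  have : 0 <= M * t by rewrite mulr_ge0 // ltW.
  nra.
nra.
Qed.

(** Coefficients of a series converging in the disk may be unbounded; rescaling the variable by 1/2
    reduces to [pseries_bounded_eq0]. *)
Lemma pseries_unique u (v : nat -> C) (f : C -> C) :
  (forall z, nm z < 1 -> clim (fun n => \sum_(j < n) u j * z ^+ j) (f z)) ->
  (forall z, nm z < 1 -> clim (fun n => \sum_(j < n) v j * z ^+ j) (f z)) ->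
  forall n, u n = v n.
Proof.
move=> hu hv n.
have r0 : 0 < 2^-1 :> R by rewrite invr_gt0.
have rC : nm (2^-1%:C%C : C) < 1 by rewrite nm_real (ger0_norm (ltW r0)); lra.
have hw z : nm z < 1 -> clim (fun n => \sum_(j < n) (u j - v j) * z ^+ j) 0.
  move=> z1; rewrite -[X in clim _ X](subrr (f z)); have := climB (hu z z1) (hv z z1).
  congr clim; apply/funext => k; rewrite -sumrB; apply: eq_bigr => j _.
  by rewrite mulrBl.
have [B B0 hB] := pseries_coef_bounded (u := fun j => u j - v j) (ltW r0) (hw _ rC).
pose w j := (u j - v j) * 2^-1%:C%C ^+ j.
have wB j : nm (w j) <= B by rewrite nmM nmX nm_real (ger0_norm (ltW r0)).
have : w n = 0.
  apply: (pseries_bounded_eq0 wB) => z z1.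
  have : nm (2^-1%:C%C * z) < 1 by rewrite nmM mulr_ilt1 ?nm_ge0.
  move=> /hw; congr clim; apply/funext => k; apply: eq_bigr => j _.
  by rewrite /w exprMn mulrA.
move/eqP; rewrite mulf_eq0 expf_eq0 fmorph_eq0 invr_eq0 pnatr_eq0 andbF orbF subr_eq0.
by move/eqP.
Qed.

(* Testing the contraction on [(z^j)_(j < k)], an approximate eigenvector of the
   backward shift. *)
Lemma contractive_schur (f : nat -> C) :
  (forall k t N, \sum_(n < N) nm (\sum_(i < k) trunc k t (n + i)%N * f i) ^+ 2 <=
     \sum_(j < k) nm (t j) ^+ 2) ->
  (forall j, nm (f j) <= 1) /\ forall z, nm z < 1 -> nm (pval f z) <= 1.
Proof.
move=> hf.
have f1 j : nm (f j) <= 1.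
  have := hf j.+1 (fun i => (i == j)%:R) 1%N; rewrite big_ord1.
  rewrite (bigD1 ord_max)//= add0n /trunc ltnSn eqxx mul1r big1 ?addr0 => [|i ij]; last first.
    by rewrite add0n -(inj_eq val_inj) /= in ij *; rewrite (negPf ij) if_same mul0r.
  rewrite (bigD1 ord_max)//= eqxx nm1 expr1n big1 ?addr0 => [|i ij]; last first.
    by rewrite -(inj_eq val_inj) /= in ij; rewrite (negPf ij) nm0 expr0n.
  by rewrite expr_le1 ?nm_ge0.
split=> // z z1; set s := nm z in z1; have s0 : 0 <= s := nm_ge0 z.
have s2 : 0 <= s ^+ 2 < 1 by rewrite sqr_ge0 expr_lt1.
have L := pvalP f1 z1; set F := pval f z in L *.
(* With N fixed and k tending to infinity, coordinate n of the image tends to z^n F. The first N of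
   them have energy |F|^2 (1 - s^(2N)) / (1 - s^2), against at most 1 / (1 - s^2) for the test
   vector. *)
have keyN N : nm F ^+ 2 * (1 - (s ^+ N) ^+ 2) <= 1.
  have lim : (fun k => \sum_(n < N) (s ^+ n) ^+ 2 * nm (\sum_(i < k + N - n) f i * z ^+ i) ^+ 2)
      @ \oo --> \sum_(n < N) (s ^+ n) ^+ 2 * nm F ^+ 2.
    have h n : (n < N)%N -> (fun k => (s ^+ n) ^+ 2 * nm (\sum_(i < k + N - n) f i * z ^+ i) ^+ 2)
        @ \oo --> (s ^+ n) ^+ 2 * nm F ^+ 2.
      move=> nN; have h1 : clim (fun k => \sum_(i < k + N - n) f i * z ^+ i) F.
        have := clim_shiftn (N - n) L; congr clim; apply/funext => k.
        by rewrite addnBA// ltnW.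
      exact: (cvgM (cvg_cst _) (cvgM (clim_nm h1) (clim_nm h1))).
    apply/cvg_dist0; have : (fun k => \sum_(n < N) `|(s ^+ n) ^+ 2 * nm (\sum_(i < k + N - n) f i * z ^+ i) ^+ 2
        - (s ^+ n) ^+ 2 * nm F ^+ 2|) @ \oo --> (0 : R).
      apply: (null_sum (F := fun k (n : 'I_N) => `|(s ^+ n) ^+ 2 * nm (\sum_(i < k + N - n) f i * z ^+ i) ^+ 2
        - (s ^+ n) ^+ 2 * nm F ^+ 2|)) => n.
      have /cvg_dist0 := h n (ltn_ord n); exact.
    apply: null_le => k; first exact: normr_ge0.
    by rewrite -sumrB; exact: ler_norm_sum.
  have b : \sum_(n < N) (s ^+ n) ^+ 2 * nm F ^+ 2 <= (1 - s ^+ 2)^-1.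
    apply: (cvgr_to_le lim); apply: nearW => k.
    have := hf (k + N)%N (fun j => z ^+ j) N => h.
    apply: (@le_trans _ _ (\sum_(n < N) nm (\sum_(i < k + N) trunc (k + N) (fun j => z ^+ j) (n + i)%N * f i) ^+ 2)).
      apply: ler_sum => n _.
      have -> : \sum_(i < k + N) trunc (k + N) (fun j => z ^+ j) (n + i)%N * f i =
         z ^+ n * \sum_(i < k + N - n) f i * z ^+ i.
        rewrite (big_ord_widen (k + N) (fun i => f i * z ^+ i) (leq_subr _ _)) [X in _ * X]big_mkcond mulr_sumr.
        apply: eq_bigr => i _; rewrite /trunc addnC ltn_subRL addnC.
        by case: ifP => _; rewrite ?mul0r ?mulr0// exprD; ring.
      by rewrite nmM nmX exprMn.
    apply: (le_trans h); apply: (@le_trans _ _ (\sum_(j < k + N) (s ^+ 2) ^+ j)).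
      by apply: ler_sum => j _; rewrite nmX -!exprM mulnC.
    exact: geometric_sum_le.
  have d0 : 0 < 1 - s ^+ 2 by rewrite subr_gt0; case/andP: s2.
  move: b; rewrite -mulr_suml -div1r ler_pdivlMr// => b.
  have -> : 1 - (s ^+ N) ^+ 2 = (1 - s ^+ 2) * \sum_(n < N) (s ^+ n) ^+ 2.
    elim: N {lim b} => [|N IH]; first by rewrite big_ord0 mulr0 expr0 expr1n subrr.
    by rewrite big_ord_recr /= mulrDr -IH (exprS s N); ring.
  by rewrite mulrA; move: b; rewrite -mulrA mulrC -mulrA; lra.
have limN : (fun N => nm F ^+ 2 * (1 - (s ^+ N) ^+ 2)) @ \oo --> nm F ^+ 2 * (1 - 0 * 0).
  have hs : (fun N => s ^+ N) @ \oo --> (0 : R) by apply: cvg_expr; rewrite ger0_norm.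
  by apply: cvgM; [exact: cvg_cst|apply: cvgB; [exact: cvg_cst|exact: cvgM]].
rewrite mulr0 subr0 mulr1 in limN.
have : nm F ^+ 2 <= 1 by apply: (cvgr_to_le limN); exact: nearW.
by rewrite expr_le1 ?nm_ge0.
Qed.

End BoundedPowerSeries.

(** * Iterated Blaschke steps and the two directions for functionals *)

Section Interpolation.
Variables (R : realType) (W : lmodType R[i]) (A : {linear W -> W}).
Local Notation C := R[i].
Implicit Types (b c : W -> C) (s : seq C).

Definition in_disk s := forall a, a \in s -> nm a < 1.

Lemma in_disk_cons a s : in_disk (a :: s) -> nm a < 1 /\ in_disk s.
Proof.
move=> h; split; first by apply: h; rewrite mem_head.
by move=> x xs; apply: h; rewrite inE xs orbT.
Qed.

Fixpoint blaschke_steps s b : W -> C :=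
  if s is a :: s' then blaschke_steps s' (blaschke_step A a b) else b.

Fixpoint blaschke_coefs s : nat -> C :=
  if s is a :: s' then blaschke_coef a (blaschke_coefs s') else fun j => (j == 0%N)%:R.

Lemma blaschke_steps_l2 s b : in_disk s -> l2_functional A b ->
  l2_functional A (blaschke_steps s b).
Proof.
elim: s b => //= a s IH b /in_disk_cons[a1 hs] hb.
by apply: IH => //; exact: blaschke_step_l2.
Qed.

Lemma blaschke_coefs_bounded s : in_disk s ->
  exists M : R, forall j, nm (blaschke_coefs s j) <= M.
Proof.
elim: s => [_|a s IH /in_disk_cons[a1 hs]] /=.
  by exists 1 => j; case: (j == 0%N); rewrite ?nm1 ?nm0.
have [M hM] := IH hs; exists (2 * (M / (1 - nm a))) => j.
exact: blaschke_coef_bounded.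
Qed.

Lemma clim_delta_sum (u : nat -> C) :
  clim (fun n => \sum_(j < n) (j == 0%N :> nat)%:R * u j) (u 0%N).
Proof.
rewrite /clim -(cvg_shiftn 1) (_ : (fun _ => _) = cst 0); first exact: cvg_cst.
apply/funext => n; rewrite addn1 big_ord_recl mul1r big1 ?addr0 ?subrr ?nm0// => j _.
by rewrite mul0r.
Qed.

Lemma blaschke_coefs_pseries s z : in_disk s -> nm z < 1 ->
  clim (fun n => \sum_(j < n) blaschke_coefs s j * z ^+ j)
    (\prod_(a <- s) ((z - a^*) / (1 - z * a))).
Proof.
move=> + z1; elim: s => [_|a s IH /in_disk_cons[a1 hs]] /=.
  by rewrite big_nil; have := clim_delta_sum (fun j => z ^+ j); rewrite expr0.
have [M hM] := blaschke_coefs_bounded hs.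
by rewrite big_cons mulrC; apply: (blaschke_coef_pseries a1 hM z1); exact: IH.
Qed.

Lemma blaschke_coefs_clim s b x : in_disk s -> l2_functional A b ->
  clim (fun n => \sum_(j < n) blaschke_coefs s j * orb A b x j) (blaschke_steps s b x).
Proof.
elim: s b => [|a s IH] b /=; first by move=> _ _; exact: (clim_delta_sum (orb A b x)).
move=> /in_disk_cons[a1 hs] hb; have [M hM] := blaschke_coefs_bounded hs.
apply/(blaschke_coef_clim a1 hb x _ hM); apply: IH => //; exact: blaschke_step_l2.
Qed.

Lemma qf_gramian_blaschke_steps s b : in_disk s -> l2_functional A b ->
  exists2 phi : 'I_(size s) -> W -> C, (forall i, linear_functional (phi i)) &
  forall x, qf (gramian A b) x = qf (gramian A (blaschke_steps s b)) x +
    \sum_i nm (phi i x) ^+ 2.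
Proof.
elim: s b => [|a s IH] b /=.
  by move=> _ _; exists (fun _ _ => 0) => [[]//|x]; rewrite big_ord0 addr0.
move=> /in_disk_cons[a1 hs] hb.
have [phi hphi E] := IH _ hs (blaschke_step_l2 a1 hb).
exists (fun i => oapp phi (szego_functional A b a) (unlift ord0 i)) => [i|x].
  by case: (unlift ord0 i) => [j|] /=; [exact: hphi|apply: szego_functional_linear => //; exact: ltW].
rewrite big_ord_recl unlift_none /=.
rewrite (_ : \sum_(i < size s) _ = \sum_i nm (phi i x) ^+ 2); last first.
  by apply: eq_bigr => i _; rewrite liftK.
by rewrite {1}/qf (gramian_blaschke_step a1 hb) raddfD /= nm_sqr /= -/(qf _ x) E; ring.
Qed.

Lemma defect_blaschke_step c b a : nm a < 1 -> l2_functional A b ->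
  defect A c (blaschke_step A a b) = reduced A c b a.
Proof.
move=> a1 hb; apply/funext => x; apply/funext => y.
by rewrite /reduced /defect (gramian_blaschke_step a1 hb); ring.
Qed.

Lemma negsq_le_blaschke_steps k c b : l2_functional A c -> l2_functional A b ->
  negsq_le k (defect A c b) ->
  exists s, [/\ size s = k, in_disk s & negsq_le 0 (defect A c (blaschke_steps s b))].
Proof.
move=> hc; elim: k b => [|k IH] b hb hk; first by exists [::]; split.
have [a a1 ha] := negative_square_reduction hc hb hk.
rewrite -(defect_blaschke_step _ a1 hb) in ha.
have [s [sk hs h0]] := IH _ (blaschke_step_l2 a1 hb) ha.
exists (a :: s); split=> //=; first by rewrite sk.
by move=> x; rewrite inE => /orP[/eqP->//|/hs].
Qed.

Lemma negsq_le0 (Q : W -> W -> C) x : hermitian_sesquilinear Q -> negsq_le 0 Q -> 0 <= qf Q x.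
Proof.
move=> hQ /(_ (fun=> x))[t t0]; rewrite /lcomb big_ord1 (qfZ hQ) pmulr_rge0//.
rewrite exprn_gt0// lt_def nm_ge0 andbT nm_eq0; apply: contra t0 => /eqP t0.
by apply/eqP/rowP => i; rewrite (ord1 i) t0 mxE.
Qed.

Lemma interpolation k c b : l2_functional A c -> l2_functional A b ->
  negsq_le k (defect A c b) ->
  exists (f : nat -> C) s, [/\ size s = k, in_disk s,
    forall k t N, \sum_(n < N) nm (\sum_(i < k) trunc k t (n + i)%N * f i) ^+ 2 <=
      \sum_(j < k) nm (t j) ^+ 2
    & forall x, exists l, clim (fun n => \sum_(j < n) f j * orb A c x j) l /\
        clim (fun n => \sum_(j < n) blaschke_coefs s j * orb A b x j) l].
Proof.
move=> hc hb /(negsq_le_blaschke_steps hc hb)[s [sk hs h0]].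
have hb' := blaschke_steps_l2 hs hb.
have [x|f [hf fE]] := commutant_lifting hc hb' _.
  exact: negsq_le0 (defect_hs hc hb') h0.
exists f, s; split=> // x; exists (blaschke_steps s b x); split; first exact: fE.
exact: blaschke_coefs_clim.
Qed.

Lemma exists_common_zero k (phi : 'I_k -> W -> C) (w : 'I_k.+1 -> W) :
  (forall i, linear_functional (phi i)) ->
  exists2 t : 'rV[C]_k.+1, t != 0 & forall i, phi i (lcomb t w) = 0.
Proof.
move=> hphi; pose M := \matrix_(i < k.+1, j < k) phi j (w i).
have : kermx M != 0 by rewrite kermx_eq0 -row_leq_rank -ltnNge ltnS rank_leq_col.
move=> /rowV0Pn[t /sub_kermxP tM t0]; exists t => // j.
rewrite (lf_lcomb (hphi j)); move/rowP: tM => /(_ j); rewrite !mxE => E; rewrite -[RHS]E.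
by apply: eq_bigr => i _; rewrite mxE.
Qed.

(** The Gramian of [b] exceeds that of [blaschke_steps s b] by [size s] rank one forms. Any
    [(size s).+1] vectors have a nonzero coefficient vector whose combination kills all of these,
    and there the Schur contraction applies. *)
Lemma negsq_le_interpolation c b (f u : nat -> C) (g : C) s :
  l2_functional A c -> l2_functional A b -> in_disk s -> nm g = 1 ->
  (forall z, nm z < 1 -> exists2 L, clim (fun n => \sum_(j < n) f j * z ^+ j) L & nm L <= 1) ->
  (forall z, nm z < 1 -> clim (fun n => \sum_(j < n) u j * z ^+ j)
     (g * \prod_(a <- s) ((z - a^*) / (1 - z * a)))) ->
  (forall x, exists l, clim (fun n => \sum_(j < n) f j * orb A c x j) l /\
     clim (fun n => \sum_(j < n) u j * orb A b x j) l) ->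
  negsq_le (size s) (defect A c b).
Proof.
move=> hc hb hs g1 hf hu h.
have hb' := blaschke_steps_l2 hs hb.
(* The calculus relation comes with some coefficient sequence of the Blaschke product; uniqueness
   identifies it with the computed one. *)
have uE j : u j = g * blaschke_coefs s j.
  apply: (pseries_unique (v := fun j => g * blaschke_coefs s j) hu) => z z1.
  have := climZ g (blaschke_coefs_pseries hs z1); congr clim; apply/funext => n.
  by rewrite mulr_sumr; apply: eq_bigr => i _; rewrite mulrA.
have fE x : clim (fun n => \sum_(j < n) f j * orb A c x j) (g * blaschke_steps s b x).
  have [l [hl hl']] := h x; suff <- : l = g * blaschke_steps s b x by [].
  apply: (clim_unique hl'); have := climZ g (blaschke_coefs_clim x hs hb).
  congr clim; apply/funext => n; rewrite mulr_sumr; apply: eq_bigr => i _.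
  by rewrite uE mulrA.
have contr x : qf (gramian A (blaschke_steps s b)) x <= qf (gramian A c) x.
  rewrite !qf_gramian; apply: sq_le => N.
  (* Evaluating the relation at A^n x recovers all coordinates of the orbit, not only the first. *)
  have hd n : clim (fun m => \sum_(j < m) f j * orb A c x (n + j)%N)
      (g * orb A (blaschke_steps s b) x n).
    have := fE (iter n A x); congr clim; apply/funext => m; apply: eq_bigr => j _.
    by rewrite orb_iter shiftnE.
  have := schur_contraction hf N (hc.2 x) hd.
  by under eq_bigr do rewrite nmM g1 mul1r.
have [phi hphi E] := qf_gramian_blaschke_steps hs hb.
move=> w; have [t t0 ht] := exists_common_zero w hphi.
exists t => //; rewrite qf_defect E big1 ?addr0 ?subr_ge0// => i _.
by rewrite ht nm0 expr0n.
Qed.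

End Interpolation.

(** * Invariant subspaces of the dual *)

Section DualSpace.
Variables (R : realType) (V : lmodType R[i]) (D : set (V -> R[i])).
Local Notation C := R[i].

(** [D] becomes the space W of the previous sections, with the restricted dual operator, while [b]
    and [c] act on it by evaluation. The proof that [D] is a subspace is an argument so that closure
    can be registered as an instance on the predicate. *)
Definition dual_mem of is_subspace D : {pred V -> C^o} := fun x' => `[< D x' >].

Variable hD : is_subspace D.

Lemma dual_mem_submod_closed : submod_closed (dual_mem hD).
Proof.
have [_ h0 hP] := hD; split=> [|a x y /asboolP hx /asboolP hy]; apply/asboolP => //; exact: hP.
Qed.

HB.instance Definition _ := GRing.isSubmodClosed.Build _ _ (dual_mem hD) dual_mem_submod_closed.

Record dual_space := DualSpace { dual_val :> V -> C^o; _ : dual_val \in dual_mem hD }.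

HB.instance Definition _ := [isSub for dual_val].
HB.instance Definition _ := [Choice of dual_space by <:].
HB.instance Definition _ := [SubChoice_isSubLmodule of dual_space by <:].

Lemma dual_valP (x : dual_space) : D x.
Proof. by have /asboolP := valP x. Qed.

Variable A : {linear V -> V}.
Hypothesis hA : forall x', D x' -> D (dual_operator A x').

Definition dual_map (x : dual_space) : dual_space :=
  DualSpace (introT (asboolP (D (dual_operator A x))) (hA (dual_valP x))).

Lemma dual_map_linear : linear dual_map.
Proof. by move=> a x y; apply: val_inj. Qed.

HB.instance Definition _ := GRing.isLinear.Build _ _ _ _ dual_map dual_map_linear.

Lemma orb_dual_map v (x : dual_space) j : orb dual_map (fun x => x v) x j = x (iter j A v).
Proof.
rewrite /orb; suff -> : forall w, iter j dual_map x w = x (iter j A w) by [].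
by elim: j => //= j IH w; rewrite /dual_operator /= IH -iterSr.
Qed.

End DualSpace.

Section Translation.
Variable R : realType.
Local Notation C := R[i].

Lemma series_climP (u : nat -> C) (l : C) :
  series (u : nat -> C^o) @ \oo --> (l : C^o) <-> clim (fun n => \sum_(j < n) u j) l.
Proof.
rewrite climP (_ : series _ = fun n => \sum_(j < n) u j)//.
by apply/funext => n; rewrite /series /= big_mkord.
Qed.

Lemma square_summable_l2 (u : nat -> C) : square_summable u -> l2 u.
Proof.
move=> /cvg_ex[l /= /series_climP /clim_bounded[M _ hM]]; exists M => n.
have := hM n; rewrite (_ : \sum_(j < n) _ = (\sum_(j < n) nm (u j) ^+ 2)%:C%C).
  rewrite nm_real; exact: le_trans (ler_norm _).
by rewrite rmorph_sum /=; apply: eq_bigr => j _; rewrite nmE rmorphXn.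
Qed.

Lemma power_series_climP (f : C -> C) u :
  power_series_on_disk f u <->
  forall z, nm z < 1 -> clim (fun n => \sum_(j < n) u j * z ^+ j) (f z).
Proof.
split=> h z z1.
  by apply/(series_climP (fun j => u j * z ^+ j)); apply: h; rewrite /unit_disk /= normC_lt1.
by apply/series_climP; apply: h; rewrite -normC_lt1.
Qed.

(** k' is the largest count attained; the one-point matrix at [x0] shows that some count is
    attained. *)
Lemma has_negative_squares_bounded (T : Type) (Omega : set T) (K : T -> T -> C) (x0 : T) k :
  Omega x0 -> (forall x y, Omega x -> Omega y -> K x y = (K y x)^*) ->
  (forall n (x : 'I_n -> T), (0 < n)%N -> (forall i, Omega (x i)) ->
    (num_neg_eigenvalues (kernel_matrix K x) <= k)%N) ->
  exists2 k', (k' <= k)%N & has_negative_squares Omega K k'.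
Proof.
move=> h0 hK hk; pose P m := `[< exists n (x : 'I_n -> T), [/\ (0 < n)%N,
  forall i, Omega (x i) & num_neg_eigenvalues (kernel_matrix K x) = m] >].
have exP : exists m, P m.
  exists (num_neg_eigenvalues (kernel_matrix K (fun _ : 'I_1 => x0))).
  by apply/asboolP; exists 1%N, (fun=> x0); split.
have leP m : P m -> (m <= k)%N by move=> /asboolP[n [x [n0 hx <-]]]; exact: hk.
case: (ex_maxnP exP leP) => k' /[dup] Pk' /asboolP hk' kmax.
exists k'; [exact: leP|split=> // n x n0 hx].
by apply: kmax; apply/asboolP; exists n, x; split.
Qed.

Section Dual.
Variables (V : lmodType C) (A : {linear V -> V}) (b c : V) (D : set (V -> C)).
Hypotheses (hD : is_subspace D) (hA : forall x', D x' -> D (dual_operator A x')).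

Local Notation A' := (dual_map (hD := hD) hA).
Local Notation ev v := (fun x : dual_space hD => x v).

Lemma dual_l2_functional v :
  (forall x', D x' -> square_summable (fun j => x' (iter j A v))) ->
  l2_functional A' (ev v).
Proof.
move=> h; split=> // x; have := square_summable_l2 (h _ (dual_valP x)).
by congr l2; apply/funext => j; rewrite orb_dual_map.
Qed.

Hypotheses (hb : l2_functional A' (ev b)) (hc : l2_functional A' (ev c)).

Lemma hermitian_formE (x y : dual_space hD) :
  hermitian_form A b c x y = defect A' (ev c) (ev b) x y.
Proof.
rewrite /hermitian_form; apply: (@cvg_lim C^o); first exact: norm_hausdorff.
apply/series_climP.
have := climB (ipP (hc.2 x) (hc.2 y)) (ipP (hb.2 x) (hb.2 y)).
congr clim; apply/funext => n; rewrite -sumrB; apply: eq_bigr => j _.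
by rewrite !orb_dual_map.
Qed.

Definition dual_lift n (x : 'I_n -> V -> C) (hx : forall i, D (x i)) (i : 'I_n) : dual_space hD :=
  DualSpace (introT (asboolP (D (x i))) (hx i)).

Lemma kernel_matrix_dual n (x : 'I_n -> dual_space hD) :
  kernel_matrix (hermitian_form A b c) (fun i => x i : V -> C) =
  kernel_matrix (defect A' (ev c) (ev b)) x.
Proof. by apply/matrixP => i j; rewrite !mxE hermitian_formE. Qed.

Lemma pick_negative_squares k : has_negative_squares D (hermitian_form A b c) k ->
  exists f B : C -> C, [/\ schur_class f, blaschke_product k B & calculus_eq A b c D f B].
Proof.
move=> [_ hk _].
have /(interpolation hc hb)[f [s [sk hs hf fE]]] : negsq_le k (defect A' (ev c) (ev b)).
  apply: (negsq_le_of_count (defect_hs hc hb)) => w.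
  by rewrite -kernel_matrix_dual; apply: hk => // i; exact: dual_valP.
have [f1 fS] := contractive_schur hf.
exists (pval f), (fun z => \prod_(a <- s) ((z - a^*) / (1 - z * a))); split.
- move=> z; rewrite /unit_disk /= normC_lt1 => z1; split; first exact: pval_derivable f1 z1.
  by rewrite normC_le1; exact: fS.
(* The factor produced by a pole parameter a has its zero at conj(a). *)
- exists 1, (fun j : 'I_k => (nth 0 s j)^*); split=> [|j|z _]; first exact: normr1.
    by rewrite /unit_disk /= normC_lt1 nm_conj; apply: hs; rewrite mem_nth ?sk.
  rewrite mul1r (big_nth 0) sk big_mkord; apply: eq_bigr => j _.
  by rewrite conjCK.
exists f, (blaschke_coefs s); split.
- by apply/power_series_climP => z; exact: pvalP.
- by apply/power_series_climP => z; exact: blaschke_coefs_pseries.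
move=> x' hx'; pose x : dual_space hD := DualSpace (introT (asboolP (D x')) hx').
have [l [h1 h2]] := fE x; exists l; split; apply/series_climP.
  by move: h1; congr clim; apply/funext => n; apply: eq_bigr => j _; rewrite orb_dual_map.
by move: h2; congr clim; apply/funext => n; apply: eq_bigr => j _; rewrite orb_dual_map.
Qed.

Lemma negative_squares_of_pick k f B : schur_class f -> blaschke_product k B ->
  calculus_eq A b c D f B ->
  exists2 k', (k' <= k)%N & has_negative_squares D (hermitian_form A b c) k'.
Proof.
move=> fS [g [a [g1 a1 BE]]] [fs [Bs [/power_series_climP hf /power_series_climP hB hl]]].
pose s := [seq (a j)^* | j <- enum 'I_k].
have sk : size s = k by rewrite size_map size_enum_ord.
have hs : in_disk s.
  by move=> _ /mapP[j _ ->]; rewrite nm_conj -normC_lt1; exact: a1.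
have hk : negsq_le k (defect A' (ev c) (ev b)).
  rewrite -sk; apply: (negsq_le_interpolation (f := fs) (u := Bs) (g := g)) => //.
  - exact: nmr_eq1.
  - move=> z z1; exists (f z); first exact: hf.
    by rewrite -normC_le1; apply: (fS z _).2; rewrite /unit_disk /= normC_lt1.
  - move=> z z1; have := hB z z1; rewrite BE ?/unit_disk /= ?normC_lt1//.
    rewrite big_map big_enum /=; congr (clim _ (_ * _)).
    by apply: eq_bigr => j _; rewrite conjCK.
  - move=> x; have [l [/series_climP h1 /series_climP h2]] := hl _ (dual_valP x).
    exists l; split.
      by move: h1; congr clim; apply/funext => n; apply: eq_bigr => j _; rewrite orb_dual_map.
    by move: h2; congr clim; apply/funext => n; apply: eq_bigr => j _; rewrite orb_dual_map.
have lift x (hx : D x) : exists y : dual_space hD, x = y.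
  by exists (DualSpace (introT (asboolP (D x)) hx)).
have [_ h0 _] := hD.
apply: (has_negative_squares_bounded h0) => [x y /lift[{}x ->] /lift[{}y ->]|n x n0 hx].
  by rewrite !hermitian_formE; exact: (defect_hs hc hb).2.
rewrite (kernel_matrix_dual (dual_lift hx)).
exact: (negsq_le_count (defect_hs hc hb) _ hk).
Qed.

End Dual.
End Translation.

Theorem mainTheorem1 (R : realType) (V : lmodType R[i]) (A : {linear V -> V})
    (b c : V) (D : set (V -> R[i])) (hD : admissible A b c D) (k : nat) :
  (has_negative_squares D (hermitian_form A b c) k ->
     exists f B : R[i] -> R[i],
       [/\ schur_class f, blaschke_product k B & calculus_eq A b c D f B])
  /\
  ((exists f B : R[i] -> R[i],
       [/\ schur_class f, blaschke_product k B & calculus_eq A b c D f B]) ->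
     exists2 k' : nat, (k' <= k)%N &
       has_negative_squares D (hermitian_form A b c) k').
Proof.
have [[hsub hA] hsum _] := hD.
have hb := dual_l2_functional hsub hA (fun x hx => (hsum x hx).1).
have hc := dual_l2_functional hsub hA (fun x hx => (hsum x hx).2).
split; first by move=> h; exact: (pick_negative_squares hb hc h).
by move=> [f [B [hf hB hfB]]]; exact: (negative_squares_of_pick hb hc hf hB hfB).
Qed.
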